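(* Let $(\mathcal{X}^{(q)})_{0\le q\le Q_{\rm iter}}$ be the sequence of random systems of weighted replicas generated by an algorithm which enters into the Generalized Adaptive Multilevel Splitting (GAMS) framework described in the context; in particular Assumptions 1, 2 and 3 of the context hold. Assume moreover that the number of iterations is almost surely finite, $\mathbb{P}(Q_{\rm iter}<+\infty)=1$, and that one of the following conditions is satisfied: \begin{itemize} \item $Q_{\rm iter}$ is bounded from above by a deterministic constant; or \item (almost sure mass conservation) for every $q\ge 0$, $\sum_{n\in I^{(q)}}G^{(n,q)}=1$ almost surely. \end{itemize} Then for any bounded measurable test function $\varphi:\mathcal{P}\to\mathbb{R}$, $$\mathbb{E}\big(\hat{\pi}^{(Q_{\rm iter})}(\varphi)\big)=\pi(\varphi),\qquad\text{where}\quad \hat{\pi}^{(q)}(\varphi)=\sum_{n\in I^{(q)}}G^{(n,q)}\varphi(X^{(n,q)}),\quad \pi(\varphi)=\int_{\mathcal{P}}\varphi\,d\pi .$$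
   Context: **General setting.** $(\Omega,\mathcal{F},\mathbb{P})$ is a probability space, $\mathcal{P}$ a Polish space with Borel $\sigma$-field $\mathcal{B}(\mathcal{P})$, $\pi$ a probability measure on $\mathcal{P}$. $\mathcal{F}^1\vee\mathcal{F}^2$ is the smallest $\sigma$-field containing both; $\sqcup$ is disjoint union; $\mathbb{N}^*=\{1,2,\dots\}$. For a kernel $\Pi$, $\Pi(\varphi)(x)=\int\varphi(y)\,\Pi(x,dy)$. *Filtrations.* $(\mathrm{filt}_z)_{z\in\mathbb{R}}$ is a non-decreasing family of sub-$\sigma$-fields of $\mathcal{B}(\mathcal{P})$ (indices $z$ are called levels). For a random variable $X:\Omega\to\mathcal{P}$, $\mathrm{filt}_z^X=X^{-1}(\mathrm{filt}_z)$. A random system of replicas is $\mathcal{X}=(X^{(n)})_{n\in I}$ with $I\subset\mathbb{N}^*$ a random finite set of labels and $X^{(n)}\in\mathcal{P}$; the space of such systems is $\mathcal{P}^{\rm rep}=\bigsqcup_{J}\mathcal{P}^{J}$ ($J$ ranging over finite subsets of $\mathbb{N}^*$). On it, $\mathrm{filt}^{\rm rep}_z$ is the $\sigma$-field of sets whose intersection with each $\mathcal{P}^J$ belongs to the product $\sigma$-field $\mathrm{filt}_z^{\otimes J}$, and $\mathrm{filt}_z^{\mathcal{X}}=\mathcal{X}^{-1}(\mathrm{filt}_z^{\rm rep})$. By convention $\mathrm{filt}_{-\infty}^{\mathcal{X}}=\sigma(I)$ and $\mathrm{filt}_{+\infty}^{\mathcal{X}}=\mathcal{F}$. For weighted systems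 $(X^{(n)},G^{(n)})_{n\in I}$, $G^{(n)}\in\mathbb{R}_+$, the same notation is used. *Stopping level.* For a filtration $(\mathcal{F}_z)_z$ on $\Omega$, a stopping level $Z$ is a real-valued random variable with $\{Z\le z\}\in\mathcal{F}_z$ for all $z\in\mathbb{R}\cup\{-\infty,+\infty\}$; $\mathcal{F}_Z$ is the $\sigma$-field of events $A$ with $A\cap\{Z\le z\}\in\mathcal{F}_z$ for all $z\in\mathbb{R}$. *Resampling kernels.* $(z,x)\in\mathbb{R}\times\mathcal{P}\mapsto\pi_z(x,\cdot)$ is a Markov kernel from $\mathbb{R}\times\mathcal{P}$ to $\mathcal{P}$; by convention $\pi_{-\infty}(x,\cdot)=\pi$ and $\pi_{+\infty}(x,\cdot)=\delta_x$. **Assumption 1.** For any $x\in\mathcal{P}$ and any continuous bounded $\varphi:\mathcal{P}\to\mathbb{R}$, $z\in\mathbb{R}\mapsto\pi_z(\varphi)(x)$ is right-continuous, and $\lim_{z\to-\infty}\pi_z(\varphi)(x)=\pi_{-\infty}(\varphi)(x)=\pi(\varphi)$. **Assumption 2.** If $X$ is distributed according to $\pi_z(x,\cdot)$ for some $(z,x)\in\mathbb{R}\times\mathcal{P}$, then for any $z'\ge z$ and any bounded measurable $\varphi:\mathcal{P}\to\mathbb{R}$, $\mathbb{E}(\varphi(X)\mid\mathrm{filt}_{z'}^X)=\pi_{z'}(\varphi)(X)$ a.s. **Sampling convention.** ''$X_2$ is sampled conditionally on $X_1$ with law $\Pi(X_1,\cdot)$'' means $X_2=f(X_1,U)$ a.s.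 with $f$ measurable, $\Pi(x_1,\cdot)=\mathrm{Law}(f(x_1,U))$ for $\mathrm{Law}(X_1)$-almost every $x_1$, and $U$ independent of $X_1$ and of all random variables introduced before. ''Sampled conditionally on a $\sigma$-field $\mathcal{G}$'' means a measurable function of $\mathcal{G}$-measurable variables and of such a fresh independent $U$. **GAMS framework.** *Initialization ($q=0$).* $I^{(0)}=\{1,\dots,\mathrm{card}\,I^{(0)}\}$, finite and nonempty; $(X^{(n,0)})_{n\in I^{(0)}}$ i.i.d. with law $\pi$; $G^{(n,0)}=1/\mathrm{card}\,I^{(0)}$; $\mathcal{X}^{(0)}=(X^{(n,0)},G^{(n,0)})_{n\in I^{(0)}}$; $\mathcal{F}^{(0)}_z=\mathrm{filt}_z^{\mathcal{X}^{(0)}}$; $Z^{(0)}$ is a stopping level for $(\mathcal{F}^{(0)}_z)_z$; $\mathcal{F}^{(0)}=\mathcal{F}^{(0)}_{Z^{(0)}}$. *Iteration $q\ge 0$.* (1) Stopping criterion: $S^{(q)}\in\{0,1\}$ is an $\mathcal{F}^{(q)}$-measurable random variable. If $S^{(q)}=0$ the algorithm stops and $Q_{\rm iter}=q$; otherwise continue. Thus $Q_{\rm iter}=\inf\{q\ge0:S^{(q)}=0\}$ ($\inf\emptyset=+\infty$). (2) Splitting step. Sample, conditionally on $\mathcal{F}^{(q)}$, $\mathbb{N}$-valued branching numbers $(B^{(n,q+1)})_{n\in I^{(q)}}$ with $\mathbb{E}(B^{(n,q+1)}\mid\mathcal{F}^{(q)})>0$ a.s. for any $n\in I^{(q)}$.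 Set $I^{(q+1)}_{\rm killed}=\{n\in I^{(q)}:B^{(n,q+1)}=0\}$, $K^{(q+1)}=\sum_{n\in I^{(q)}}\max\{B^{(n,q+1)}-1,0\}$, $I^{(q+1)}_{\rm new}=\{\max I^{(q)}+1,\dots,\max I^{(q)}+K^{(q+1)}\}$ (the labeling is purely conventional), $I^{(q+1)}=(I^{(q)}\setminus I^{(q+1)}_{\rm killed})\sqcup I^{(q+1)}_{\rm new}$. Choose (conditionally on $\mathcal{F}^{(q)}$, as for the branching numbers) a children-parent map $P^{(q+1)}:I^{(q+1)}_{\rm new}\to I^{(q)}\setminus I^{(q+1)}_{\rm killed}$ such that each $n\in I^{(q)}\setminus I^{(q+1)}_{\rm killed}$ has exactly $B^{(n,q+1)}-1$ preimages, and extend it to $I^{(q+1)}$ by $P^{(q+1)}(n)=n$ for $n\in I^{(q)}\setminus I^{(q+1)}_{\rm killed}$. Weights: for $n'\in I^{(q+1)}$ with $P^{(q+1)}(n')=n$, $G^{(n',q+1)}=G^{(n,q)}/\mathbb{E}(B^{(n,q+1)}\mid\mathcal{F}^{(q)})$. (3) Resampling step. $X^{(n,q+1)}=X^{(n,q)}$ for $n\in I^{(q)}\setminus I^{(q+1)}_{\rm killed}$. For $n'\in I^{(q+1)}_{\rm new}$, $X^{(n',q+1)}$ is sampled (independently for different $n'$) according to $\pi_{Z^{(q)}}(X^{(P^{(q+1)}(n'),q)},\cdot)$. Set $\mathcal{X}^{(q+1)}=(X^{(n,q+1)},G^{(n,q+1)})_{n\in I^{(q+1)}}$. (4) Level computation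 step. $\mathcal{F}^{(q+1)}_z=\mathcal{F}^{(q)}\vee\sigma(P^{(q+1)})\vee\mathrm{filt}_z^{\mathcal{X}^{(q+1)}}$ (where $\sigma(P^{(q+1)})$ contains $\sigma((B^{(n,q+1)})_{n\in I^{(q)}})$). $Z^{(q+1)}$ is a stopping level for $(\mathcal{F}^{(q+1)}_z)_z$ with $Z^{(q+1)}\ge Z^{(q)}$ a.s. Set $\mathcal{F}^{(q+1)}=\mathcal{F}^{(q+1)}_{Z^{(q+1)}}$. For theoretical purposes $\mathcal{X}^{(q)}$ and $\mathcal{F}^{(q)}$ are defined for all $q\ge0$ by running (2)–(4) without ever stopping. **Assumption 3.** The variables $(S^{(q)})$, $(B^{(n,q+1)})$, $(Z^{(q)})$ satisfy the requirements listed in the description above: $S^{(q)}$ is $\{0,1\}$-valued and $\mathcal{F}^{(q)}$-measurable; the branching numbers are $\mathbb{N}$-valued, sampled conditionally on $\mathcal{F}^{(q)}$, with $\mathbb{E}(B^{(n,q+1)}\mid\mathcal{F}^{(q)})>0$ a.s.; $Z^{(q)}$ is a real-valued $(\mathcal{F}^{(q)}_z)_z$-stopping level with $Z^{(q+1)}\ge Z^{(q)}$.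
   Formalization: Assumption 2 is also required at the starting level z = -∞, where π_z(x,·) = π: if X has law π, then E(φ(X)|filt_{z'}^X) = π_{z'}(φ)(X) a.s. for every real z'; with real starting levels only, the claim is false. E(B|F^(q)) is taken to be a.s. finite. *)

(* Defs.v *)
From HB Require Import structures.
From mathcomp Require Import all_boot all_order all_algebra finmap.
From mathcomp Require Import all_classical all_reals all_analysis.

Set Implicit Arguments.
Unset Strict Implicit.
Unset Printing Implicit Defensive.
Import Order.TTheory GRing.Theory Num.Theory.
Import numFieldNormedType.Exports.
Local Open Scope classical_set_scope.
Local Open Scope ring_scope.

(* sigma-fields on a type are represented as sets of sets *)

Definition polish (R : realType) (T : topologicalType) : Prop :=
  (exists dist : T -> T -> R,
    [/\ forall x y, dist x y = 0 <-> x = y,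
        forall x y, dist x y = dist y x,
        forall x y z, dist x z <= dist x y + dist y z,
        forall x (V : set T),
          nbhs x V <-> exists2 e : R, 0 < e & forall y, dist x y < e -> V y
      & forall u : nat -> T,
          (forall e : R, 0 < e -> exists N, forall m n,
             (N <= m)%N -> (N <= n)%N -> dist (u m) (u n) < e) ->
          exists l : T, u @ \oo --> l]) /\
  (exists2 D : set T, countable D & dense D).

Definition borel (T : ptopologicalType) := g_sigma_algebraType (@open T).

Definition measurable_wrt (Om : Type) (H : set (set Om)) d'
    (T' : measurableType d') (Y : Om -> T') : Prop :=
  forall B, measurable B -> H (Y @^-1` B).

Definition sigma_of (Om : Type) d' (T' : measurableType d') (Y : Om -> T') :
    set (set Om) :=
  preimage_set_system setT Y (@measurable _ T').

(* sigma-field generated by a variable with values in a countable set *)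
Definition sigma_of_discrete (Om T' : Type) (Y : Om -> T') : set (set Om) :=
  preimage_set_system setT Y setT.

Definition join_sigma (Om : Type) (H1 H2 : set (set Om)) : set (set Om) :=
  <<s H1 `|` H2 >>.

Definition prod_sigma (T1 T2 : Type) (H1 : set (set T1)) (H2 : set (set T2)) :
    set (set (T1 * T2)) :=
  join_sigma (preimage_set_system setT fst H1) (preimage_set_system setT snd H2).

(* disjoint union of the T^J, J ranging over the finite sets of labels *)
Definition sys (T : Type) := {J : {fset nat} & J -> T}.

(* The families indexed by labels are total functions on nat; only their
   values on the current set of labels are meaningful, and only those are
   recorded in the system. *)
Definition restr (T : Type) (J : {fset nat}) (f : nat -> T) : sys T :=
  existT (fun J : {fset nat} => J -> T) J (fun j => f (val j)).

Definition pow_sigma (T : Type) (H : set (set T)) (J : {fset nat}) :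
    set (set (J -> T)) :=
  <<s \bigcup_(j in [set: J])
        preimage_set_system setT (fun x : J -> T => x j) H >>.

Definition rep_sigma (T : Type) (H : set (set T)) : set (set (sys T)) :=
  [set C | forall J : {fset nat},
     pow_sigma H [set x : J -> T |
       C (existT (fun J : {fset nat} => J -> T) J x)]].

Section probability_notions.
Context d (Om : measurableType d) (R : realType) (P : probability Om R).

(* [Y] is a (real-valued) version of E(X | H), for [X] integrable or
   nonnegative; integrals are extended-real valued, so that a nonnegative [X]
   need not be integrable. *)
Definition is_cexp (H : set (set Om)) (X Y : Om -> R) : Prop :=
  measurable_wrt H Y /\
  forall A, H A ->
    (\int[P]_(w in A) (X w)%:E = \int[P]_(w in A) (Y w)%:E)%E.

(* E(X | H) = Y almost surely *)
Definition cexp_ae (H : set (set Om)) (X Y : Om -> R) : Prop :=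
  exists2 Y', is_cexp H X Y' & {ae P, forall w, Y' w = Y w}.

Definition mutually_independent (K : choiceType) (H : K -> set (set Om)) : Prop :=
  forall (J : {fset K}) (A : K -> set Om),
    (forall k, k \in J -> H k (A k)) ->
    P (\bigcap_(k in [set` J]) A k) = (\prod_(k <- J) fine (P (A k)))%:E.

End probability_notions.

Section levels.
Context (R : realType) (T : ptopologicalType).

Definition level_filtration (filt : R -> set (set T)) : Prop :=
  [/\ forall z, sigma_algebra setT (filt z),
      forall z, filt z `<=` @measurable _ (borel T)
    & forall z z', z <= z' -> filt z `<=` filt z'].

Variables (filt : R -> set (set T)) (pi0 : probability (borel T) R).
Variable pik : R.-pker (measurableTypeR R * borel T)%type ~> borel T.

Definition pi_ext (z : \bar R) (x : T) : {measure set (borel T) -> \bar R} :=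
  match z with
  | r%:E => pik (r, x)
  | -oo%E => pi0
  | +oo%E => \d_(x : borel T)
  end.

Definition assumption1 : Prop :=
  forall (x : T) (phi : T -> R), continuous phi -> bounded_fun phi ->
    (forall z : R,
       (\int[pik (r, x)]_y phi y) @[r --> z^'+] --> \int[pik (z, x)]_y phi y) /\
    (\int[pik (r, x)]_y phi y) @[r --> -oo] --> \int[pi0]_y phi y.

(* The starting level [z] may be -oo, where pi_z(x, .) is pi0: the convergence
   of pi_z to pi0 in [assumption1] is only weak and does not carry the
   identity below over to pi0. *)
Definition assumption2 : Prop :=
  forall d' (Om : measurableType d') (P : probability Om R)
    (X : {RV P >-> borel T}) (z : \bar R) (x : T),
    (forall A, measurable A -> distribution P X A = pi_ext z x A) ->
    forall z' : R, (z <= z'%:E)%E ->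
    forall phi : borel T -> R, measurable_fun setT phi -> bounded_fun phi ->
      cexp_ae P (preimage_set_system setT X (filt z'))
        (phi \o X) (fun w => \int[pik (z', X w)]_y phi y).

End levels.

Section filtrations.
Context d (Om : measurableType d) (R : realType) (T : ptopologicalType).
Variable filt : R -> set (set T).

(* filtration generated by a random system of weighted replicas: the weights
   are visible at every finite level *)
Definition filt_sys (Xs : Om -> sys (T * R)) (z : \bar R) : set (set Om) :=
  match z with
  | r%:E => preimage_set_system setT Xs
              (rep_sigma (prod_sigma (filt r) (@measurable _ (measurableTypeR R))))
  | -oo%E => sigma_of_discrete (fun w => projT1 (Xs w))
  | +oo%E => measurable
  end.

Definition stopping_level (F : \bar R -> set (set Om)) (Z : Om -> R) : Prop :=
  forall z : \bar R, F z [set w | ((Z w)%:E <= z)%E].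

Definition stopped_sigma (F : \bar R -> set (set Om)) (Z : Om -> R) :
    set (set Om) :=
  [set A | measurable A /\ forall z : R, F z%:E (A `&` [set w | Z w <= z])].

End filtrations.

Section gams.
Context d (Om : measurableType d) (R : realType) (T : ptopologicalType).
Context dU (U : measurableType dU).

(* [usplit q] and [ures q n] are the fresh random sources used in the
   splitting step, resp. for the resampling of label [n], of iteration [q]. *)
Record gams := Gams {
  lab : nat -> Om -> {fset nat} ;    (* I^(q) *)
  rep : nat -> nat -> Om -> T ;      (* rep q n = X^(n,q) *)
  wgt : nat -> nat -> Om -> R ;      (* wgt q n = G^(n,q) *)
  lev : nat -> Om -> R ;             (* Z^(q) *)
  go : nat -> Om -> bool ;           (* S^(q) *)
  brn : nat -> nat -> Om -> nat ;    (* brn q n = B^(n,q+1) *)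
  par : nat -> nat -> Om -> nat ;    (* par q n = P^(q+1)(n) *)
  usplit : nat -> Om -> U ;
  ures : nat -> nat -> Om -> U }.

Variables (P : probability Om R) (pi0 : probability (borel T) R).
Variables (filt : R -> set (set T)).
Variable pik : R.-pker (measurableTypeR R * borel T)%type ~> borel T.
Variable a : gams.

Definition wsys (q : nat) (w : Om) : sys (T * R) :=
  restr (lab a q w) (fun n => (rep a q n w, wgt a q n w)).

Definition brn_sys (q : nat) (w : Om) : sys nat :=
  restr (lab a q w) (fun n => brn a q n w).

Definition par_sys (q : nat) (w : Om) : sys nat :=
  restr (lab a q.+1 w) (fun n => par a q n w).

Definition killed (q : nat) (w : Om) : {fset nat} :=
  [fset n in lab a q w | brn a q n w == 0%N]%fset.

Definition survivors (q : nat) (w : Om) : {fset nat} :=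
  (lab a q w `\` killed q w)%fset.

(* [(brn a q n w - 1)%N] is truncated, i.e. max (B - 1) 0 *)
Definition newlab (q : nat) (w : Om) : {fset nat} :=
  [fset n in iota (\max_(n <- lab a q w) n).+1
                  (\sum_(n <- lab a q w) (brn a q n w - 1))]%fset.

(* Flev q z = F^(q)_z *)
Fixpoint Flev (q : nat) : \bar R -> set (set Om) :=
  match q with
  | 0%N => filt_sys filt (wsys 0)
  | p.+1 => fun z =>
      join_sigma (join_sigma (stopped_sigma (Flev p) (lev a p))
                             (sigma_of_discrete (par_sys p)))
                 (filt_sys filt (wsys p.+1) z)
  end.

Definition Fq (q : nat) : set (set Om) := stopped_sigma (Flev q) (lev a q).

Definition sigma_wsys (q : nat) : set (set Om) :=
  preimage_set_system setT (wsys q)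
    (rep_sigma (prod_sigma (@measurable _ (borel T))
                           (@measurable _ (measurableTypeR R)))).

(* sigma-field of all the random variables introduced before the splitting
   step of iteration q, and (below) before its resampling step *)
Fixpoint hist (q : nat) : set (set Om) :=
  match q with
  | 0%N => <<s sigma_wsys 0 `|` sigma_of (lev a 0) `|` sigma_of (go a 0) >>
  | p.+1 => <<s hist p `|` sigma_of (usplit a p)
              `|` sigma_of_discrete (brn_sys p) `|` sigma_of_discrete (par_sys p)
              `|` (\bigcup_n sigma_of (ures a p n))
              `|` sigma_wsys p.+1
              `|` sigma_of (lev a p.+1) `|` sigma_of (go a p.+1) >>
  end.

Definition hist_split (q : nat) : set (set Om) :=
  <<s hist q `|` sigma_of (usplit a q)
    `|` sigma_of_discrete (brn_sys q) `|` sigma_of_discrete (par_sys q) >>.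

(* B^(n,q+1), extended by 0 on the event that n is not a label *)
Definition brn0 (q n : nat) (w : Om) : R :=
  if n \in lab a q w then (brn a q n w)%:R else 0.

(* The branching numbers and the children-parent map of iteration q are
   sampled conditionally on F^(q): [V] is F^(q)-measurable and [usplit a q] is
   the fresh randomness; (sys nat * sys nat) is countable, hence carries the
   discrete sigma-field. *)
Definition split_sampling (q : nat) : Prop :=
  [/\ measurable_fun setT (usplit a q),
      sigma_of_discrete (brn_sys q) `|` sigma_of_discrete (par_sys q)
        `<=` measurable,
      mutually_independent P
        (fun b : bool => if b then hist q else sigma_of (usplit a q))
    & exists d' (T' : measurableType d') (V : Om -> T')
        (f : T' * U -> sys nat * sys nat),
        [/\ measurable_wrt (Fq q) V,
            forall C, measurable (f @^-1` C)
          & {ae P, forall w,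
               (brn_sys q w, par_sys q w) = f (V w, usplit a q w)}]].

Definition resampling (q : nat) : Prop :=
  [/\ forall n, measurable_fun setT (ures a q n),
      mutually_independent P (fun k : option nat =>
        if k is Some n then sigma_of (ures a q n) else hist_split q)
    & forall n, exists f : (measurableTypeR R * borel T) * U -> borel T,
        [/\ measurable_fun setT f,
            {ae P, forall w, n \in newlab q w ->
               forall A, measurable A ->
               P [set w' | A (f ((lev a q w, rep a q (par a q n w) w),
                                 ures a q n w'))]
               = pik (lev a q w, rep a q (par a q n w) w) A}
          & {ae P, forall w, n \in newlab q w ->
               rep a q.+1 n w =
               f ((lev a q w, rep a q (par a q n w) w), ures a q n w)}]].

Record assumption3 : Prop := Assumption3 {
  a3_go : forall q, measurable_wrt (Fq q) (go a q) ;
  a3_split : forall q, split_sampling q ;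
  a3_brn_gt0 : forall q n, exists2 Y, is_cexp P (Fq q) (brn0 q n) Y &
    {ae P, forall w, n \in lab a q w -> 0 < Y w} ;
  a3_lev : forall q, stopping_level (Flev q) (lev a q) ;
  a3_lev_le : forall q, {ae P, forall w, lev a q w <= lev a q.+1 w} }.

Record gams_framework : Prop := GamsFramework {
  wsys_measurable : forall q, sigma_wsys q `<=` measurable ;
  wgt_ge0 : forall q n w, n \in lab a q w -> 0 <= wgt a q n w ;
  lab_init : forall w, exists2 k, (0 < k)%N &
    lab a 0 w = [fset n in iota 1 k]%fset ;
  (* given card I^(0) = k, the initial replicas are i.i.d. of law pi0; if
     card I^(0) is deterministic, they are just i.i.d. of law pi0 *)
  rep_init : forall k (A : nat -> set (borel T)),
    (forall n, measurable (A n)) ->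
    let Ik := [set w | lab a 0 w = [fset n in iota 1 k]%fset] in
    P (Ik `&` [set w | forall n, n \in iota 1 k -> A n (rep a 0 n w)]) =
    (P Ik * (\prod_(n <- iota 1 k) fine (pi0 (A n)))%:E)%E ;
  wgt_init : forall n w, n \in lab a 0 w ->
    wgt a 0 n w = (#|` lab a 0 w|%:R)^-1 ;
  lab_next : forall q w,
    lab a q.+1 w = (survivors q w `|` newlab q w)%fset ;
  par_new : forall q n w, n \in newlab q w -> par a q n w \in survivors q w ;
  par_card : forall q n w, n \in survivors q w ->
    #|` [fset m in newlab q w | par a q m w == n]%fset| = (brn a q n w - 1)%N ;
  par_old : forall q n w, n \in survivors q w -> par a q n w = n ;
  wgt_next : forall q n Y, is_cexp P (Fq q) (brn0 q n) Y ->
    {ae P, forall w, forall m, m \in lab a q.+1 w -> par a q m w = n ->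
       wgt a q.+1 m w = wgt a q n w / Y w} ;
  rep_old : forall q n w, n \in survivors q w -> rep a q.+1 n w = rep a q n w ;
  rep_new : forall q, resampling q }.

(* inf {q | S^(q) = 0}; [None] stands for +oo *)
Definition Qiter (w : Om) : option nat :=
  match pselect (exists q, ~~ go a q w) with
  | left h => Some (ex_minn h)
  | right _ => None
  end.

Definition estimator (q : nat) (phi : T -> R) (w : Om) : R :=
  \sum_(n <- lab a q w) wgt a q n w * phi (rep a q n w).

(* the value on the event that Qiter is infinite is immaterial *)
Definition final_estimator (phi : T -> R) (w : Om) : R :=
  if Qiter w is Some q then estimator q phi w else 0.

End gams.

(* Main.v *)
Require Import Defs.
From HB Require Import structures.
From mathcomp Require Import all_boot all_order all_algebra finmap.
From mathcomp Require Import all_classical all_reals all_analysis.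
From mathcomp Require Import measurable_realfun ring lra.

Set Implicit Arguments.
Unset Strict Implicit.
Unset Printing Implicit Defensive.
Import Order.TTheory GRing.Theory Num.Theory.
Import numFieldNormedType.Exports.
Local Open Scope classical_set_scope.
Local Open Scope ring_scope.

(* Conditionally on the labels, the weights, the genealogy and the other replicas,
   a replica of iteration q+1 has the law pi_(Z^(q)) (parent, .) it was sampled
   from, while a replica of iteration 0 has law pi.
   Assumption 2 propagates such a law to any later deterministic level z: given
   the information of level z, phi(X) may be replaced by pi_z(phi)(X). By
   right-continuity this extends to the stopping level Z^(q): given F^(q) and the
   other replicas, phi(X^(n,q)) may be replaced by pi_(Z^(q))(phi)(X^(n,q)). Hence
   a surviving replica looks exactly like its own resampled children, and the
   conditional laws are those of the first sentence again at the next iteration.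
   Since the weights divide by E(B | F^(q)), the sum over the children of
   G * phi has the same conditional expectation as the sum over the parents: the
   estimators form a martingale for (F^(q)). Optional stopping at Q_iter follows
   from the boundedness of Q_iter, or from that of the estimators. *)

(** * Integration functionals *)

Section integral_functionals.
Local Open Scope ereal_scope.
Context d (X : measurableType d) (R : realType).
Implicit Types (f g : X -> \bar R) (L : (X -> \bar R) -> \bar R).

Definition nnmeas f := measurable_fun setT f /\ forall x, 0 <= f x.

(* Nonnegative functionals with the properties of an integral: densities,
   images and mixtures of measures can then be compared without being built as
   measures. *)
Record is_int L : Prop := IsInt {
  int_ge0 : forall f, nnmeas f -> 0 <= L f ;
  int_add : forall f g, nnmeas f -> nnmeas g ->
    L (fun x => f x + g x) = L f + L g ;
  int_scale : forall (c : R) f, (0 <= c)%R -> nnmeas f ->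
    L (fun x => c%:E * f x) = c%:E * L f ;
  int_cvg : forall (f_ : nat -> X -> \bar R) f,
    (forall n, nnmeas (f_ n)) -> nnmeas f ->
    (forall x, nondecreasing_seq (f_ ^~ x)) ->
    (forall x, f_ ^~ x @ \oo --> f x) ->
    L (f_ n) @[n --> \oo] --> L f }.

Lemma nnmeas_indic (A : set X) :
  measurable A -> nnmeas (fun x => (\1_A x)%:E).
Proof.
by move=> mA; split=> [|x]; [exact/measurable_EFinP|rewrite lee_fin].
Qed.

Lemma nnmeas_EFin (h : X -> R) : measurable_fun setT h ->
  (forall x, 0 <= h x)%R -> nnmeas (fun x => (h x)%:E).
Proof.
by move=> mh h0; split=> [|x]; [exact/measurable_EFinP|rewrite lee_fin].
Qed.

Lemma nnmeasM f g : nnmeas f -> nnmeas g -> nnmeas (fun x => f x * g x).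
Proof.
move=> [mf f0] [mg g0]; split=> [|x]; last exact: mule_ge0.
exact: emeasurable_funM.
Qed.

Import HBNNSimple.

Lemma int_unique_sets L1 L2 : is_int L1 -> is_int L2 ->
  (forall A, measurable A ->
    L1 (fun x => (\1_A x)%:E) = L2 (fun x => (\1_A x)%:E)) ->
  forall f, nnmeas f -> L1 f = L2 f.
Proof.
move=> i1 i2 eqA f nf; have [mf f0] := nf.
pose f_ := nnsfun_approx measurableT mf.
have nf_ n : nnmeas (fun x => (f_ n x)%:E).
  by split=> [|x]; [exact/measurable_EFinP|rewrite lee_fin].
have L_ n : L1 (fun x => (f_ n x)%:E) = L2 (fun x => (f_ n x)%:E).
  have E : (fun x => (f_ n x)%:E) = (fun x => \sum_(y <- fset_set (range (f_ n)))
      (y%:E * (\1_(f_ n @^-1` [set y]) x)%:E)).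
    apply/funext => x; rewrite fimfunE fsbig_finite//=.
    by rewrite -sumEFin.
  have ny y : (0 <= y)%R ->
      nnmeas (fun x => y%:E * (\1_(f_ n @^-1` [set y]) x)%:E).
    move=> y0; apply: nnmeasM; last exact: nnmeas_indic.
    by split => // x; rewrite lee_fin.
  have Ey L y : is_int L -> (0 <= y)%R ->
      L (fun x => y%:E * (\1_(f_ n @^-1` [set y]) x)%:E) =
      y%:E * L (fun x => (\1_(f_ n @^-1` [set y]) x)%:E).
    by move=> iL y0; apply: int_scale => //; exact: nnmeas_indic.
  rewrite E; have : forall y, y \in enum_fset (fset_set (range (f_ n))) -> (0 <= y)%R.
    by move=> y; rewrite in_fset_set// !inE => -[x _ <-].
  elim: (enum_fset (fset_set (range (f_ n)))) => [|y s ih] s0.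
    have z : (fun x : X => \sum_(y <- [::])
        y%:E * (\1_(f_ n @^-1` [set y]) x)%:E) =
        (fun x => 0%:E * (\1_(@set0 X) x)%:E).
      by apply/funext => x; rewrite big_nil mul0e.
    rewrite z (int_scale i1)//; last exact: nnmeas_indic.
    rewrite (int_scale i2)//; last exact: nnmeas_indic.
    by rewrite !mul0e.
  have y0 : (0 <= y)%R by have := s0 y (mem_head _ _).
  under [X in L1 X]eq_fun do rewrite big_cons.
  under [X in L2 X]eq_fun do rewrite big_cons.
  have ns : nnmeas (fun x : X => \sum_(y <- s)
        y%:E * (\1_(f_ n @^-1` [set y]) x)%:E).
    have : forall y, y \in s -> (0 <= y)%R.
      by move=> z zs; apply: s0; rewrite inE zs orbT.
    elim: {ih s0} s => [_|z s ih s0].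
      by under eq_fun do rewrite big_nil; split => //.
    have [m1 h1] := ny z (s0 z (mem_head _ _)).
    have [|m2 h2] := ih.
      by move=> u us; apply: s0; rewrite inE us orbT.
    under eq_fun do rewrite big_cons; split; last first.
      by move=> x; exact: adde_ge0.
    exact: emeasurable_funD.
  rewrite (int_add i1)//; last exact: ny.
  rewrite (int_add i2)//; last exact: ny.
  rewrite ih; last by move=> z zs; apply: s0; rewrite inE zs orbT.
  by rewrite !Ey// eqA.
have c1 := @int_cvg _ i1 (fun n x => (f_ n x)%:E) f nf_ nf.
have c2 := @int_cvg _ i2 (fun n x => (f_ n x)%:E) f nf_ nf.
have nd x : nondecreasing_seq (fun n => (f_ n x)%:E).
  by move=> m n mn; rewrite lee_fin; exact/lefP/nd_nnsfun_approx.
have cv x : (f_ n x)%:E @[n --> \oo] --> f x by exact: cvg_nnsfun_approx.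
rewrite -(cvg_lim _ (c1 nd cv))// -(cvg_lim _ (c2 nd cv))//.
by congr (limn _); exact/funext.
Qed.

Lemma int_unique_pi (G : set (set X)) L1 L2 : is_int L1 -> is_int L2 ->
  @measurable _ X = <<s G >> -> setI_closed G ->
  L1 (fun=> 1) = L2 (fun=> 1) -> L1 (fun=> 1) < +oo ->
  (forall A, G A -> L1 (fun x => (\1_A x)%:E) = L2 (fun x => (\1_A x)%:E)) ->
  forall f, nnmeas f -> L1 f = L2 f.
Proof.
move=> i1 i2 mG GI L1T Lfin LG; apply: int_unique_sets => //.
have iT : (fun x : X => (\1_(@setT X) x)%:E : \bar R) = (fun=> 1).
  by apply/funext => x; rewrite indicT.
have setD L A B : is_int L -> measurable A -> measurable B -> B `<=` A ->
    L (fun x => (\1_(A `\` B) x)%:E) + L (fun x => (\1_B x)%:E) =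
    L (fun x => (\1_A x)%:E).
  move=> iL mA mB BA; rewrite -int_add//; last 2 first.
    by apply: nnmeas_indic; exact: measurableD.
    exact: nnmeas_indic.
  congr L; apply/funext => x; rewrite -EFinD; congr EFin.
  rewrite !indicE in_setD; case: (boolP (x \in B)) => xB /=.
    by rewrite andbF add0r (_ : x \in A)//; move: xB; rewrite !inE; exact: BA.
  by rewrite andbT addr0.
have fin L A : is_int L -> L (fun=> 1) < +oo -> measurable A ->
    L (fun x => (\1_A x)%:E) \is a fin_num.
  move=> iL LT mA; rewrite ge0_fin_numE ?int_ge0//; last exact: nnmeas_indic.
  apply: le_lt_trans LT; rewrite -iT -(setD L setT A)//.
  by rewrite leeDr// int_ge0//; apply: nnmeas_indic; exact: measurableD.
pose H := [set A : set X | measurable A /\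
   L1 (fun x => (\1_A x)%:E) = L2 (fun x => (\1_A x)%:E)].
suff : @measurable _ X `<=` H by move=> h A /h[].
rewrite mG; apply: lambda_system_subset => //.
- split => //.
  + by rewrite /H /= iT; split => //.
  + move=> A B BA [mA HA] [mB HB]; split; first exact: measurableD.
    have fB : L2 (fun x => (\1_B x)%:E) \is a fin_num by apply: fin => //; rewrite -L1T.
    rewrite -[LHS](addeK _ fB) -[RHS](addeK _ fB); congr (_ - _).
    by rewrite -{1}HB !setD.
  + move=> F ndF HF; split; first by apply: bigcupT_measurable => i; exact: (HF i).1.
    have c L : is_int L -> L (fun x => (\1_(F n) x)%:E) @[n --> \oo] -->
        L (fun x => (\1_(\bigcup_i F i) x)%:E).
      move=> iL; apply: (int_cvg iL).
      * by move=> n; apply: nnmeas_indic; exact: (HF n).1.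
      * by apply: nnmeas_indic; apply: bigcupT_measurable => i; exact: (HF i).1.
      * move=> x m n mn; rewrite lee_fin !indicE.
        case: (boolP (x \in F m)) => // xm; rewrite (_ : x \in F n) ?lexx//.
        by move: xm; rewrite !inE; have /subsetPset := ndF _ _ mn; exact.
      * move=> x; apply/fine_cvgP; split; first exact: nearW.
        case: (boolP (x \in \bigcup_i F i)) => xF.
          move: (xF); rewrite inE => -[i _ Fix].
          apply: cvg_near_cst; exists i => // n /= ni.
          rewrite !indicE xF mem_set//.
          by have /subsetPset := ndF _ _ ni; exact.
        apply: cvg_near_cst; apply: nearW => n /=.
        rewrite !indicE (negbTE xF); case: (boolP (x \in F n)) => //.
        move=> xn; move: xF; rewrite notin_setE => -[]; exists n => //.
        by move: xn; rewrite inE.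
    rewrite -(cvg_lim _ (c L1 i1))// -(cvg_lim _ (c L2 i2))//.
    by congr (limn _); apply/funext => n; exact: (HF n).2.
- by move=> A GA; split; [rewrite mG; exact: sub_sigma_algebra|exact: LG].
Qed.

End integral_functionals.

Section int_examples.
Local Open Scope ereal_scope.
Context d (X : measurableType d) (R : realType).

Lemma int_comp d' (Y : measurableType d') (mu : {measure set Y -> \bar R})
    (h : Y -> R) (M : Y -> (X -> \bar R) -> \bar R) :
  measurable_fun setT h -> (forall y, 0 <= h y)%R -> (forall y, is_int (M y)) ->
  (forall f, nnmeas f -> measurable_fun setT (M ^~ f)) ->
  is_int (fun f => \int[mu]_y ((h y)%:E * M y f)).
Proof.
move=> mh h0 iM mM.
have nM f : nnmeas f -> nnmeas (fun y => (h y)%:E * M y f).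
  move=> nf; apply: nnmeasM; first exact: nnmeas_EFin.
  by split=> [|y]; [exact: mM|exact: int_ge0].
split.
- by move=> f /nM nf; apply: integral_ge0 => y _; exact: nf.2.
- move=> f g nf ng; rewrite -ge0_integralD//; last 4 first.
  + by move=> x _; exact: (nM _ nf).2.
  + exact: (nM _ nf).1.
  + by move=> x _; exact: (nM _ ng).2.
  + exact: (nM _ ng).1.
  by apply: eq_integral => y _; rewrite int_add// ge0_muleDr ?int_ge0.
- move=> c f c0 nf; rewrite -ge0_integralZl_EFin//; last 2 first.
  + by move=> x _; exact: (nM _ nf).2.
  + exact: (nM _ nf).1.
  by apply: eq_integral => y _; rewrite int_scale// muleCA.
- move=> f_ f nf_ nf nd cf.
  have cM y : M y (f_ n) @[n --> \oo] --> M y f by exact: int_cvg.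
  have ndM y : nondecreasing_seq (fun n => M y (f_ n)).
    move=> m n mn.
    pose g x := if (f_ m x == +oo) then 0 else f_ n x - f_ m x.
    have mgt : measurable [set x | f_ m x == +oo].
      rewrite (_ : mkset _ = f_ m @^-1` [set +oo]).
        by rewrite -[X in measurable X]setTI; apply: (nf_ m).1.
      by apply/seteqP; split => x /eqP.
    have ng : nnmeas g.
      split.
        apply: measurable_fun_ifT => //.
          apply: (measurable_fun_bool true); rewrite setTI.
          by rewrite (_ : _ @^-1` _ = [set x | f_ m x == +oo])//.
        apply: emeasurable_funB; [exact: (nf_ n).1|exact: (nf_ m).1].
      move=> x; rewrite /g; case: ifPn => // fm.
      rewrite sube_ge0; first exact: nd.
      by rewrite ge0_fin_numE ?lt_neqAle ?leey ?fm//; exact: (nf_ m).2.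
    have -> : f_ n = (fun x => f_ m x + g x).
      apply/funext => x; rewrite /g; case: ifPn => [/eqP fm|fm].
        by rewrite adde0; have := nd x m n mn; rewrite /= fm leye_eq => /eqP.
      rewrite addeC subeK// ge0_fin_numE ?lt_neqAle ?leey ?fm//.
      exact: (nf_ m).2.
    by rewrite int_add// leeDl// int_ge0.
  have -> : (fun y => (h y)%:E * M y f) =
      (fun y => limn (fun n => (h y)%:E * M y (f_ n))).
    apply/funext => y; apply/esym/cvg_lim => //.
    exact: cvgeZl.
  apply: cvg_monotone_convergence => //.
  + by move=> n; exact: (nM _ (nf_ n)).1.
  + by move=> n y _; exact: (nM _ (nf_ n)).2.
  + by move=> y _ m n mn; apply: lee_wpmul2l; rewrite ?lee_fin//; exact: ndM.
Qed.

Lemma int_dirac (x : X) : is_int (fun f : X -> \bar R => f x).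
Proof.
by split=> [f nf|f g nf ng|c f c0 nf|f_ f nf_ nf nd cf] //; exact: nf.2.
Qed.

Lemma int_integral (mu : {measure set X -> \bar R}) :
  is_int (fun f : X -> \bar R => \int[mu]_x f x).
Proof.
have := @int_comp _ X mu (cst 1%R) (fun x f => f x).
rewrite (_ : (fun f => \int[mu]_y _) = (fun f => \int[mu]_y f y)).
  apply => //; first by move=> y; exact: int_dirac.
  by move=> f; case.
by apply/funext => f; apply: eq_integral => x _; rewrite mul1e.
Qed.

End int_examples.

(** * Identities between conditional expectations *)

Section cond_equal.
Context d (Om : measurableType d) (R : realType) (P : probability Om R).
Implicit Types (G H : set (set Om)).

Definition gmeas G d' (T' : measurableType d') (W : Om -> T') :=
  measurable_fun [set: g_sigma_algebraType G] (W : g_sigma_algebraType G -> T').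

Lemma gen_setT G : <<s G >> setT.
Proof. exact: (@measurableT _ (g_sigma_algebraType G)). Qed.

Lemma gen_setI G A B : <<s G >> A -> <<s G >> B -> <<s G >> (A `&` B).
Proof. exact: (@measurableI _ (g_sigma_algebraType G)). Qed.

Lemma gen_cst G (Q : Prop) : <<s G >> [set _ | Q].
Proof.
have [q|nq] := pselect Q.
  by rewrite (_ : mkset _ = setT); [exact: gen_setT|apply/seteqP; split].
by rewrite (_ : mkset _ = set0); [exact: sigma_algebra0|apply/seteqP; split].
Qed.

Lemma gmeas_sub G H d' (T' : measurableType d') (W : Om -> T') :
  G `<=` <<s H >> -> gmeas G W -> gmeas H W.
Proof.
move=> GH mW _ B mB; rewrite setTI; have := mW measurableT _ mB; rewrite setTI.
by apply: smallest_sub; [exact: smallest_sigma_algebra|exact: GH].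
Qed.

Lemma gen_measurable G : G `<=` measurable -> <<s G >> `<=` measurable.
Proof. by move=> Gm; apply: smallest_sub => //; exact: sigma_algebra_measurable. Qed.

Lemma gmeas_measurable G d' (T' : measurableType d') (W : Om -> T') :
  G `<=` measurable -> gmeas G W -> measurable_fun setT W.
Proof.
move=> Gm mW _ B mB; rewrite setTI; have := mW measurableT _ mB; rewrite setTI.
exact: gen_measurable.
Qed.

Definition nnR (f : Om -> R) := measurable_fun setT f /\ forall w, 0 <= f w.

Lemma nnR_nnmeas f : nnR f -> nnmeas (fun w => (f w)%:E).
Proof. by move=> [mf f0]; exact: nnmeas_EFin. Qed.

Lemma integral_le1_lty f : nnR f -> (forall w, f w <= 1) ->
  (\int[P]_w (f w)%:E < +oo)%E.
Proof.
move=> nf f1; have [mf f0] := nnR_nnmeas nf.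
apply: (@le_lt_trans _ _ (\int[P]_w cst 1 w)%E).
  by apply: ge0_le_integral => // w _; rewrite lee_fin.
by rewrite integral_cst// mul1e ltey_eq fin_num_measure.
Qed.

(* E(f | <<s G>>) = E(g | <<s G>>), without choosing versions *)
Definition eqm G (f g : Om -> \bar R) : Prop :=
  forall W : Om -> \bar R, nnmeas (W : g_sigma_algebraType G -> \bar R) ->
  (\int[P]_w (W w * f w) = \int[P]_w (W w * g w))%E.

Lemma eqm_trans G g f h : eqm G f g -> eqm G g h -> eqm G f h.
Proof. by move=> e1 e2 W nW; rewrite e1// e2. Qed.

Lemma eqm_sub G H f g : G `<=` <<s H >> -> eqm H f g -> eqm G f g.
Proof.
by move=> GH e W [mW W0]; apply: e; split => //; exact: gmeas_sub GH mW.
Qed.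

Lemma eqm_mul G (V : Om -> \bar R) f g :
  nnmeas (V : g_sigma_algebraType G -> \bar R) -> eqm G f g ->
  eqm G (fun w => V w * f w)%E (fun w => V w * g w)%E.
Proof.
move=> nV e W nW; under eq_integral do rewrite muleA.
under [RHS]eq_integral do rewrite muleA.
by apply: (e (fun w => W w * V w)%E); exact: nnmeasM.
Qed.

Lemma gindic_nnmeas G A : <<s G >> A ->
  nnmeas ((fun w => (\1_A w)%:E) : g_sigma_algebraType G -> \bar R).
Proof.
move=> GA; apply: (@nnmeas_indic _ (g_sigma_algebraType G) R A); exact: GA.
Qed.

Lemma eqm_indic G f g A : eqm G f g -> <<s G >> A ->
  (\int[P]_w ((\1_A w)%:E * f w) = \int[P]_w ((\1_A w)%:E * g w))%E.
Proof. by move=> e GA; apply: e; exact: gindic_nnmeas. Qed.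

Lemma eqm_integral G f g : eqm G f g -> (\int[P]_w f w = \int[P]_w g w)%E.
Proof.
move=> e; have n1 : nnmeas ((fun=> 1%E) : g_sigma_algebraType G -> \bar R) by split.
have := e _ n1; under eq_integral do rewrite mul1e.
by move=> ->; apply: eq_integral => w _; rewrite mul1e.
Qed.

Lemma int_density G (f : Om -> R) : G `<=` measurable -> nnR f ->
  is_int (fun W : g_sigma_algebraType G -> \bar R => \int[P]_w (W w * (f w)%:E))%E.
Proof.
move=> Gm [mf f0].
have -> : (fun W : g_sigma_algebraType G -> \bar R => \int[P]_w (W w * (f w)%:E))%E =
    (fun W => \int[P]_w ((f w)%:E * W w))%E.
  by apply/funext => W; apply: eq_integral => w _; rewrite muleC.
apply: (@int_comp _ (g_sigma_algebraType G) R _ Om P f (fun w W => W w)) => //.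
- by move=> w; exact: int_dirac.
- by move=> W [mW _]; exact: gmeas_measurable Gm mW.
Qed.

Lemma eqm_sets G (f g : Om -> R) : G `<=` measurable -> nnR f -> nnR g ->
  (forall A, <<s G >> A ->
    \int[P]_w ((\1_A w)%:E * (f w)%:E) = \int[P]_w ((\1_A w)%:E * (g w)%:E))%E ->
  eqm G (EFin \o f) (EFin \o g).
Proof.
move=> Gm nf ng e W nW.
by apply: (int_unique_sets (int_density Gm nf) (int_density Gm ng)).
Qed.

Lemma eqm_pi G H (f g : Om -> R) : G `<=` measurable -> nnR f -> nnR g ->
  <<s H >> = <<s G >> -> setI_closed H -> H setT ->
  (\int[P]_w (f w)%:E < +oo)%E ->
  (forall A, H A ->
    \int[P]_w ((\1_A w)%:E * (f w)%:E) = \int[P]_w ((\1_A w)%:E * (g w)%:E))%E ->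
  eqm G (EFin \o f) (EFin \o g).
Proof.
move=> Gm nf ng HG HI HT ffin e W nW.
have := e _ HT; rewrite indicT => eT.
apply: (@int_unique_pi _ (g_sigma_algebraType G) R H _ _
  (int_density Gm nf) (int_density Gm ng)) => //.
by under eq_integral do rewrite mul1e.
Qed.

Lemma eqm_join G1 G2 (f g : Om -> R) :
  G1 `<=` measurable -> G2 `<=` measurable -> nnR f -> nnR g ->
  (\int[P]_w (f w)%:E < +oo)%E ->
  (forall A1 A2, <<s G1 >> A1 -> <<s G2 >> A2 ->
    \int[P]_w ((\1_(A1 `&` A2) w)%:E * (f w)%:E) =
    \int[P]_w ((\1_(A1 `&` A2) w)%:E * (g w)%:E))%E ->
  eqm (G1 `|` G2) (EFin \o f) (EFin \o g).
Proof.
move=> G1m G2m nf ng ffin e.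
have sT (G : set (set Om)) : <<s G >> setT by exact: gen_setT.
apply: (@eqm_pi _ [set B | exists A1, exists A2,
   [/\ <<s G1 >> A1, <<s G2 >> A2 & B = A1 `&` A2]]) => //.
- by move=> A [/G1m|/G2m].
- apply/seteqP; split; apply: smallest_sub; try exact: smallest_sigma_algebra.
    move=> _ [A1 [A2 [h1 h2 ->]]].
    apply: gen_setI.
      by apply: sub_sigma_algebra2 h1 => A; left.
    by apply: sub_sigma_algebra2 h2 => A; right.
  move=> A [GA|GA]; apply: sub_sigma_algebra.
    by exists A, setT; split; [exact: sub_sigma_algebra|exact: sT|rewrite setIT].
  by exists setT, A; split; [exact: sT|exact: sub_sigma_algebra|rewrite setTI].
- move=> _ _ [A1 [A2 [h1 h2 ->]]] [B1 [B2 [k1 k2 ->]]].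
  exists (A1 `&` B1), (A2 `&` B2); split; last by rewrite setIACA.
    exact: gen_setI.
  exact: gen_setI.
- by exists setT, setT; split => //; rewrite setIT.
- by move=> _ [A1 [A2 [h1 h2 ->]]]; exact: e.
Qed.

Definition ae_eqset (A B : set Om) := {ae P, forall w, A w <-> B w}.

Lemma integral_ae_eqset (A B : set Om) (f : Om -> R) :
  measurable A -> measurable B -> nnR f -> ae_eqset A B ->
  (\int[P]_w ((\1_A w)%:E * (f w)%:E) = \int[P]_w ((\1_B w)%:E * (f w)%:E))%E.
Proof.
move=> mA mB nf AB; have nf' := nnR_nnmeas nf.
apply: ge0_ae_eq_integral => //.
- exact: (nnmeasM (nnmeas_indic R mA) nf').1.
- exact: (nnmeasM (nnmeas_indic R mB) nf').1.
- by move=> w _; exact: (nnmeasM (nnmeas_indic R mA) nf').2.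
- by move=> w _; exact: (nnmeasM (nnmeas_indic R mB) nf').2.
- move: AB; rewrite /ae_eqset; apply: filterS => w AB _; congr (_%:E * _)%E.
  by rewrite !indicE (_ : (w \in A) = (w \in B))//; apply/idP/idP; rewrite !inE => h; exact/AB.
Qed.

Lemma compl_sigma_algebra G : G `<=` measurable ->
  sigma_algebra setT [set A | measurable A /\
    exists2 B, <<s G >> B & ae_eqset A B].
Proof.
move=> Gm; split.
- split => //; exists set0; first exact: sigma_algebra0.
  by apply: nearW.
- move=> A [mA [B GB AB]]; rewrite setTD; split; first exact: measurableC.
  exists (~` B); first exact: sigma_algebraC.
  by move: AB; rewrite /ae_eqset; apply: filterS => w AB; split; apply: contra_not => /AB.
- move=> F FG; split; first by apply: bigcupT_measurable => i; have [] := FG i.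
  have /choice[B BP] : forall i, exists B, <<s G >> B /\ ae_eqset (F i) B.
    by move=> i; have [_ [B]] := FG i; exists B.
  exists (\bigcup_i B i).
    by apply: sigma_algebra_bigcup => i; exact: (BP i).1.
  have : {ae P, forall w, forall i, F i w <-> B i w}.
    by apply: ae_foralln => i; exact: (BP i).2.
  apply: filterS => w FB; split => -[i _ Fi]; exists i => //; exact/FB.
Qed.

Lemma eqm_compl G H (f g : Om -> R) : G `<=` measurable -> nnR f -> nnR g ->
  (forall A, H A -> measurable A /\ exists2 B, <<s G >> B & ae_eqset A B) ->
  eqm G (EFin \o f) (EFin \o g) -> eqm H (EFin \o f) (EFin \o g).
Proof.
move=> Gm nf ng HG e.
have sHG := smallest_sub (compl_sigma_algebra Gm) HG.
apply: eqm_sets => //; first by move=> A /HG[].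
move=> A /sHG[mA [B GB AB]].
have mB : measurable B by exact: gen_measurable GB.
by rewrite !(integral_ae_eqset mA mB)//; exact: eqm_indic e GB.
Qed.

Lemma eqm_ae G (f f' g g' : Om -> R) : G `<=` measurable ->
  nnR f -> nnR f' -> nnR g -> nnR g' ->
  {ae P, forall w, f w = f' w} -> {ae P, forall w, g w = g' w} ->
  eqm G (EFin \o f) (EFin \o g) -> eqm G (EFin \o f') (EFin \o g').
Proof.
move=> Gm nf nf' ng ng' ff gg e W nW.
have nW' : nnmeas W by case: nW => mW W0; split => //; exact: gmeas_measurable Gm mW.
have h (u v : Om -> R) : nnR u -> nnR v -> {ae P, forall w, u w = v w} ->
    (\int[P]_w (W w * (u w)%:E) = \int[P]_w (W w * (v w)%:E))%E.
  move=> /nnR_nnmeas nu /nnR_nnmeas nv uv; apply: ge0_ae_eq_integral => //.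
  - exact: (nnmeasM nW' nu).1.
  - exact: (nnmeasM nW' nv).1.
  - by move=> w _; exact: (nnmeasM nW' nu).2.
  - by move=> w _; exact: (nnmeasM nW' nv).2.
  - by apply: filterS uv => w -> _.
by rewrite /= -(h f f')// -(h g g')//; exact: e.
Qed.

Lemma integral_partition (C : countType) (Y : Om -> C) (f : Om -> \bar R) :
  (forall y, measurable (Y @^-1` [set y])) -> nnmeas f ->
  (\int[P]_w f w =
   \sum_(k <oo) \int[P]_w ((\1_[set w | choice.pickle (Y w) = k] w)%:E * f w))%E.
Proof.
move=> mY nf; have mF k : measurable [set w | choice.pickle (Y w) = k].
  case E : (@choice.unpickle C k) => [y|]; last first.
    rewrite (_ : mkset _ = set0)//; apply/seteqP; split => // w /= h.
    by move: E; rewrite -h (choice.pickleK (Y w)).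
  have [yk|yk] := eqVneq (choice.pickle y) k.
    rewrite (_ : mkset _ = Y @^-1` [set y])//; apply/seteqP; split => w /=.
      by rewrite -yk => /(pcan_inj choice.pickleK).
    by move=> ->.
  rewrite (_ : mkset _ = set0)//; apply/seteqP; split => // w /= h.
  by move: E yk; rewrite -h (choice.pickleK (Y w)) => -[->]; rewrite eqxx.
rewrite -integral_nneseries//; last 2 first.
- by move=> k; exact: (nnmeasM (nnmeas_indic R (mF k)) nf).1.
- by move=> k w _; exact: (nnmeasM (nnmeas_indic R (mF k)) nf).2.
apply: eq_integral => w _.
rewrite (@nneseriesD1 _ _ (choice.pickle (Y w)))//; last first.
  by move=> k _; exact: (nnmeasM (nnmeas_indic R (mF k)) nf).2.
rewrite indicE mem_set// mul1e eseries0 ?adde0// => k _ /= kY.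
by rewrite indicE memNset ?mul0e// => /= h; move: kY; rewrite h eqxx.
Qed.

Lemma eqm_partition G (C : countType) (Y : Om -> C) (f g : Om -> \bar R) :
  G `<=` measurable -> nnmeas f -> nnmeas g ->
  (forall y, measurable (Y @^-1` [set y])) ->
  (forall y, eqm G (fun w => (\1_(Y @^-1` [set y]) w)%:E * f w)%E
                   (fun w => (\1_(Y @^-1` [set y]) w)%:E * g w)%E) ->
  eqm G f g.
Proof.
move=> Gm nf ng mY e W nW.
have nW' : nnmeas W by case: nW => mW W0; split => //; exact: gmeas_measurable Gm mW.
rewrite (integral_partition mY); last exact: nnmeasM.
rewrite (integral_partition mY); last exact: nnmeasM.
apply: eq_eseriesr => k _.
have [[y yk]|h] := pselect (exists y, choice.pickle (y : C) = k).
  have -> : [set w | choice.pickle (Y w) = k] = Y @^-1` [set y].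
    apply/seteqP; split => w /=; first by rewrite -yk => /(pcan_inj choice.pickleK).
    by move=> ->.
  under eq_integral do rewrite muleCA.
  by rewrite e//; apply: eq_integral => w _; rewrite muleCA.
have -> : [set w | choice.pickle (Y w) = k] = set0.
  by apply/seteqP; split => // w /= kY; apply: h; exists (Y w).
by apply: eq_integral => w _; rewrite indic0 !mul0e.
Qed.

End cond_equal.

Section freezing.
Context d (Om : measurableType d) (R : realType) (P : probability Om R).
Variables (G : set (set Om)) (Gm : G `<=` measurable).
Context dU (U : measurableType dU) (u : Om -> U) (mu : measurable_fun setT u).
Hypothesis indep : forall A D, <<s G >> A -> measurable D ->
  P (A `&` u @^-1` D) = (P A * P (u @^-1` D))%E.

Let freeze_pair d' (V : measurableType d') (v : Om -> V) (k : V * U -> \bar R) :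
  gmeas G v -> nnmeas k ->
  (\int[P]_w k (v w, u w) = \int[P]_w \int[P]_w' k (v w, u w'))%E.
Proof.
move=> gv nk; have mv := gmeas_measurable Gm gv.
have mD D : measurable D -> measurable (u @^-1` D).
  by move=> mD; rewrite -[X in measurable X]setTI; exact: mu.
have mC C : measurable C -> <<s G >> (v @^-1` C).
  by move=> mC; have := gv measurableT _ mC; rewrite setTI.
have mk (f : V * U -> \bar R) : nnmeas f -> measurable_fun setT (fun ww : Om * Om => f (v ww.1, u ww.2)).
  move=> [mf _]; apply: (measurableT_comp mf).
  apply: measurable_fun_pair.
    exact: (measurableT_comp mv measurable_fst).
  exact: (measurableT_comp mu measurable_snd).
have mk1 w (f : V * U -> \bar R) : nnmeas f -> measurable_fun setT (fun w' : Om => f (v w, u w')).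
  move=> [mf _]; apply: (measurableT_comp mf); exact: measurable_fun_pair.
pose L1 f := (\int[P]_w (1%:E * f (v w, u w)))%E : \bar R.
pose L2 f := (\int[P]_w (1%:E * \int[P]_w' (1%:E * f (v w, u w'))))%E : \bar R.
have i1 : is_int L1.
  apply: (@int_comp _ (V * U)%type R _ Om P (cst 1%R) (fun w f => f (v w, u w))) => //.
    by move=> w; exact: int_dirac.
  by move=> f [mf _]; apply: (measurableT_comp mf); exact: measurable_fun_pair.
have i2 : is_int L2.
  apply: (@int_comp _ (V * U)%type R _ Om P (cst 1%R)
    (fun w f => \int[P]_w' (1%:E * f (v w, u w'))))%E => //.
    move=> w; apply: (@int_comp _ (V * U)%type R _ Om P (cst 1%R)
      (fun w' f => f (v w, u w'))) => //.
      by move=> w'; exact: int_dirac.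
    by move=> f nf; exact: mk1.
  move=> f nf; under eq_fun do under eq_integral do rewrite mul1e.
  have h := (@measurable_fun_fubini_tonelli_F _ _ _ _ _ P _ (mk f nf) (fun ww => nf.2 _)). exact: h.
have I1 : (\int[P]_w (1%:E * 1) = 1 :> \bar R)%E.
  under eq_integral do rewrite mul1e.
  rewrite (integral_cst P measurableT 1%E). by rewrite mul1e; exact: probability_setT.
suff : L1 k = L2 k.
  rewrite /L1 /L2; under eq_integral do rewrite mul1e.
  under [in RHS]eq_integral do rewrite mul1e.
  move=> ->; apply: eq_integral => w _.
  by under eq_integral do rewrite mul1e.
apply: (int_unique_pi i1 i2 (measurable_prod_measurableType V U)) => //.
- move=> _ _ [A mA [B mB <-]] [A' mA' [B' mB' <-]].
  exists (A `&` A'); first exact: measurableI.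
  by exists (B `&` B'); [exact: measurableI|rewrite setXI].
- by rewrite /L2; apply: eq_integral => w _; rewrite /= I1.
- by rewrite /L1 /= I1 ltry.
- move=> _ [A mA [B mB <-]].
  have ind w w' : ((\1_(A `*` B) (v w, u w'))%:E =
      (\1_(v @^-1` A) w)%:E * (\1_(u @^-1` B) w')%:E :> \bar R)%E.
    rewrite -EFinM !indicE -natrM mulnb; congr (_%:R%:E); congr nat_of_bool.
    by apply/idP/andP; rewrite !inE.
  have mA' : measurable (v @^-1` A) by exact: gen_measurable (mC _ mA).
  rewrite /L1 /L2; under eq_integral do rewrite mul1e ind -EFinM.
  have -> : (\int[P]_w (\1_(v @^-1` A) w * \1_(u @^-1` B) w)%:E =
      \int[P]_w (\1_(v @^-1` A `&` u @^-1` B) w)%:E)%E.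
    by apply: eq_integral => w _; rewrite indicI.
  rewrite integral_indic// ?setIT; last by apply: measurableI => //; exact: mD.
  transitivity (P (v @^-1` A) * P (u @^-1` B))%E; first by apply: indep => //; exact: mC.
  symmetry.
  under eq_integral.
    move=> w _; under eq_integral do rewrite mul1e ind.
    rewrite ge0_integralZl//; last first.
      by apply/measurable_EFinP; apply: measurable_indic; exact: mD.
    rewrite integral_indic// ?setIT ?mul1e; last exact: mD.
    over.
  rewrite ge0_integralZr//; last first.
    by apply/measurable_EFinP; exact: measurable_indic.
  by rewrite integral_indic// setIT.
Qed.

Lemma freeze_gmeas d' (V : measurableType d') (v : Om -> V) (k : V * U -> \bar R) :
  gmeas G v -> nnmeas k ->
  nnmeas ((fun w => \int[P]_w' k (v w, u w')) : g_sigma_algebraType G -> \bar R)%E.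
Proof.
move=> gv [mk k0]; split; last by move=> w; exact: integral_ge0.
pose f (ww : g_sigma_algebraType G * Om) := k (v ww.1, u ww.2).
have mf : measurable_fun setT f.
  apply: (measurableT_comp mk).
  apply: measurable_fun_pair.
    exact: (measurableT_comp gv measurable_fst).
  exact: (measurableT_comp mu measurable_snd).
exact: (@measurable_fun_fubini_tonelli_F _ _ _ _ _ P _ mf (fun ww => k0 _)).
Qed.

Lemma freeze d' (V : measurableType d') (v : Om -> V) (k : V * U -> \bar R) :
  gmeas G v -> nnmeas k ->
  eqm P G (fun w => k (v w, u w)) (fun w => \int[P]_w' k (v w, u w'))%E.
Proof.
move=> gv nk W [mW W0]; have [mk k0] := nk.
pose v' w := (W w, v w).
pose k' (x : (\bar R * V) * U) := (`|x.1.1| * k (x.1.2, x.2))%E.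
have gv' : gmeas G v' by exact: measurable_fun_pair.
have nk' : nnmeas k'.
  split; last by move=> x; apply: mule_ge0.
  apply: emeasurable_funM.
    apply: measurableT_comp; first exact: abse_measurable.
    by apply: measurableT_comp.
  apply: (measurableT_comp mk); apply: measurable_fun_pair => //.
  by apply: measurableT_comp.
have := freeze_pair gv' nk'.
rewrite /k' /=; under eq_integral do rewrite gee0_abs//.
move=> ->; apply: eq_integral => w _; rewrite gee0_abs// ge0_integralZl//.
apply: (measurableT_comp mk); exact: measurable_fun_pair.
Qed.

End freezing.

Lemma indep_join d (Om : measurableType d) (R : realType) (P : probability Om R)
    (G1 G2 : set (set Om)) (D : set Om) :
  G1 `<=` measurable -> G2 `<=` measurable -> measurable D ->
  (forall A1 A2, <<s G1 >> A1 -> <<s G2 >> A2 ->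
    P (A1 `&` A2 `&` D) = P (A1 `&` A2) * P D)%E ->
  forall A, <<s G1 `|` G2 >> A -> P (A `&` D) = (P A * P D)%E.
Proof.
move=> G1m G2m mD e A GA.
pose c := fine (P D).
have cE : P D = c%:E by rewrite fineK// fin_num_measure.
have c0 : 0 <= c by rewrite fine_ge0.
have G12m : G1 `|` G2 `<=` measurable by move=> B [/G1m|/G2m].
have E (B : set Om) : measurable B ->
    (\int[P]_w ((\1_B w)%:E * (\1_D w)%:E) = P (B `&` D))%E.
  move=> mB; transitivity (\int[P]_w (\1_(B `&` D) w)%:E)%E.
    by apply: eq_integral => w _; rewrite indicI EFinM.
  by rewrite integral_indic// ?setIT//; exact: measurableI.
have E' (B : set Om) : measurable B ->
    (\int[P]_w ((\1_B w)%:E * (cst c w)%:E) = P B * P D)%E.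
  move=> mB; rewrite /= ge0_integralZr ?lee_fin//; last first.
    by apply/measurable_EFinP; exact: measurable_indic.
  by rewrite integral_indic// setIT cE.
have e12 : eqm P (G1 `|` G2) (EFin \o \1_D) (EFin \o cst c).
  apply: eqm_join => //.
  - apply: integral_le1_lty => [|w]; first by split=> //; exact: measurable_indic.
    by rewrite indicE lern1 leq_b1.
  - move=> A1 A2 h1 h2; rewrite E ?E'; first exact: e.
      by apply: measurableI; [exact: gen_measurable h1|exact: gen_measurable h2].
    by apply: measurableI; [exact: gen_measurable h1|exact: gen_measurable h2].
have := e12 _ (gindic_nnmeas R GA).
by rewrite E ?E'//; exact: gen_measurable GA.
Qed.

(** * Measures on Polish spaces *)

Section continuous_functions.
Context (R : realType) (T : ptopologicalType).

Lemma continuous_borel (f : T -> R) :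
  continuous f -> measurable_fun [set: borel T] (f : borel T -> R).
Proof.
move=> /continuousP cf; apply: (measurability _ (RGenOpens.measurableE R)).
move=> _ [_ [a [b ->] <-]]; rewrite setTI; apply: sub_sigma_algebra.
exact/cf/interval_open.
Qed.

Hypothesis polT : polish R T.

Lemma open_approx (O : set T) : open O ->
  exists f : nat -> T -> R,
    [/\ forall k, continuous (f k), forall k x, 0 <= f k x <= 1,
        forall x, nondecreasing_seq (f ^~ x)
      & forall x, f ^~ x @ \oo --> (\1_O x : R)].
Proof.
move=> oO; have [[dist [d0 dC dtri dnbhs _]] _] := polT.
have dge0 x y : 0 <= dist x y.
  have := dtri x y x; rewrite (d0 x x).2// (dC y x) -mulr2n.
  by rewrite pmulrn_lge0.
have [[y0 Oy0]|O1] := pselect (exists y, ~ O y); last first.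
  have {}O1 : O = setT by apply/seteqP; split => // x _; apply: contrapT => ?; apply: O1; exists x.
  exists (fun _ _ => 1); split.
  - by move=> k; exact: cst_continuous.
  - by move=> k x; rewrite ler01 lexx.
  - by move=> x m n _.
  - by move=> x; rewrite O1 indicT; exact: cvg_cst.
pose S x := [set dist x y | y in ~` O].
have S0 x : nonempty (S x) by exists (dist x y0); exists y0.
have Slb x : has_lbound (S x) by exists 0 => _ [y _ <-].
pose del x := inf (S x).
have del_ge0 x : 0 <= del x by apply: lb_le_inf => // _ [y _ <-].
have del_lip x x' : del x <= del x' + dist x x'.
  rewrite -lerBlDr; apply: lb_le_inf => // _ [y Oy <-].
  rewrite lerBlDr addrC; apply: le_trans (dtri x x' y).
  by apply: ge_inf => //; exists y.
have delO x : O x -> 0 < del x.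
  move=> Ox; have : nbhs x O by exact: open_nbhs_nbhs.
  move=> /dnbhs[e e0 eO]; apply: (lt_le_trans e0).
  apply: lb_le_inf => // _ [y Oy <-].
  by rewrite leNgt; apply/negP => /eO.
have delNO x : ~ O x -> del x = 0.
  move=> Ox; apply/eqP; rewrite eq_le del_ge0 andbT.
  by apply: ge_inf => //; exists x => //; exact/(d0 x x).
exists (fun k x => Num.min 1 (k%:R * del x)); split.
- move=> k x; apply/cvgrPdist_lt => e e0.
  have k0 : 0 < k.+1%:R :> R by [].
  apply/dnbhs; exists (e / k.+1%:R); first by rewrite divr_gt0.
  move=> y; rewrite ltr_pdivlMr// => yx.
  apply: le_lt_trans yx.
  have D : `|k%:R * del x - k%:R * del y| <= dist x y * k.+1%:R.
    rewrite -mulrBr normrM ger0_norm// mulrC; apply: ler_pM => //; last by rewrite ler_nat.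
    rewrite ler_norml lerBlDl del_lip andbT lerNl opprB lerBlDl.
    by rewrite (dC x y) del_lip.
  apply: le_trans D; rewrite /Num.min.
  have a0 : 0 <= k%:R * del x by rewrite mulr_ge0.
  have b0 : 0 <= k%:R * del y by rewrite mulr_ge0.
  move: (k%:R * del x) (k%:R * del y) a0 b0 => u v _ _.
  case: ltP => hu; case: ltP => hv.
  + by rewrite subrr normr0.
  + rewrite !ger0_norm ?subr_ge0//; last by rewrite (le_trans hv)// ltW.
    by rewrite lerB// ltW.
  + rewrite ler0_norm ?subr_le0// ler0_norm ?subr_le0; last by rewrite (le_trans hu)// ltW.
    by rewrite lerN2 lerB// ltW.
  + by [].
- move=> k x; rewrite le_min ler01 mulr_ge0//=.
  by rewrite ge_min lexx.
- move=> x m n mn; rewrite le_min ge_min lexx/= ge_min.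
  by apply/orP; right; rewrite ler_wpM2r// ler_nat.
- move=> x; rewrite indicE; case: (boolP (x \in O)); rewrite ?inE => Ox /=.
    apply: cvg_near_cst.
    exists (Num.truncn (del x)^-1).+1 => // k /= kt.
    apply/min_idPl; rewrite -ler_pdivrMr ?delO// mul1r.
    apply: le_trans (ltW (truncnS_gt _)) _; by rewrite ler_nat.
  rewrite (_ : (fun k => _) = cst 0); first exact: cvg_cst.
  apply/funext => k; rewrite delNO ?mulr0; last by move: Ox => /negP; rewrite inE.
  by apply/min_idPr.
Qed.

Lemma int_unique_cont (L1 L2 : (borel T -> \bar R) -> \bar R) :
  is_int L1 -> is_int L2 -> (L1 (fun=> 1) < +oo)%E ->
  (forall f : T -> R, continuous f -> (forall x, 0 <= f x <= 1) ->
    L1 (EFin \o f) = L2 (EFin \o f)) ->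
  forall f, nnmeas f -> L1 f = L2 f.
Proof.
move=> i1 i2 L1fin ec; apply: (@int_unique_pi _ (borel T) R (@open T)) => //.
- by move=> A B oA oB; exact: openI.
- have := ec (cst 1); apply; first exact: cst_continuous.
  by move=> x; rewrite /= ler01 lexx.
- move=> O oO; have [f [fc f01 nd cf]] := open_approx oO.
  have nf k : nnmeas ((EFin \o f k) : borel T -> \bar R).
    apply: nnmeas_EFin; first exact: continuous_borel.
    by move=> x; have /andP[] := f01 k x.
  have c (L : (borel T -> \bar R) -> \bar R) : is_int L -> L (EFin \o f k) @[k --> \oo] --> L (fun x => (\1_O x)%:E).
    move=> iL; apply: (int_cvg iL) => //.
    + apply: nnmeas_indic; exact: sub_sigma_algebra.
    + by move=> x; apply: cvg_EFin; [exact: nearW|exact: cf].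
  rewrite -(cvg_lim _ (c L1 i1))// -(cvg_lim _ (c L2 i2))//.
  congr (limn _); apply/funext => k; exact: ec.
Qed.

End continuous_functions.

(** * The kernel at a fixed level *)

Lemma integral_indicE d (Om : measurableType d) (R : realType)
    (mu : {measure set Om -> \bar R}) (A : set Om) (f : Om -> \bar R) :
  (\int[mu]_(w in A) f w = \int[mu]_w ((\1_A w)%:E * f w))%E.
Proof.
rewrite integral_mkcond; apply: eq_integral => w _.
by rewrite patchE indicE; case: ifPn => _; rewrite ?mul1e ?mul0e.
Qed.

Lemma probability_of_measure d (X : measurableType d) (R : realType)
    (mu : {measure set X -> \bar R}) : mu [set: X] = 1%E ->
  exists Q : probability X R, forall A, Q A = mu A.
Proof.
move=> mu1.
exists (mnormalize mu (dirac (point : X))) => A.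
have E : mnormalize mu (dirac (point : X)) = mu :> (set X -> \bar R).
  by apply/funext => B; rewrite /mnormalize mu1 onee_eq0/= invr1 mule1.
by rewrite -[RHS](congr1 (fun f => f A) E).
Qed.

Section kernel_functions.
Context (R : realType) (T : ptopologicalType).
Variable pik : R.-pker (measurableTypeR R * borel T)%type ~> borel T.

Definition M1 (phi : T -> R) :=
  measurable_fun [set: borel T] (phi : borel T -> R) /\
  forall x, 0 <= phi x <= 1.

Definition Kr (phi : T -> R) (z : R) (x : T) : R := \int[pik (z, x)]_y phi y.

Definition Kprod (psis : seq (T -> R)) (z : R) (x : T) : R :=
  \prod_(psi <- psis) Kr psi z x.

Definition allM1 (psis : seq (T -> R)) :=
  forall i, (i < size psis)%N -> M1 (nth (cst 0) psis i).

Lemma M1_nnmeas phi : M1 phi -> nnmeas ((EFin \o phi) : borel T -> \bar R).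
Proof. by move=> [mphi p01]; apply: nnmeas_EFin => // x; have /andP[] := p01 x. Qed.

Lemma M1_indic (B : set (borel T)) : measurable B -> M1 (\1_B : borel T -> R).
Proof.
move=> mB; split=> [|x]; first exact: measurable_indic.
by rewrite indicE ler0n lern1 leq_b1.
Qed.

Lemma M1_cst1 : M1 (cst 1).
Proof. by split => // x; rewrite ler01 lexx. Qed.

Lemma M1M phi psi : M1 phi -> M1 psi -> M1 (fun x => phi x * psi x).
Proof.
move=> [m1 h1] [m2 h2]; split=> [|x]; first exact: measurable_funM.
have /andP[a b] := h1 x; have /andP[a' b'] := h2 x.
by rewrite mulr_ge0//= mulr_ile1.
Qed.

Lemma integral_M1_le1 (mu : {measure set (borel T) -> \bar R}) phi :
  mu [set: borel T] = 1%E -> M1 phi -> (\int[mu]_y (phi y)%:E <= 1)%E.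
Proof.
move=> mu1 Mphi; have [mphi p0] := M1_nnmeas Mphi.
apply: (@le_trans _ _ (\int[mu]_w cst 1 w)%E); last by rewrite integral_cst// mu1 mul1e.
by apply: ge0_le_integral => // w _; rewrite lee_fin; have /andP[] := Mphi.2 w.
Qed.

Lemma KrE phi z x : M1 phi ->
  (Kr phi z x)%:E = (\int[pik (z, x)]_y (phi y)%:E)%E.
Proof.
move=> Mphi; have [mphi p0] := M1_nnmeas Mphi.
rewrite /Kr /Rintegral fineK// ge0_fin_numE; last by apply: integral_ge0 => y _; exact: p0.
apply: le_lt_trans (ltry 1); apply: integral_M1_le1 => //.
exact: prob_kernel.
Qed.

Lemma Kr01 phi z x : M1 phi -> 0 <= Kr phi z x <= 1.
Proof.
move=> Mphi; have [mphi p0] := M1_nnmeas Mphi.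
rewrite -!lee_fin KrE// integral_ge0/=; last by move=> y _; exact: p0.
by apply: integral_M1_le1 => //; exact: prob_kernel.
Qed.

Lemma measurable_integral_pik d (X : measurableType d) (z : X -> R) (x : X -> T)
    (f : borel T -> \bar R) :
  measurable_fun setT z -> measurable_fun [set: X] (x : X -> borel T) ->
  nnmeas f -> measurable_fun setT (fun w => \int[pik (z w, x w)]_y f y)%E.
Proof.
move=> mz mx [mf f0].
apply: (@measurable_fun_integral_kernel _ _ X (borel T) R
  (fun w => pik (z w, x w))) => // B mB.
apply: (measurableT_comp (measurable_kernel pik B mB)).
exact: (@measurable_fun_pair _ _ _ X (measurableTypeR R) (borel T) z x mz mx).
Qed.

Lemma measurable_Kr d (X : measurableType d) (z : X -> R) (x : X -> T) phi :
  measurable_fun setT z -> measurable_fun [set: X] (x : X -> borel T) ->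
  M1 phi -> measurable_fun setT (fun w => Kr phi (z w) (x w)).
Proof.
move=> mz mx Mphi; apply/measurable_EFinP.
rewrite (_ : EFin \o _ = fun w => (\int[pik (z w, x w)]_y (phi y)%:E)%E).
  by apply: measurable_integral_pik => //; exact: M1_nnmeas.
by apply/funext => w /=; rewrite KrE.
Qed.

Lemma Kr_M1 phi z : M1 phi -> M1 (Kr phi z).
Proof.
by move=> Mphi; split=> [|x]; [exact: (@measurable_Kr _ (borel T))|exact: Kr01].
Qed.

Lemma allM1_cons psi psis : allM1 (psi :: psis) <-> M1 psi /\ allM1 psis.
Proof.
split=> [h|[h1 h2] [|i] //=]; last exact: h2.
by split; [exact: (h 0%N)|move=> i ip; exact: (h i.+1)].
Qed.

Lemma measurable_Kprod d (X : measurableType d) (z : X -> R) (x : X -> T) psis :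
  measurable_fun setT z -> measurable_fun [set: X] (x : X -> borel T) ->
  allM1 psis -> measurable_fun setT (fun w => Kprod psis (z w) (x w)).
Proof.
move=> mz mx; elim: psis => [_|psi psis ih /allM1_cons[h1 h2]].
  by under eq_fun do rewrite /Kprod big_nil; exact: measurable_cst.
under eq_fun do rewrite /Kprod big_cons.
by apply: measurable_funM; [exact: measurable_Kr|exact: ih].
Qed.

Lemma Kprod01 psis z x : allM1 psis -> 0 <= Kprod psis z x <= 1.
Proof.
elim: psis => [_|psi psis ih /allM1_cons[h1 h2]].
  by rewrite /Kprod big_nil ler01 lexx.
rewrite /Kprod big_cons; have /andP[a b] := Kr01 z x h1.
have /andP[a' b'] := ih h2.
by rewrite mulr_ge0//= mulr_ile1.
Qed.

Lemma Kprod_M1 psis z : allM1 psis -> M1 (Kprod psis z).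
Proof.
by move=> h; split=> [|x]; [exact: (@measurable_Kprod _ (borel T))|exact: Kprod01].
Qed.

Variables (filt : R -> set (set T)) (pi0 : probability (borel T) R).
Hypotheses (filtF : level_filtration filt) (A2 : assumption2 filt pi0 pik).

Section pointwise.
Variables (z0 : \bar R) (x : T) (z : R) (z0z : (z0 <= z%:E)%E).
Variables (Q : probability (borel T) R) (QE : forall A, Q A = pi_ext pi0 pik z0 x A).

Let fz : set (set (borel T)) := filt z.

Lemma cexp_M1 phi : M1 phi -> exists2 phi' : borel T -> R,
  gmeas fz phi' /\ {ae Q, forall y, phi' y = Kr phi z y} &
  forall A, filt z A ->
   (\int[Q]_y ((\1_A y)%:E * (phi y)%:E) = \int[Q]_y ((\1_A y)%:E * (phi' y)%:E))%E.
Proof.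
move=> Mphi; have [mphi p01] := Mphi.
have [sfilt filtm _] := filtF.
pose X : {RV Q >-> borel T} := mfun_Sub (mem_set (@measurable_id _ (borel T) setT)).
have [||phi' [mphi' e] ae'] := @A2 _ _ Q X z0 x _ z z0z phi mphi.
- by move=> A mA; rewrite /distribution/= /pushforward/= preimage_id QE.
- exists 1; split; first exact: num_real.
  move=> t t1 y _; have /andP[a b] := p01 y.
  by rewrite /= ger0_norm// (le_trans b)// ltW.
have fE A : filt z A -> preimage_set_system setT X (filt z) A.
  by move=> fA; exists A => //; rewrite preimage_id setTI.
exists phi'; first split => //.
- move=> _ B mB; rewrite setTI; apply: sub_sigma_algebra.
  by have [C fC] := mphi' B mB; rewrite preimage_id setTI => <-.
- by move=> A /fE fA; have := e _ fA; rewrite !(integral_indicE _ (A : set (borel T))).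
Qed.

Lemma pointwise_cexp C phi psis : filt z C -> M1 phi -> allM1 psis ->
  (\int[Q]_y (\1_C y * phi y * Kprod psis z y)%:E =
   \int[Q]_y (\1_C y * Kr phi z y * Kprod psis z y)%:E)%E.
Proof.
move=> fC Mphi Mpsis; have [sfilt filtm _] := filtF.
have [phi' [mphi' aephi'] ephi'] := cexp_M1 Mphi.
have sig A : <<s fz >> A -> filt z A by rewrite sigma_algebra_id//; exact: sfilt.
have nR (f : T -> R) : M1 f -> nnR (f : borel T -> R).
  by move=> [mf f01]; split=> [|y]; [exact: mf|have /andP[] := f01 y].
have e : eqm Q fz (EFin \o phi) (EFin \o Kr phi z).
  apply: eqm_sets => //; first exact: filtm.
  - exact: nR.
  - by apply: nR; exact: Kr_M1.
  move=> A /sig fA; rewrite ephi'//.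
  have mA : measurable A by exact: filtm fA.
  have mp' : measurable_fun [set: borel T] phi' by apply: gmeas_measurable mphi'; exact: filtm.
  have mK := (Kr_M1 z Mphi).1.
  have mi : measurable_fun [set: borel T] (fun y => (\1_A y)%:E : \bar R).
    by apply/measurable_EFinP; exact: measurable_indic.
  apply: ae_eq_integral => //.
  - by apply: emeasurable_funM => //; exact/measurable_EFinP.
  - by apply: emeasurable_funM => //; exact/measurable_EFinP.
  - by apply: filterS aephi' => y /= -> _.
have [W [mW W0 WE]] : exists W : borel T -> R, [/\ gmeas fz W,
    forall y, 0 <= W y & {ae Q, forall y, W y = Kprod psis z y}].
  elim: psis Mpsis => [_|psi psis ih /allM1_cons[Mpsi /ih[W [mW W0 WE]]]].
    exists (cst 1); split; [exact: measurable_cst|by move=> y; rewrite /= ler01|].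
    by apply: nearW => y; rewrite /Kprod big_nil.
  have [psi' [mpsi' aepsi'] _] := cexp_M1 Mpsi.
  exists (fun y => `|psi' y| * W y); split.
  - apply: measurable_funM => //.
    exact: (measurableT_comp (@normr_measurable R setT) mpsi').
  - by move=> y; rewrite mulr_ge0.
  - apply: filterS2 aepsi' WE => y -> ->.
    by rewrite /Kprod big_cons ger0_norm//; have /andP[] := Kr01 z y Mpsi.
pose V y := \1_C y * W y.
have nV : nnmeas ((EFin \o V) : g_sigma_algebraType fz -> \bar R).
  apply: nnmeas_EFin; last by move=> y; rewrite mulr_ge0.
  apply: measurable_funM => //.
  by apply: measurable_indic; exact: sub_sigma_algebra.
have mC : measurable (C : set (borel T)) by exact: filtm fC.
have mV : measurable_fun [set: borel T] V.
  apply: measurable_funM; first exact: measurable_indic.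
  by apply: gmeas_measurable mW; exact: filtm.
have h (f : T -> R) : M1 f -> (\int[Q]_y (\1_C y * f y * Kprod psis z y)%:E =
    \int[Q]_y ((EFin \o V) y * (EFin \o f) y))%E.
  move=> Mf; have [mf f01] := Mf; have [mK K01] := Kprod_M1 z Mpsis.
  apply: ge0_ae_eq_integral => //.
  - apply/measurable_EFinP; apply: measurable_funM => //.
    by apply: measurable_funM => //; exact: measurable_indic.
  - by apply: emeasurable_funM; exact/measurable_EFinP.
  - move=> y _; rewrite lee_fin !mulr_ge0//.
      by have /andP[] := f01 y.
    by have /andP[] := K01 y.
  - move=> y _; rewrite -EFinM lee_fin !mulr_ge0//.
    by have /andP[] := f01 y.
  - by apply: filterS WE => y WE _; rewrite /= -EFinM /V WE mulrAC.
by rewrite !h//; [exact: e|exact: Kr_M1].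
Qed.

End pointwise.

Lemma pi_extT z0 x : pi_ext pi0 pik z0 x [set: borel T] = 1%E.
Proof.
case: z0 => [r| |] /=; [exact: prob_kernel|exact: diracT|exact: probability_setT].
Qed.

Lemma pointwise_pi_ext z0 x z C phi psis : (z0 <= z%:E)%E -> filt z C ->
  M1 phi -> allM1 psis ->
  (\int[pi_ext pi0 pik z0 x]_y (\1_C y * phi y * Kprod psis z y)%:E =
   \int[pi_ext pi0 pik z0 x]_y (\1_C y * Kr phi z y * Kprod psis z y)%:E)%E.
Proof.
move=> z0z fC Mphi Mpsis.
have [Q QE] := probability_of_measure (pi_extT z0 x).
have E f : (\int[pi_ext pi0 pik z0 x]_y f y = \int[Q]_y f y)%E.
  by apply: eq_measure_integral => A mA _; rewrite -QE.
by rewrite !E; exact: (pointwise_cexp z0z QE).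
Qed.

End kernel_functions.

(** * The strong Markov property at a stopping level *)

Section strong_markov.
Context d (Om : measurableType d) (R : realType) (P : probability Om R).
Context (T : ptopologicalType).
Variables (filt : R -> set (set T)) (pi0 : probability (borel T) R).
Variable pik : R.-pker (measurableTypeR R * borel T)%type ~> borel T.
Hypotheses (polT : polish R T) (filtF : level_filtration filt).
Hypotheses (A1 : assumption1 pi0 pik) (A2 : assumption2 filt pi0 pik).
Variables (E O : set (set Om)) (N : set Om) (X : Om -> T).
Variables (F : \bar R -> set (set Om)) (Z : Om -> R).
Variables (Z0 : Om -> \bar R) (x0 : Om -> T).
Hypotheses (Em : E `<=` measurable) (Om' : O `<=` measurable).
Hypotheses (EN : <<s E >> N) (mX : measurable_fun setT (X : Om -> borel T)).
Hypothesis mZ : measurable_fun setT Z.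
Hypothesis EZ0 : forall z : R, <<s E >> [set w | (Z0 w <= z%:E)%E].
Hypothesis FE : forall z : R,
  F z%:E `<=` <<s (E `|` O) `|` preimage_set_system setT X (filt z) >>.
Hypothesis FZ : forall z : R, F z%:E [set w | Z w <= z].
Hypothesis Z0Z : {ae P, forall w, (Z0 w <= (Z w)%:E)%E}.
Hypothesis HC : forall phi, M1 phi ->
  eqm P (E `|` O) (fun w => (\1_N w * phi (X w))%:E)
    (fun w => (\1_N w)%:E * \int[pi_ext pi0 pik (Z0 w) (x0 w)]_y (phi y)%:E)%E.

Let D z := (E `|` O) `|` preimage_set_system setT X (filt z).
Let f phi psis (z : Om -> R) w : R :=
  \1_N w * phi (X w) * Kprod pik psis (z w) (X w).
Let g phi psis (z : Om -> R) w : R :=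
  \1_N w * Kr pik phi (z w) (X w) * Kprod pik psis (z w) (X w).

Let filt_measurable z : filt z `<=` @measurable _ (borel T).
Proof. by have [_ h _] := filtF; exact: h. Qed.

Let pre_measurable z : preimage_set_system setT X (filt z) `<=` measurable.
Proof. by move=> _ [C fC <-]; apply: mX => //; exact: filt_measurable fC. Qed.

Let EO_measurable : E `|` O `<=` measurable.
Proof. by move=> A [/Em|/Om']. Qed.

Let D_measurable z : D z `<=` measurable.
Proof. by move=> A [/EO_measurable|/pre_measurable]. Qed.

Let mN : measurable N. Proof. exact: gen_measurable EN. Qed.

Let ED z A : <<s E >> A -> <<s D z >> A.
Proof. by apply: sub_sigma_algebra2 => B EB; left; left. Qed.

Let DD z z' A : z <= z' -> <<s D z >> A -> <<s D z' >> A.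
Proof.
move=> zz; apply: sub_sigma_algebra2 => B [EB|[C fC <-]]; first by left.
by right; exists C => //; have [_ _ m] := filtF; exact: (m _ _ zz).
Qed.

Let nnR_f phi psis z : measurable_fun setT z -> M1 phi -> allM1 psis -> nnR (f phi psis z).
Proof.
move=> mz [mp p01] Mpsis; split=> [|w]; last first.
  have /andP[a b] := p01 (X w); have /andP[a' b'] := Kprod01 pik (z w) (X w) Mpsis.
  by rewrite /f !mulr_ge0.
apply: measurable_funM; last exact: measurable_Kprod.
by apply: measurable_funM; [exact: measurable_indic|exact: (measurableT_comp mp)].
Qed.

Let nnR_g phi psis z : measurable_fun setT z -> M1 phi -> allM1 psis -> nnR (g phi psis z).
Proof.
move=> mz Mp Mpsis; split=> [|w]; last first.
  have /andP[a b] := Kr01 pik (z w) (X w) Mp.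
  have /andP[a' b'] := Kprod01 pik (z w) (X w) Mpsis.
  by rewrite /g !mulr_ge0.
apply: measurable_funM; last exact: measurable_Kprod.
by apply: measurable_funM; [exact: measurable_indic|exact: measurable_Kr].
Qed.

Let indic01 (A : set Om) w : 0 <= (\1_A w : R) <= 1.
Proof. by rewrite indicE ler0n lern1 leq_b1. Qed.

Let f_le1 phi psis z w : M1 phi -> allM1 psis -> f phi psis z w <= 1.
Proof.
move=> [mp p01] Mpsis; have /andP[a b] := p01 (X w).
have /andP[a' b'] := Kprod01 pik (z w) (X w) Mpsis.
have /andP[a'' b''] := indic01 N w.
by rewrite /f !mulr_ile1 ?mulr_ge0.
Qed.

Let g_le1 phi psis z w : M1 phi -> allM1 psis -> g phi psis z w <= 1.
Proof.
move=> Mp Mpsis; have /andP[a b] := Kr01 pik (z w) (X w) Mp.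
have /andP[a' b'] := Kprod01 pik (z w) (X w) Mpsis.
have /andP[a'' b''] := indic01 N w.
by rewrite /g !mulr_ile1 ?mulr_ge0.
Qed.

Let indicM (A B : set Om) w : (\1_(A `&` B) w : R) = \1_A w * \1_B w.
Proof. by rewrite indicI. Qed.

Let below z := [set w | (Z0 w <= z%:E)%E].

Let fixed_level z phi psis : M1 phi -> allM1 psis ->
  eqm P (D z) (fun w => (\1_(below z) w * f phi psis (cst z) w)%:E)
              (fun w => (\1_(below z) w * g phi psis (cst z) w)%:E).
Proof.
move=> Mphi Mpsis.
have mb : measurable (below z) by exact: gen_measurable (EZ0 z).
have nb u : nnR u -> nnR (fun w => \1_(below z) w * u w).
  move=> [mu u0]; split=> [|w]; last by rewrite mulr_ge0.
  by apply: measurable_funM => //; exact: measurable_indic.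
have b1 u w : 0 <= u w <= 1 -> \1_(below z) w * u w <= 1.
  by move=> /andP[u0 u1]; rewrite mulr_ile1//; have /andP[] := indic01 (below z) w.
apply: (@eqm_join _ _ _ P _ _ (fun w => \1_(below z) w * f phi psis (cst z) w)
  (fun w => \1_(below z) w * g phi psis (cst z) w)) => //.
- by apply: nb; exact: nnR_f.
- by apply: nb; exact: nnR_g.
- apply: integral_le1_lty; first by apply: nb; exact: nnR_f.
  by move=> w; apply: b1; rewrite f_le1// andbT; have [_] := nnR_f (measurable_cst z) Mphi Mpsis.
- move=> B1 B2 sB1; rewrite sigma_algebra_id; last first.
    by apply: sigma_algebra_preimage; have [] := filtF.
  move=> [C fC <-]; have mC := filt_measurable fC.
  have Wn : nnmeas ((fun w => (\1_(B1 `&` below z) w)%:E) :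
      g_sigma_algebraType (E `|` O) -> \bar R).
    apply: gindic_nnmeas; apply: gen_setI => //.
    by apply: sub_sigma_algebra2 (EZ0 z) => B; left.
  have key h (u := fun y => \1_C y * h y * Kprod pik psis z y) :
      M1 h -> (\int[P]_w ((\1_(B1 `&` ([set: Om] `&` X @^-1` C)) w)%:E *
        (\1_(below z) w * (\1_N w * h (X w) * Kprod pik psis z (X w)))%:E) =
      \int[P]_w ((\1_(B1 `&` below z) w)%:E * ((\1_N w)%:E *
        \int[pi_ext pi0 pik (Z0 w) (x0 w)]_y (u y)%:E)))%E.
    move=> Mh; have Mu : M1 u by apply: M1M; [apply: M1M => //; exact: M1_indic|exact: Kprod_M1].
    rewrite -(HC Mu Wn); apply: eq_integral => w _.
    rewrite -!EFinM setTI !indicM /u; congr EFin.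
    rewrite (_ : \1_(X @^-1` C) w = \1_C (X w))//.
    move: (\1_C _) (\1_B1 _) (\1_N _) (\1_(below z) _) (h _) (Kprod _ _ _ _).
    by move=> *; ring.
  rewrite (key phi Mphi) /g (key (Kr pik phi z) (Kr_M1 pik z Mphi)).
  apply: eq_integral => w _.
  have [/set_mem[_ Zw]|nB] := boolP (w \in B1 `&` below z); last first.
    by rewrite indicE (negbTE nB) !mul0e.
  by do 2 congr (_ * _)%E; exact: (pointwise_pi_ext filtF A2).
Qed.

(* Levels with countably many values decreasing to Z: Assumption 2 applies on each
   event where zk k is constant, and right-continuity gives the limit. *)
Let zk (k : nat) (w : Om) : R := (Num.ceil (Z w * k.+1%:R) + 1)%:~R / k.+1%:R.

Let zk_gt k w : Z w < zk k w.
Proof.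
by rewrite /zk ltr_pdivlMr// intrD (le_lt_trans (ceil_ge _))// ltrDl.
Qed.

Let zk_le k w : zk k w <= Z w + 2 / k.+1%:R.
Proof.
rewrite /zk ler_pdivrMr// mulrDl divfK// intrD.
have := ceilB1_lt (Z w * k.+1%:R); rewrite intrB => h.
lra.
Qed.

Let Zle c := [set w | Z w <= c].

Let mZle c : measurable (Zle c).
Proof. exact: (gen_measurable (@D_measurable c) (FE (FZ c))). Qed.

Let ceil_setE k (i : int) :
  (fun w => Num.ceil (Z w * k.+1%:R)) @^-1` [set i] =
  Zle (i%:~R / k.+1%:R) `\` Zle ((i - 1)%:~R / k.+1%:R).
Proof.
apply/seteqP; split=> w /=.
  move/eqP; rewrite ceil_eq /Zle /= !ler_pdivlMr// => /andP[h1 h2].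
  by split => //; apply/negP; rewrite -ltNge.
rewrite /Zle /= !ler_pdivlMr// => -[h1 /negP]; rewrite -ltNge => h2.
by apply/eqP; rewrite ceil_eq h1 h2.
Qed.

Let measurable_ceil_eq k (i : int) :
  measurable ((fun w => Num.ceil (Z w * k.+1%:R)) @^-1` [set i]).
Proof. by rewrite ceil_setE; apply: measurableD. Qed.

Let mzk k : measurable_fun setT (zk k).
Proof.
move=> _ B mB; rewrite setTI.
rewrite (_ : _ @^-1` _ = \bigcup_(i : int)
    ((fun w => Num.ceil (Z w * k.+1%:R)) @^-1` [set i] `&`
     [set _ | B ((i + 1)%:~R / k.+1%:R)])).
  apply: countable_bigcupT_measurable => // i; apply: measurableI => //.
  have [h|h] := pselect (B ((i + 1)%:~R / k.+1%:R)).
    by rewrite (_ : mkset _ = setT)//; apply/seteqP; split.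
  by rewrite (_ : mkset _ = set0)//; apply/seteqP; split.
apply/seteqP; split=> w /=.
  by move=> h; exists (Num.ceil (Z w * k.+1%:R)).
by move=> [i _ /= [<-]].
Qed.

Let FZs := stopped_sigma F Z.

Let ceil_trace k (i : int) B : <<s FZs >> B ->
  <<s D ((i + 1)%:~R / k.+1%:R) >>
    (B `&` (fun w => Num.ceil (Z w * k.+1%:R)) @^-1` [set i]).
Proof.
set Y := _ @^-1` _; set Dz := <<s D _ >>.
have h c A : c <= (i + 1)%:~R / k.+1%:R -> F c%:E A -> Dz A.
  by move=> cz /FE; exact: DD.
have c1 : i%:~R / k.+1%:R <= (i + 1)%:~R / k.+1%:R :> R.
  by rewrite ler_pM2r ?invr_gt0// ler_int lerDl.
have c0 : (i - 1)%:~R / k.+1%:R <= (i + 1)%:~R / k.+1%:R :> R.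
  by rewrite ler_pM2r ?invr_gt0// ler_int lerD2l.
have DD' A B' : Dz A -> Dz B' -> Dz (A `\` B').
  exact: (@measurableD _ (g_sigma_algebraType _)).
have DY : Dz Y by rewrite /Y ceil_setE; apply: DD'; apply: h (FZ _).
move: B; apply: smallest_sub.
  split=> [|A DA|A_ DA] /=.
  - by rewrite set0I; exact: sigma_algebra0.
  - rewrite (_ : _ `&` _ = Y `\` (A `&` Y)); first exact: DD'.
    by apply/seteqP; split => w /=; rewrite /setD /=; tauto.
  - by rewrite setI_bigcupl; exact: sigma_algebra_bigcup.
move=> A [mA FA] /=.
rewrite /Y ceil_setE (_ : _ `&` _ =
  (A `&` Zle (i%:~R / k.+1%:R)) `\` (A `&` Zle ((i - 1)%:~R / k.+1%:R))).
  by apply: DD'; apply: h (FA _).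
by apply/seteqP; split => w /=; tauto.
Qed.

Let discretized k phi psis : M1 phi -> allM1 psis ->
  eqm P (FZs `|` O) (fun w => (f phi psis (zk k) w)%:E)
                    (fun w => (g phi psis (zk k) w)%:E).
Proof.
move=> Mphi Mpsis.
apply: eqm_join => //.
- by move=> A [].
- exact: nnR_f.
- exact: nnR_g.
- by apply: integral_le1_lty => [|w]; [exact: nnR_f|exact: f_le1].
move=> B1 B2 sB1 sB2.
have FZm : FZs `<=` measurable by move=> A [].
have mB1 : measurable B1 by exact: gen_measurable sB1.
have mB2 : measurable B2 by exact: gen_measurable sB2.
have mB : measurable (B1 `&` B2) by exact: measurableI.
have nB (u : Om -> R) : nnR u -> nnmeas (fun w => (\1_(B1 `&` B2) w)%:E * (u w)%:E)%E.
  by move=> nu; apply: nnmeasM; [exact: nnmeas_indic|exact: nnR_nnmeas].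
apply: (@eqm_integral _ _ _ P set0).
pose Y w := Num.ceil (Z w * k.+1%:R).
apply: (@eqm_partition _ _ _ P _ int Y) => //.
- by apply: nB; exact: nnR_f.
- by apply: nB; exact: nnR_g.
- by move=> i; exact: measurable_ceil_eq.
move=> i; pose z : R := (i + 1)%:~R / k.+1%:R.
have zkE w : Y w = i -> zk k w = z by rewrite /zk /z -/(Y w) => ->.
pose C := B1 `&` Y @^-1` [set i] `&` B2.
have DC : <<s D z >> C.
  apply: gen_setI; first exact: ceil_trace.
  by apply: sub_sigma_algebra2 sB2 => A OA; left; right.
have mC : measurable C by exact: gen_measurable DC.
have mb : measurable (below z) by exact: gen_measurable (EZ0 z).
have nC (A : set Om) (u : Om -> R) : measurable A -> nnR u -> nnR (fun w => \1_A w * u w).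
  move=> mA [mu u0]; split=> [|w]; last by rewrite mulr_ge0.
  by apply: measurable_funM => //; exact: measurable_indic.
have e := eqm_mul (gindic_nnmeas R DC) (@fixed_level z _ _ Mphi Mpsis).
have mYi := measurable_ceil_eq k i.
have sub0 : set0 `<=` <<s D z >> by [].
have := eqm_sub sub0 e.
pose U (u : Om -> R) w : R := \1_C w * (\1_(below z) w * u w).
pose U' (u : Om -> R) w : R := \1_(Y @^-1` [set i]) w * (\1_(B1 `&` B2) w * u w).
have UU (u : (Om -> R) -> Om -> R) w : (Z0 w <= (Z w)%:E)%E ->
    (forall v v', v w = v' w -> u v w = u v' w) ->
    U (u (cst z)) w = U' (u (zk k)) w.
  move=> Zw uE; rewrite /U /U' /C !indicM.
  rewrite [\1_(_ @^-1` _) w]indicE; case: (boolP (w \in _)) => [/set_mem/= Yw|_]; last first.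
    by rewrite !(mulr0, mul0r).
  have zw := zkE w Yw; rewrite (uE (cst z) (zk k))//.
  rewrite (_ : \1_(below z) w = 1) ?mulr1 ?mul1r//.
  rewrite indicE mem_set//= /below /= (le_trans Zw)// lee_fin -zw ltW//.
apply: (@eqm_ae _ _ _ P set0 (U (f phi psis (cst z))) (U' (f phi psis (zk k)))
  (U (g phi psis (cst z))) (U' (g phi psis (zk k)))) => //.
- by apply: (nC) => //; apply: nC => //; exact: nnR_f.
- by apply: (nC) => //; apply: nC => //; exact: nnR_f.
- by apply: (nC) => //; apply: nC => //; exact: nnR_g.
- by apply: (nC) => //; apply: nC => //; exact: nnR_g.
- apply: filterS Z0Z => w Zw; apply: (UU (f phi psis)) => // v v' vv.
  by rewrite /f vv.
- apply: filterS Z0Z => w Zw; apply: (UU (g phi psis)) => // v v' vv.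
  by rewrite /g vv.
Qed.

Let cont01 (phi : T -> R) := continuous phi /\ forall x, 0 <= phi x <= 1.

Let cont01_M1 phi : cont01 phi -> M1 phi.
Proof. by move=> [cphi p01]; split => //; exact: continuous_borel. Qed.

Let cvg_zk w : zk k w @[k --> \oo] --> Z w.
Proof.
apply: (@squeeze_cvgr _ _ _ _ (cst (Z w)) (fun k => Z w + 2 * harmonic k)).
- apply: nearW => k; rewrite [X in _ && X]zk_le andbT; exact: ltW (zk_gt _ _).
- exact: cvg_cst.
rewrite -[X in _ --> X]addr0 -[X in _ --> _ + X](mulr0 2).
by apply: cvgD; [exact: cvg_cst|apply: cvgMr; exact: cvg_harmonic].
Qed.

Let cvg_Kr phi w : cont01 phi ->
  Kr pik phi (zk k w) (X w) @[k --> \oo] --> Kr pik phi (Z w) (X w).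
Proof.
move=> [cphi p01]; have bphi : bounded_fun phi.
  exists 1; split; first exact: num_real.
  move=> t t1 y _; have /andP[a b] := p01 y.
  by rewrite /= ger0_norm// (le_trans b)// ltW.
have [rc _] := A1 (X w) cphi bphi.
by have /cvg_at_rightP := rc (Z w); apply; split => [k|].
Qed.

Let cvg_Kprod psis w :
  (forall i, (i < size psis)%N -> cont01 (nth (cst 0) psis i)) ->
  Kprod pik psis (zk k w) (X w) @[k --> \oo] --> Kprod pik psis (Z w) (X w).
Proof.
elim: psis => [_|psi psis ih h].
  by rewrite /Kprod; under eq_fun do rewrite big_nil; rewrite big_nil; exact: cvg_cst.
rewrite /Kprod; under eq_fun do rewrite big_cons; rewrite big_cons.
apply: cvgM; first by apply: cvg_Kr; exact: (h 0%N).
by apply: ih => i ip; exact: (h i.+1).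
Qed.

Let strong_markov_cont phi psis : cont01 phi ->
  (forall i, (i < size psis)%N -> cont01 (nth (cst 0) psis i)) ->
  eqm P (FZs `|` O) (fun w => (f phi psis Z w)%:E) (fun w => (g phi psis Z w)%:E).
Proof.
move=> cphi cpsis; have Mphi := cont01_M1 cphi.
have Mpsis : allM1 psis by move=> i ip; apply: cont01_M1; exact: cpsis.
have FZOm : FZs `|` O `<=` measurable by move=> A [[]|/Om'].
apply: eqm_sets => //; [exact: nnR_f|exact: nnR_g|].
move=> A sA; have mA : measurable A by exact: gen_measurable sA.
have lim (u : nat -> Om -> R) v : (forall k, nnR (u k)) -> nnR v ->
    (forall k w, u k w <= 1) -> (forall w, u k w @[k --> \oo] --> v w) ->
    (\int[P]_w ((\1_A w)%:E * (u k w)%:E) @[k --> \oo] -->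
     \int[P]_w ((\1_A w)%:E * (v w)%:E))%E.
  move=> nu nv u1 uv.
  have m1A : measurable_fun setT (fun w => (\1_A w)%:E : \bar R).
    by apply/measurable_EFinP; exact: measurable_indic.
  have [] // := @dominated_convergence _ _ _ P setT measurableT
    (fun k w => (\1_A w)%:E * (u k w)%:E)%E
    (fun w => (\1_A w)%:E * (v w)%:E)%E (cst 1%E).
  - by move=> k; apply: emeasurable_funM => //; exact: (nnR_nnmeas (nu k)).1.
  - by apply: emeasurable_funM => //; exact: (nnR_nnmeas nv).1.
  - apply: nearW => w _; apply: cvgeZl => //.
    by apply: cvg_EFin; [exact: nearW|exact: uv].
  - exact: finite_measure_integrable_cst.
  - apply: nearW => w k _; rewrite -EFinM abse_EFin lee_fin.
    have := (nu k).2 w => u0; have /andP[a b] := indic01 A w.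
    by rewrite ger0_norm ?mulr_ge0// mulr_ile1.
have lf := lim (fun k => f phi psis (zk k)) (f phi psis Z).
have lg := lim (fun k => g phi psis (zk k)) (g phi psis Z).
have {}lf := lf (fun k => nnR_f (mzk k) Mphi Mpsis) (nnR_f mZ Mphi Mpsis).
have {}lg := lg (fun k => nnR_g (mzk k) Mphi Mpsis) (nnR_g mZ Mphi Mpsis).
rewrite -(cvg_lim _ (lf _ _))//; last 2 first.
- by move=> k w; exact: f_le1.
- move=> w; apply: cvgM; first exact: cvg_cst.
  exact: cvg_Kprod.
rewrite -(cvg_lim _ (lg _ _))//; last 2 first.
- by move=> k w; exact: g_le1.
- move=> w; apply: cvgM; last exact: cvg_Kprod.
  by apply: cvgM; [exact: cvg_cst|exact: cvg_Kr].
congr (limn _); apply/funext => k.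
exact: (eqm_indic (discretized k Mphi Mpsis)).
Qed.

Let int_X (u : Om -> R) : nnR u -> (forall w, u w <= 1) ->
  is_int (fun h : borel T -> \bar R => \int[P]_w ((u w)%:E * h (X w)))%E.
Proof.
move=> [mu u0] u1; apply: (@int_comp _ (borel T) R _ Om P u (fun w h => h (X w))) => //.
  by move=> w; exact: int_dirac.
by move=> h [mh _]; exact: (measurableT_comp mh).
Qed.

Let int_K (u : Om -> R) : nnR u -> (forall w, u w <= 1) ->
  is_int (fun h : borel T -> \bar R =>
    \int[P]_w ((u w)%:E * \int[pik (Z w, X w)]_y h y))%E.
Proof.
move=> [mu u0] u1; apply: (@int_comp _ (borel T) R _ Om P u
  (fun w h => \int[pik (Z w, X w)]_y h y)%E) => //.
  by move=> w; exact: int_integral.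
by move=> h nh; exact: measurable_integral_pik.
Qed.

Lemma strong_markov phi psis : M1 phi -> allM1 psis ->
  eqm P (stopped_sigma F Z `|` O)
    (fun w => (\1_N w * phi (X w) * Kprod pik psis (Z w) (X w))%:E)
    (fun w => (\1_N w * Kr pik phi (Z w) (X w) * Kprod pik psis (Z w) (X w))%:E).
Proof.
move=> Mphi Mpsis.
have FZOm : FZs `|` O `<=` measurable by move=> A [[]|/Om'].
apply: (@eqm_sets _ _ _ P _ (f phi psis Z) (g phi psis Z)) => //.
- exact: nnR_f.
- exact: nnR_g.
move=> A sA; have mA : measurable A by exact: gen_measurable sA.
have nA (u : Om -> R) : nnR u -> nnR (fun w => \1_A w * u w).
  move=> [mu u0]; split=> [|w]; last by rewrite mulr_ge0.
  by apply: measurable_funM => //; exact: measurable_indic.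
have A1' (u : Om -> R) w : 0 <= u w -> u w <= 1 -> \1_A w * u w <= 1.
  by move=> u0 u1; rewrite mulr_ile1//; have /andP[] := indic01 A w.
have fin (u : Om -> R) : nnR u -> (forall w, u w <= 1) ->
    (\int[P]_w ((u w)%:E * 1) < +oo)%E.
  by move=> nu u1; under eq_integral do rewrite mule1; exact: integral_le1_lty.
pose eqA ph ps := (\int[P]_w ((\1_A w)%:E * (f ph ps Z w)%:E) =
  \int[P]_w ((\1_A w)%:E * (g ph ps Z w)%:E))%E.
have kmul (v : R) ps w : (0 <= v)%R -> (v <= 1)%R -> allM1 ps ->
    0 <= \1_A w * (\1_N w * v * Kprod pik ps (Z w) (X w)) <= 1.
  move=> v0 v1 Mps; have /andP[a' b'] := Kprod01 pik (Z w) (X w) Mps.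
  have /andP[a b] := indic01 A w; have /andP[a'' b''] := indic01 N w.
  by rewrite !mulr_ge0//= !mulr_ile1 ?mulr_ge0.
have step1 ph ps : M1 ph -> (forall i, (i < size ps)%N -> cont01 (nth (cst 0) ps i)) ->
    eqA ph ps.
  move=> Mph cps; have Mps : allM1 ps by move=> i ip; apply: cont01_M1; exact: cps.
  pose u w := \1_A w * (\1_N w * 1 * Kprod pik ps (Z w) (X w)).
  have nu : nnR u.
    exact: (nA _ (@nnR_f (cst 1) ps Z mZ (M1_cst1 _ _) Mps)).
  have u1 w : u w <= 1 by have /andP[] := kmul 1 ps w ler01 (lexx _) Mps.
  have e1 h : M1 h -> (\int[P]_w ((u w)%:E * (EFin \o h) (X w)) =
      \int[P]_w ((\1_A w)%:E * (f h ps Z w)%:E))%E.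
    move=> Mh; apply: eq_integral => w _; rewrite /= -!EFinM /u /f; congr EFin.
    by ring.
  have e2 h : M1 h -> (\int[P]_w ((u w)%:E * \int[pik (Z w, X w)]_y (EFin \o h) y) =
      \int[P]_w ((\1_A w)%:E * (g h ps Z w)%:E))%E.
    move=> Mh; apply: eq_integral => w _; rewrite -KrE// -!EFinM /u /g; congr EFin.
    by ring.
  rewrite /eqA -e1// -e2//.
  apply: (int_unique_cont polT (int_X nu u1) (int_K nu u1)) => //.
  - exact: fin.
  - move=> h ch h01; have Mh : M1 h by exact: cont01_M1.
    rewrite e1// e2//; apply: (eqm_indic (strong_markov_cont _ cps)) => //.
  - exact: M1_nnmeas.
have step2 ms : forall cs ph, M1 ph -> allM1 ms ->
    (forall i, (i < size cs)%N -> cont01 (nth (cst 0) cs i)) -> eqA ph (ms ++ cs).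
  elim: ms => [|m ms ih] cs ph Mph; first by move=> _; exact: step1.
  move=> /allM1_cons[Mm Mms] ccs.
  have Mmc : allM1 (ms ++ cs).
    move=> i; rewrite size_cat nth_cat; case: (ltnP i (size ms)) => [im _|mi ip]; first exact: Mms.
    by apply: cont01_M1; apply: ccs; rewrite ltn_subLR.
  pose u v w := \1_A w * (\1_N w * v w * Kprod pik (ms ++ cs) (Z w) (X w)).
  have nu1 : nnR (u (fun w => ph (X w))) by apply: nA; exact: nnR_f.
  have nu2 : nnR (u (fun w => Kr pik ph (Z w) (X w))) by apply: nA; exact: nnR_g.
  have u11 w : u (fun w => ph (X w)) w <= 1.
    by have /andP[h1 h2] := Mph.2 (X w); have /andP[] := kmul _ (ms ++ cs) w h1 h2 Mmc.
  have u21 w : u (fun w => Kr pik ph (Z w) (X w)) w <= 1.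
    by have /andP[h1 h2] := Kr01 pik (Z w) (X w) Mph;
      have /andP[] := kmul _ (ms ++ cs) w h1 h2 Mmc.
  have e1 h : M1 h -> (\int[P]_w ((u (fun w => ph (X w)) w)%:E *
      \int[pik (Z w, X w)]_y (EFin \o h) y) =
      \int[P]_w ((\1_A w)%:E * (f ph (h :: ms ++ cs) Z w)%:E))%E.
    move=> Mh; apply: eq_integral => w _; rewrite -KrE// -!EFinM /u /f; congr EFin.
    by rewrite /Kprod big_cons; ring.
  have e2 h : M1 h -> (\int[P]_w ((u (fun w => Kr pik ph (Z w) (X w)) w)%:E *
      \int[pik (Z w, X w)]_y (EFin \o h) y) =
      \int[P]_w ((\1_A w)%:E * (g ph (h :: ms ++ cs) Z w)%:E))%E.
    move=> Mh; apply: eq_integral => w _; rewrite -KrE// -!EFinM /u /g; congr EFin.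
    by rewrite /Kprod big_cons; ring.
  rewrite /eqA cat_cons -e1// -e2//.
  apply: (int_unique_cont polT (int_K nu1 u11) (int_K nu2 u21)) => //.
  - have -> : (fun w => (u (fun w => ph (X w)) w)%:E * \int[pik (Z w, X w)]_y 1)%E =
        (fun w => (u (fun w => ph (X w)) w)%:E * 1)%E.
      apply/funext => w; congr (_ * _)%E.
      by rewrite (integral_cst _ measurableT 1%E) mul1e; exact: prob_kernel.
    exact: fin.
  - move=> h ch h01; have Mh : M1 h by exact: cont01_M1.
    rewrite e1// e2//.
    have Ek z y : Kprod pik (h :: ms ++ cs) z y = Kprod pik (ms ++ (h :: cs)) z y.
      by rewrite /Kprod big_cons !big_cat /= big_cons mulrCA.
    have Ef : f ph (h :: ms ++ cs) Z = f ph (ms ++ (h :: cs)) Z.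
      by apply/funext => w; rewrite /f Ek.
    have Eg : g ph (h :: ms ++ cs) Z = g ph (ms ++ (h :: cs)) Z.
      by apply/funext => w; rewrite /g Ek.
    rewrite Ef Eg; apply: ih => // -[|i] //= ip.
    exact: ccs.
  - exact: M1_nnmeas.
by have := step2 psis [::] phi Mphi Mpsis; rewrite cats0; apply.
Qed.

End strong_markov.

(** * The sigma-fields of the algorithm *)

Section systems.
Context d (Om : measurableType d).

Lemma countable_bigcup_gen (G : set (set Om)) (C : countType) (F : C -> set Om) :
  (forall i, <<s G >> (F i)) -> <<s G >> (\bigcup_i F i).
Proof.
by move=> GF; apply: (@countable_bigcupT_measurable _ (g_sigma_algebraType G)).
Qed.

Lemma gen_setD (G : set (set Om)) A B :
  <<s G >> A -> <<s G >> B -> <<s G >> (A `\` B).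
Proof. exact: (@measurableD _ (g_sigma_algebraType G)). Qed.

Lemma gen_trace (G : set (set Om)) (T : Type) (Hg : set (set T)) (A : set Om)
    (y : Om -> T) :
  <<s G >> A -> (forall B, Hg B -> <<s G >> (A `&` y @^-1` B)) ->
  forall B, <<s Hg >> B -> <<s G >> (A `&` y @^-1` B).
Proof.
move=> GA GB; apply: smallest_sub => //; split=> [|B DB|B_ DB] /=.
- by rewrite preimage_set0 setI0; exact: sigma_algebra0.
- rewrite (_ : _ `&` _ = A `\` (A `&` y @^-1` B)); first exact: gen_setD.
  by apply/seteqP; split => w /=; rewrite /setD /=; tauto.
- rewrite preimage_bigcup setI_bigcupr; exact: sigma_algebra_bigcup.
Qed.

Lemma restr_gen (T : Type) (H : set (set T)) (I : Om -> {fset nat})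
    (Y : Om -> nat -> T) (G : set (set Om)) :
  (forall J, <<s G >> [set w | I w = J]) ->
  (forall n B, H B -> <<s G >> [set w | n \in I w /\ B (Y w n)]) ->
  preimage_set_system setT (fun w => restr (I w) (Y w)) (rep_sigma H) `<=` <<s G >>.
Proof.
move=> GI GY _ [C rC <-]; rewrite setTI.
pose y (J : {fset nat}) w := fun j : J => Y w (val j).
rewrite (_ : _ @^-1` _ = \bigcup_(J : {fset nat}) ([set w | I w = J] `&`
    y J @^-1` [set x | C (existT (fun J : {fset nat} => J -> T) J x)])).
  apply: countable_bigcup_gen => J.
  apply: gen_trace (rC J) => // _ [j _ [B HB <-]]; rewrite setTI.
  rewrite (_ : _ `&` _ = [set w | I w = J] `&`
     [set w | val j \in I w /\ B (Y w (val j))]).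
    by apply: gen_setI => //; exact: GY.
  apply/seteqP; split=> w /= [IJ].
    by move=> Bj; split => //; split => //; rewrite IJ; exact: valP.
  by move=> [_ Bj].
apply/seteqP; split=> w /=.
  by move=> Cw; exists (I w).
by move=> [J _ [/= IJ]]; rewrite /restr /y; case: _ / IJ.
Qed.

Lemma rep_sigma_sigma_algebra (T : Type) (H : set (set T)) :
  sigma_algebra setT (rep_sigma H).
Proof.
split=> [J|C rC J|C_ rC J] /=.
- exact: sigma_algebra0.
- have := rC J; set D := mkset _ => DJ.
  rewrite (_ : mkset _ = setT `\` D); first exact: sigma_algebraCD.
  by apply/seteqP; split=> x /=.
- rewrite (_ : mkset _ = \bigcup_i [set x : J -> T |
       C_ i (existT (fun J : {fset nat} => J -> T) J x)]).
    by apply: sigma_algebra_bigcup => i; exact: rC.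
  by apply/seteqP; split.
Qed.

Lemma pow_sigma_setT (T : Type) (H : set (set T)) J : pow_sigma H (J := J) setT.
Proof.
rewrite -(setD0 setT); apply: sigma_algebraCD; exact: sigma_algebra0.
Qed.

Lemma restr_lab (T : Type) (H : set (set T)) (I : Om -> {fset nat})
    (Y : Om -> nat -> T) J :
  preimage_set_system setT (fun w => restr (I w) (Y w)) (rep_sigma H)
    [set w | I w = J].
Proof.
exists [set s | projT1 s = J]; last by rewrite setTI.
move=> J' /=; have [->|/eqP JJ] := eqVneq J' J.
  rewrite (_ : mkset _ = setT); first exact: pow_sigma_setT.
  by apply/seteqP; split.
rewrite (_ : mkset _ = set0); first exact: sigma_algebra0.
by apply/seteqP; split.
Qed.

Lemma restr_val (T : Type) (H : set (set T)) (I : Om -> {fset nat})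
    (Y : Om -> nat -> T) n B : H B ->
  preimage_set_system setT (fun w => restr (I w) (Y w)) (rep_sigma H)
    [set w | n \in I w /\ B (Y w n)].
Proof.
move=> HB; exists [set s : sys T | exists j : projT1 s, val j = n /\ B (projT2 s j)].
  move=> J /=; have [nJ|nJ] := boolP (n \in J).
    apply: sub_sigma_algebra; exists [` nJ]%fset => //; exists B => //.
    rewrite setTI; apply/seteqP; split=> x /=.
      by move=> Bx; exists [` nJ]%fset.
    by move=> [j [jn Bj]]; rewrite (_ : [` nJ]%fset = j)//; exact: val_inj.
  rewrite (_ : mkset _ = set0); first exact: sigma_algebra0.
  apply/seteqP; split => // x /= [j [jn _]].
  by move: nJ; rewrite -jn => /negP; apply; exact: valP.
rewrite setTI; apply/seteqP; split => w /=.
  by move=> [j [<- Bj]]; split => //; exact: valP.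
by move=> [nI Bn]; exists [` nI]%fset.
Qed.

End systems.

Section gams_measurability.
Context d (Om : measurableType d) (R : realType) (T : ptopologicalType).
Context dU (U : measurableType dU).
Variables (P : probability Om R) (pi0 : probability (borel T) R).
Variables (filt : R -> set (set T)).
Variable pik : R.-pker (measurableTypeR R * borel T)%type ~> borel T.
Variable a : gams Om R T U.
Hypotheses (filtF : level_filtration filt) (a3 : assumption3 P filt a).
Hypothesis gf : gams_framework P pi0 filt pik a.

Definition repset q n (B : set T) := [set w | n \in lab a q w /\ B (rep a q n w)].
Definition wgtset q n (D : set R) := [set w | n \in lab a q w /\ D (wgt a q n w)].

Definition gLab q := [set A | exists J, A = [set w | lab a q w = J]].
Definition gWgt q := [set A | exists n D, measurable D /\ A = wgtset q n D].
Definition gRep q n := [set A | exists m (B : set (borel T)),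
  [/\ m <> n, measurable B & A = repset q m B]].
Definition gAll q := [set A | exists m (B : set (borel T)),
  measurable B /\ A = repset q m B].
Definition gPast q := if q is p.+1 then
  Fq filt a p `|` sigma_of_discrete (par_sys a p) else set0.
Definition gEnv q := gPast q `|` (gLab q `|` gWgt q).

(* default values are used on the event that n is not a label *)
Definition repx q n w : borel T := if n \in lab a q w then rep a q n w else point.

Let prod1 (H1 : set (set T)) (H2 : set (set R)) B : H1 B -> prod_sigma H1 H2 (fst @^-1` B).
Proof. by move=> HB; apply: sub_sigma_algebra; left; exists B; rewrite ?setTI. Qed.

Let prod2 (H1 : set (set T)) (H2 : set (set R)) B : H2 B -> prod_sigma H1 H2 (snd @^-1` B).
Proof. by move=> HB; apply: sub_sigma_algebra; right; exists B; rewrite ?setTI. Qed.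

Lemma sigma_wsys_lab q J : sigma_wsys a q [set w | lab a q w = J].
Proof. exact: restr_lab. Qed.

Lemma sigma_wsys_rep q n (B : set (borel T)) : measurable B -> sigma_wsys a q (repset q n B).
Proof.
move=> mB; have := @restr_val _ Om _ _ (lab a q)
  (fun w n => (rep a q n w, wgt a q n w)) n _ (@prod1 (@measurable _ (borel T)) (@measurable _ (measurableTypeR R)) B mB); exact.
Qed.

Lemma sigma_wsys_wgt q n D : measurable D -> sigma_wsys a q (wgtset q n D).
Proof.
move=> mD; have := @restr_val _ Om _ _ (lab a q)
  (fun w n => (rep a q n w, wgt a q n w)) n _ (@prod2 (@measurable _ (borel T)) (@measurable _ (measurableTypeR R)) D mD); exact.
Qed.

Lemma measurable_lab q J : measurable [set w | lab a q w = J].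
Proof. by apply: (wsys_measurable gf); exact: sigma_wsys_lab. Qed.

Lemma measurable_repset q n (B : set (borel T)) : measurable B -> measurable (repset q n B).
Proof. by move=> mB; apply: (wsys_measurable gf); exact: sigma_wsys_rep. Qed.

Lemma measurable_wgtset q n D : measurable D -> measurable (wgtset q n D).
Proof. by move=> mD; apply: (wsys_measurable gf); exact: sigma_wsys_wgt. Qed.

Lemma inlab_gen (G : set (set Om)) q n : gLab q `<=` <<s G >> ->
  <<s G >> [set w | n \in lab a q w].
Proof.
move=> GL; rewrite (_ : mkset _ = \bigcup_(J : {fset nat})
    ([set w | lab a q w = J] `&` [set w | n \in J])).
  apply: countable_bigcup_gen => J; apply: gen_setI; last exact: gen_cst.
  by apply: GL; exists J.
apply/seteqP; split=> w /=; first by move=> nw; exists (lab a q w).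
by move=> [J _ [<-]].
Qed.

Lemma wsys_gen (G : set (set Om)) q (H : set (set T)) :
  gLab q `<=` <<s G >> -> gWgt q `<=` <<s G >> ->
  (forall n B, H B -> <<s G >> (repset q n B)) ->
  preimage_set_system setT (wsys a q)
    (rep_sigma (prod_sigma H (@measurable _ (measurableTypeR R)))) `<=` <<s G >>.
Proof.
move=> GL GW GH; apply: restr_gen => [J|n B HB]; first by apply: GL; exists J.
have := @gen_trace _ Om G (T * R)%type _ [set w | n \in lab a q w]
  (fun w => (rep a q n w, wgt a q n w)) (inlab_gen n GL); apply; last exact: HB.
move=> C [[B' HB' <-]|[D mD <-]]; rewrite setTI; first exact: GH.
by apply: GW; exists n, D.
Qed.

Lemma Flev_sigma q (z : R) : sigma_algebra setT (Flev filt a q z%:E).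
Proof.
case: q => [|q] /=; last exact: smallest_sigma_algebra.
exact/sigma_algebra_preimage/rep_sigma_sigma_algebra.
Qed.

Lemma Fq_measurable q : Fq filt a q `<=` measurable.
Proof. by move=> A []. Qed.

Lemma gPast_measurable q : gPast q `<=` measurable.
Proof.
case: q => [//|q] A [/Fq_measurable//|pA].
by have [_ h _ _] := a3_split a3 q; apply: h; right.
Qed.

Lemma gEnv_measurable q : gEnv q `<=` measurable.
Proof.
move=> A [/gPast_measurable//|[[J ->]|[n [D [mD ->]]]]].
  exact: measurable_lab.
exact: measurable_wgtset.
Qed.

Lemma gRep_measurable q n : gRep q n `<=` measurable.
Proof. by move=> A [m [B [_ mB ->]]]; exact: measurable_repset. Qed.

Lemma Flev_gen q (z : R) : Flev filt a q z%:E `<=`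
  <<s gEnv q `|` [set A | exists n C, filt z C /\ A = repset q n C] >>.
Proof.
have h : filt_sys filt (wsys a q) z%:E `<=`
    <<s gEnv q `|` [set A | exists n C, filt z C /\ A = repset q n C] >>.
  apply: wsys_gen.
  - by move=> A LA; apply: sub_sigma_algebra; left; right; left.
  - by move=> A LA; apply: sub_sigma_algebra; left; right; right.
  - by move=> n B fB; apply: sub_sigma_algebra; right; exists n, B.
case: q h => [//|q] h /=; apply: smallest_sub; first exact: smallest_sigma_algebra.
move=> A [|/h//]; apply: smallest_sub; first exact: smallest_sigma_algebra.
by move=> {}A pA; apply: sub_sigma_algebra; left; left.
Qed.

Lemma Flev_sys q (z : R) : filt_sys filt (wsys a q) z%:E `<=` Flev filt a q z%:E.
Proof. by case: q => [//|q] A fA /=; apply: sub_sigma_algebra; right. Qed.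

Let FlevI q (z : R) A B : Flev filt a q z%:E A -> Flev filt a q z%:E B ->
  Flev filt a q z%:E (A `&` B).
Proof.
rewrite -[Flev _ _ _ _](sigma_algebra_id (Flev_sigma q z)); exact: gen_setI.
Qed.

Lemma lev_set q (z : R) : Flev filt a q z%:E [set w | lev a q w <= z].
Proof.
by have := a3_lev a3 q z%:E; rewrite (_ : [set w | _] = [set w | lev a q w <= z]).
Qed.

Lemma Flev_measurable q (z : R) : Flev filt a q z%:E `<=` measurable.
Proof.
move=> A /Flev_gen; apply: gen_measurable => B [/gEnv_measurable//|[n [C [fC ->]]]].
by apply: measurable_repset; have [_ h _] := filtF; exact: h fC.
Qed.

Lemma Fq_of_Flev q A : (forall z : R, Flev filt a q z%:E A) -> Fq filt a q A.
Proof.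
move=> FA; split; first exact: (Flev_measurable (FA 0)).
by move=> z; apply: FlevI => //; exact: lev_set.
Qed.

Lemma gLab_Fq q : gLab q `<=` Fq filt a q.
Proof. by move=> _ [J ->]; apply: Fq_of_Flev => z; apply: Flev_sys; exact: restr_lab. Qed.

Lemma gWgt_Fq q : gWgt q `<=` Fq filt a q.
Proof.
move=> _ [n [D [mD ->]]]; apply: Fq_of_Flev => z; apply: Flev_sys.
have := @restr_val _ Om _ _ (lab a q)
  (fun w n => (rep a q n w, wgt a q n w)) n _ (@prod2 (filt z) (@measurable _ (measurableTypeR R)) D mD); exact.
Qed.

Lemma Flev_mono q (z z' : R) : z <= z' ->
  Flev filt a q z%:E `<=` Flev filt a q z'%:E.
Proof.
move=> zz; have h : filt_sys filt (wsys a q) z%:E `<=` filt_sys filt (wsys a q) z'%:E.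
  move=> _ [C rC <-]; exists C => // J; move: (rC J); apply: sub_sigma_algebra2.
  move=> _ [j _ [B HB <-]]; exists j => //; exists B => //; move: B HB.
  apply: sub_sigma_algebra2 => B [[B' fB <-]|]; last by right.
  by left; exists B' => //; have [_ _ m] := filtF; exact: (m _ _ zz).
case: q h => [//|q] h /=; apply: sub_sigma_algebra2 => A [pA|/h]; first by left.
by right.
Qed.

Lemma lev_Fq q : gmeas (Fq filt a q) (lev a q).
Proof.
apply: (measurability _ (RGenOInfty.measurableE R)) => _ [_ [x ->] <-].
rewrite setTI (_ : _ @^-1` _ = ~` [set w | lev a q w <= x]); last first.
  by apply/seteqP; split => w /=; rewrite in_itv/= andbT ltNge => /negP.
apply: sigma_algebraC; apply: sub_sigma_algebra; split.
  exact: Flev_measurable (lev_set q x).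
move=> z; have [xz|zx] := leP x z.
  rewrite (_ : _ `&` _ = [set w | lev a q w <= x]); last first.
    by apply/seteqP; split => w /= => [[]//|h]; split => //; exact: le_trans xz.
  exact: Flev_mono xz _ (lev_set q x).
rewrite (_ : _ `&` _ = [set w | lev a q w <= z]); first exact: lev_set.
apply/seteqP; split => w /= => [[]//|h]; split => //.
by rewrite (le_trans h)// ltW.
Qed.

Lemma Fq_succ q : Fq filt a q `<=` Fq filt a q.+1.
Proof.
move=> A FA; apply: Fq_of_Flev => z /=; apply: sub_sigma_algebra; left.
by apply: sub_sigma_algebra; left.
Qed.

Lemma Fq_gen q (G : set (set Om)) :
  (forall z : R, Flev filt a q z%:E `<=` <<s G >>) -> Fq filt a q `<=` <<s G >>.
Proof.
move=> FG A [_ FA]; rewrite (_ : A = \bigcup_(n : nat) (A `&` [set w | lev a q w <= n%:R])).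
  by apply: countable_bigcup_gen => n; exact: FG (FA n%:R).
apply/seteqP; split=> w /=; last by move=> [n _ []].
move=> Aw; exists (Num.truncn (lev a q w)).+1 => //; split => //=.
exact: ltW (truncnS_gt _).
Qed.

Lemma hist_sub q : hist a q `<=` hist a q.+1.
Proof. by move=> A hA; apply: sub_sigma_algebra; do 7 left. Qed.

Lemma wsys_hist q : sigma_wsys a q `<=` hist a q.
Proof.
case: q => [|q] A sA; apply: sub_sigma_algebra; first by left; left.
by left; left; right.
Qed.

Lemma hist_sigma q : <<s hist a q >> = hist a q.
Proof. by apply: sigma_algebra_id; case: q => [|q]; exact: smallest_sigma_algebra. Qed.

Lemma Fq_hist q : Fq filt a q `<=` hist a q.
Proof.
elim: q => [|q ih]; rewrite -hist_sigma; apply: Fq_gen => z A /Flev_gen.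
  apply: sub_sigma_algebra2 => B [[//|[[J ->]|[n [D [mD ->]]]]]|[n [C [fC ->]]]];
    apply: wsys_hist.
  - exact: sigma_wsys_lab.
  - exact: sigma_wsys_wgt.
  - by apply: sigma_wsys_rep; have [_ h _] := filtF; exact: h fC.
apply: sub_sigma_algebra2 => B [[[/ih/hist_sub//|pB]|[[J ->]|[n [D [mD ->]]]]]|[n [C [fC ->]]]].
- by apply: sub_sigma_algebra; do 4 left; right.
- by apply: wsys_hist; exact: sigma_wsys_lab.
- by apply: wsys_hist; exact: sigma_wsys_wgt.
- by apply: wsys_hist; apply: sigma_wsys_rep; have [_ h _] := filtF; exact: h fC.
Qed.

Lemma measurable_lab_default (G : set (set Om)) d' (V : measurableType d') q n
    (y : Om -> V) v :
  <<s G >> [set w | n \in lab a q w] ->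
  (forall B, measurable B -> <<s G >> [set w | n \in lab a q w /\ B (y w)]) ->
  gmeas G (fun w => if n \in lab a q w then y w else v).
Proof.
move=> GI GB _ B mB; rewrite setTI.
rewrite (_ : _ @^-1` B = [set w | n \in lab a q w /\ B (y w)] `|`
    ([set _ | B v] `\` [set w | n \in lab a q w])).
  apply: (@measurableU _ (g_sigma_algebraType G)); first exact: GB.
  by apply: gen_setD => //; exact: gen_cst.
apply/seteqP; split => w /=; rewrite /setD /=; case: ifPn => nI.
- by left.
- by right.
- by move=> [[]|[]].
- by move=> [[]|[]].
Qed.

Lemma measurable_repx (G : set (set Om)) q n :
  <<s G >> [set w | n \in lab a q w] ->
  (forall B : set (borel T), measurable B -> <<s G >> (repset q n B)) ->
  gmeas G (repx q n).
Proof. by move=> GI GB; exact: measurable_lab_default. Qed.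

Definition wgtx q n w : R := if n \in lab a q w then wgt a q n w else 0.

Lemma measurable_wgtx (G : set (set Om)) q n :
  <<s G >> [set w | n \in lab a q w] ->
  (forall D, measurable D -> <<s G >> (wgtset q n D)) ->
  gmeas G (wgtx q n).
Proof. by move=> GI GB; exact: measurable_lab_default. Qed.

Definition inlab q n := [set w | n \in lab a q w].

Lemma inlab_Fq q n : <<s Fq filt a q >> (inlab q n).
Proof.
by apply: inlab_gen => B LB; apply: sub_sigma_algebra; exact: gLab_Fq.
Qed.

Lemma wgtx_Fq q n : gmeas (Fq filt a q) (wgtx q n).
Proof.
apply: measurable_wgtx => [|D mD]; first exact: inlab_Fq.
by apply: sub_sigma_algebra; apply: gWgt_Fq; exists n, D.
Qed.

Definition plev q w : \bar R := if q is p.+1 then (lev a p w)%:E else -oo%E.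

Definition ppar q n w : T :=
  if q is p.+1 then rep a p (par a p n w) w else rep a 0 n w.

(* given gEnv q, the replicas are independent, the n-th one having the law it
   was sampled from *)
Definition fresh q := forall n phi, M1 phi ->
  eqm P (gEnv q `|` gRep q n) (fun w => (\1_(inlab q n) w * phi (repx q n w))%:E)
    (fun w => (\1_(inlab q n) w)%:E *
      \int[pi_ext pi0 pik (plev q w) (ppar q n w)]_y (phi y)%:E)%E.

(* given Fq q, the replicas are independent, the n-th one having law
   pi_(Z^(q)) (X^(n,q), .); the factor Kprod lets functions of that law be
   treated as if they were measurable with respect to Fq q *)
Definition cond_indep q := forall n phi psis, M1 phi -> allM1 psis ->
  eqm P (Fq filt a q `|` gRep q n)
    (fun w => (\1_(inlab q n) w * phi (repx q n w) *
               Kprod pik psis (lev a q w) (repx q n w))%:E)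
    (fun w => (\1_(inlab q n) w * Kr pik phi (lev a q w) (repx q n w) *
               Kprod pik psis (lev a q w) (repx q n w))%:E).

End gams_measurability.

Section fresh_replicas.
Context d (Om : measurableType d) (R : realType) (T : ptopologicalType).
Context dU (U : measurableType dU).
Variables (P : probability Om R) (pi0 : probability (borel T) R).
Variables (filt : R -> set (set T)).
Variable pik : R.-pker (measurableTypeR R * borel T)%type ~> borel T.
Variable a : gams Om R T U.
Hypotheses (polT : polish R T) (filtF : level_filtration filt).
Hypotheses (A1 : assumption1 pi0 pik) (A2 : assumption2 filt pi0 pik).
Hypotheses (a3 : assumption3 P filt a) (gf : gams_framework P pi0 filt pik a).

Lemma measurable_inlab q n : measurable (inlab a q n).
Proof.
apply: (gen_measurable (G := gLab a q)) => [_ [J ->]|]; first exact: (measurable_lab gf).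
by apply: inlab_gen; exact: sub_sigma_algebra.
Qed.

Lemma measurable_repxT q n : measurable_fun setT (repx a q n).
Proof.
have [m h] : exists m : nat, m <> n by exists n.+1 => /eqP; rewrite gtn_eqF.
apply: (@gmeas_measurable _ _ (gLab a q `|` gAll a q)).
  by move=> _ [[J ->]|[k [B [mB ->]]]]; [exact: (measurable_lab gf)|exact: (measurable_repset gf)].
apply: measurable_repx; first by apply: inlab_gen => A LA; apply: sub_sigma_algebra; left.
by move=> B mB; apply: sub_sigma_algebra; right; exists n, B.
Qed.

Lemma measurable_levT q : measurable_fun setT (lev a q).
Proof.
apply: (gmeas_measurable (G := Fq filt a q)); first exact: Fq_measurable.
exact: (lev_Fq filtF a3 gf).
Qed.

Lemma fresh_cond_indep q : fresh P pi0 filt pik a q -> cond_indep P filt pik a q.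
Proof.
move=> fq n phi psis Mphi Mpsis.
have EN : <<s gEnv filt a q >> (inlab a q n).
  by apply: inlab_gen => A LA; apply: sub_sigma_algebra; right; left.
apply: (@strong_markov _ Om R P T filt pi0 pik polT filtF A1 A2 (gEnv filt a q)
  (gRep a q n) (inlab a q n) (repx a q n) (Flev filt a q) (lev a q)
  (plev a q) (ppar a q n)) => //.
- exact: (gEnv_measurable a3 gf).
- exact: (gRep_measurable gf).
- exact: measurable_repxT.
- exact: measurable_levT.
- case: q {fq EN} => [|q] z /=.
    rewrite (_ : mkset _ = setT); first exact: gen_setT.
    by apply/seteqP; split => // w _; exact: leNye.
  have sub : Fq filt a q `<=` <<s gEnv filt a q.+1 >>.
    by move=> A FA; apply: sub_sigma_algebra; left; left.
  have := gmeas_sub sub (@lev_Fq _ _ _ _ _ _ _ _ _ _ _ filtF a3 gf q).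
  move=> /(_ measurableT _ (measurable_itv `]-oo, z])); rewrite setTI.
  rewrite (_ : _ @^-1` _ = [set w | ((lev a q w)%:E <= z%:E)%E]) => [//|].
  by apply/seteqP; split => w /=; rewrite in_itv/= lee_fin.
- move=> z A /(Flev_gen); apply: smallest_sub; first exact: smallest_sigma_algebra.
  move=> B [EB|[m [C [fC ->]]]]; first by apply: sub_sigma_algebra; left; left.
  have [_ fm _] := filtF.
  have [->|/eqP mn] := eqVneq m n; last first.
    by apply: sub_sigma_algebra; left; right; exists m, C; split => //; exact: fm fC.
  rewrite (_ : repset a q n C = inlab a q n `&` repx a q n @^-1` C).
    apply: gen_setI; first by apply: sub_sigma_algebra2 EN => D ED; left; left.
    by apply: sub_sigma_algebra; right; exists C => //; rewrite setTI.
  by apply/seteqP; split => w /= [nI]; rewrite /repx nI.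
- by move=> z; exact: (lev_set a3).
- case: q {fq EN} => [|q] /=; first by apply: nearW => w; exact: leNye.
  by apply: filterS (a3_lev_le a3 q) => w; rewrite lee_fin.
- exact: fq.
Qed.

Lemma gWgt0_gen : gWgt a 0 `<=` <<s gLab a 0 >>.
Proof.
move=> _ [n [D [mD ->]]].
rewrite (_ : wgtset a 0 n D = \bigcup_(J : {fset nat}) ([set w | lab a 0 w = J] `&`
   [set _ | n \in J /\ D (#|` J|%:R)^-1])).
  apply: countable_bigcup_gen => J; apply: gen_setI; last exact: gen_cst.
  by apply: sub_sigma_algebra; exists J.
apply/seteqP; split => w /=.
  move=> [nI Dw]; exists (lab a 0 w) => //; split => //=.
  by rewrite -(wgt_init gf nI).
move=> [J _ [/= IJ [nJ DJ]]]; rewrite /wgtset /=.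
have nI : n \in lab a 0 w by rewrite IJ.
by split => //; rewrite (wgt_init gf nI) IJ.
Qed.

Lemma measurable_bigcap_repx q (s : set nat) (Bs : nat -> set (borel T)) (G : set (set Om)) :
  (forall m, s m -> gmeas G (repx a q m)) -> (forall m, measurable (Bs m)) ->
  <<s G >> [set w | forall m, s m -> Bs m (repx a q m w)].
Proof.
move=> mX mB; rewrite (_ : mkset _ = \bigcap_(m in s) (repx a q m @^-1` Bs m)).
  apply: (@bigcap_measurableType _ (g_sigma_algebraType G)) => m sm.
  by have := mX m sm measurableT _ (mB m); rewrite setTI.
by apply/seteqP; split.
Qed.

Lemma fresh0 : fresh P pi0 filt pik a 0.
Proof.
move=> n phi Mphi /=.
pose c := fine (\int[pi0]_y (phi y)%:E)%E.
have nphi := M1_nnmeas Mphi.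
have cE : (\int[pi0]_y (phi y)%:E = c%:E)%E.
  rewrite fineK// ge0_fin_numE; last by apply: integral_ge0 => y _; exact: nphi.2.
  by apply: le_lt_trans (ltry 1); apply: integral_M1_le1 => //; exact: probability_setT.
have c0 : 0 <= c by rewrite -lee_fin -cE integral_ge0// => y _; exact: nphi.2.
rewrite cE; pose G := gLab a 0 `|` gRep a 0 n.
have Gm : G `<=` measurable.
  by move=> A [[J ->]|/(gRep_measurable gf)//]; exact: (measurable_lab gf).
apply: (@eqm_sub _ _ _ _ _ G).
  move=> A [[//|[LA|/gWgt0_gen]]|RA].
  - by apply: sub_sigma_algebra; left.
  - by apply: sub_sigma_algebra2 => B LB; left.
  - by apply: sub_sigma_algebra; right.
have mN := measurable_inlab 0 n; have mX := measurable_repxT 0 n.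
have nf : nnR (fun w => \1_(inlab a 0 n) w * phi (repx a 0 n w)).
  split=> [|w]; last by rewrite mulr_ge0//; have /andP[] := Mphi.2 (repx a 0 n w).
  by apply: measurable_funM; [exact: measurable_indic|exact: (measurableT_comp Mphi.1)].
have ng : nnR (fun w => \1_(inlab a 0 n) w * c).
  split=> [|w]; last by rewrite mulr_ge0.
  by apply: measurable_funM; [exact: measurable_indic|exact: measurable_cst].
apply: (@eqm_partition _ _ _ P G _ (lab a 0)) => //.
- exact: (nnR_nnmeas nf).
- exact: (nnR_nnmeas ng).
- by move=> J; exact: (measurable_lab gf).
move=> J; have mJ := measurable_lab gf 0 J.
have zero : (forall w, (\1_(lab a 0 @^-1` [set J]) w : R) * \1_(inlab a 0 n) w = 0) ->
   eqm P G (fun w => (\1_(lab a 0 @^-1` [set J]) w)%:E *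
      (\1_(inlab a 0 n) w * phi (repx a 0 n w))%:E)%E
    (fun w => (\1_(lab a 0 @^-1` [set J]) w)%:E * ((\1_(inlab a 0 n) w)%:E * c%:E))%E.
  move=> z W nW; apply: eq_integral => w _; congr (_ * _)%E.
  by rewrite -!EFinM !mulrA z !mul0r.
have [[w0 Jw0]|nJ] := pselect (exists w, lab a 0 w = J); last first.
  apply: zero => w; rewrite indicE memNset ?mul0r// => /= wJ.
  by apply: nJ; exists w.
have [nJ|nJ] := boolP (n \in J); last first.
  apply: zero => w; rewrite !indicE.
  case: (boolP (w \in _)) => [/set_mem/= wJ|_]; last by rewrite mul0r.
  rewrite (_ : (w \in inlab a 0 n) = false) ?mulr0//; apply: memNset.
  by rewrite /inlab /= wJ; exact/negP.
have [k k0 labk] := lab_init gf w0; rewrite Jw0 in labk.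
have nk : n \in iota 1 k by move: nJ; rewrite labk !inE.
pose f w := (\1_(lab a 0 @^-1` [set J]) w : R) *
  (\1_(inlab a 0 n) w * phi (repx a 0 n w)).
pose g w := (\1_(lab a 0 @^-1` [set J]) w : R) * (\1_(inlab a 0 n) w * c).
have indM (A : set Om) (u : Om -> R) : measurable A -> nnR u -> nnR (fun w => \1_A w * u w).
  move=> mA [mu u0]; split=> [|w]; last by rewrite mulr_ge0.
  by apply: measurable_funM => //; exact: measurable_indic.
have gX m : m <> n -> gmeas G (repx a 0 m).
  move=> mn; apply: measurable_repx.
    by apply: inlab_gen => A LA; apply: sub_sigma_algebra; left.
  by move=> B mB; apply: sub_sigma_algebra; right; exists m, B.
apply: (@eqm_pi _ _ _ P G [set A | exists (L : set {fset nat}) (Bs : nat -> set (borel T)),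
  (forall m, measurable (Bs m)) /\
  A = [set w | L (lab a 0 w)] `&` [set w | forall m, m <> n -> Bs m (repx a 0 m w)]]
  f g) => //.
- exact: indM.
- exact: indM.
- apply/seteqP; split; apply: smallest_sub; try exact: smallest_sigma_algebra.
    move=> _ [L [Bs [mBs ->]]]; apply: gen_setI; last first.
      by apply: (@measurable_bigcap_repx 0 [set m | m <> n]) => // m; exact: gX.
    rewrite (_ : mkset _ = \bigcup_(J' : {fset nat}) ([set w | lab a 0 w = J'] `&`
        [set _ | L J'])).
      apply: countable_bigcup_gen => J'; apply: gen_setI; last exact: gen_cst.
      by apply: sub_sigma_algebra; left; exists J'.
    apply/seteqP; split => w /=; first by move=> Lw; exists (lab a 0 w).
    by move=> [J' _ [/= <-]].
  move=> _ [[J' ->]|[m [B [mn mB ->]]]]; apply: sub_sigma_algebra.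
    exists [set J'], (fun=> setT); split => [//|].
    by apply/seteqP; split => w /= => [->|[]].
  exists [set J' : {fset nat} | m \in J'], (fun i => if i == m then B else setT); split.
    by move=> i; case: ifP.
  apply/seteqP; split => w /=.
    move=> [mI Bw]; split => // i _; case: eqP => // ->.
    by rewrite /repx mI.
  by move=> [mI /(_ m mn)]; rewrite eqxx /repx mI.
- move=> _ _ [L [Bs [mBs ->]]] [L' [Bs' [mBs' ->]]].
  exists (L `&` L'), (fun m => Bs m `&` Bs' m); split.
    by move=> m; exact: measurableI.
  apply/seteqP; split => w /=.
    by move=> [[h1 h2] [h3 h4]]; split => // m mn; split; [exact: h2|exact: h4].
  by move=> [[h1 h3] h]; split; split => // m /h[].
- by exists setT, (fun=> setT); split => //; apply/seteqP; split.
- apply: integral_le1_lty; first exact: indM.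
  have i1 (A : set Om) w : (\1_A w : R) <= 1 by rewrite indicE lern1 leq_b1.
  by move=> w; have /andP[h1 h2] := Mphi.2 (repx a 0 n w); rewrite /f !mulr_ile1 ?mulr_ge0.
move=> _ [L [Bs [mBs ->]]].
set A := (X in \1_X).
pose AB (B : set (borel T)) m := if m == n then B else Bs m.
have mAB B : measurable B -> forall m, measurable (AB B m).
  by move=> mB m; rewrite /AB; case: ifP.
pose SB B := [set w | lab a 0 w = [fset m in iota 1 k]%fset] `&`
  [set w | forall m, m \in iota 1 k -> AB B m (rep a 0 m w)].
have SBE B : SB B = lab a 0 @^-1` [set J] `&` [set w | forall m,
    m \in iota 1 k -> AB B m (repx a 0 m w)].
  rewrite /SB -labk; apply/seteqP; split => w /= [wJ h]; split => // m mk.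
    by rewrite /repx wJ labk inE/= mk; exact: h.
  by have := h m mk; rewrite /repx wJ labk inE/= mk.
have mSB B : measurable B -> measurable (SB B).
  move=> mB; rewrite SBE; apply: measurableI => //.
  apply: (gen_measurable (G := measurable)) => //.
  apply: (@measurable_bigcap_repx 0 [set m | m \in iota 1 k]) => [m _|]; last exact: mAB.
  apply: (measurability _ (esym (sigma_algebra_id (@sigma_algebra_measurable _ (borel T))))) => _ [B' mB' <-].
  by apply: sub_sigma_algebra; exact: (measurable_repxT).
pose pr := \prod_(m <- iota 1 k | m != n) fine (pi0 (Bs m)).
have PSB B : measurable B -> P (SB B) = (P (SB setT) * pi0 B)%E.
  move=> mB.
  have E B' : measurable B' ->
      P (SB B') = (P [set w | lab a 0 w = [fset m in iota 1 k]%fset] * (pr * fine (pi0 B'))%:E)%E.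
    move=> mB'; rewrite [LHS](rep_init gf _ (mAB B' mB')); congr (_ * _%:E)%E.
    rewrite (bigD1_seq n) ?iota_uniq//= mulrC; congr (_ * _); last by rewrite /AB eqxx.
    by apply: eq_bigr => m mn; rewrite /AB (negbTE mn).
  rewrite (E B mB) (E setT)//.
  rewrite -muleA; congr (_ * _)%E.
  have -> : fine (pi0 [set: borel T]) = 1 by rewrite (_ : pi0 _ = 1%E)//; exact: probability_setT.
  by rewrite mulr1 EFinM fineK// fin_num_measure.
have key : (\int[P]_w ((\1_(SB setT) w)%:E * (phi (repx a 0 n w))%:E) =
    \int[P]_w ((\1_(SB setT) w)%:E * c%:E))%E.
  pose L1 (h : borel T -> \bar R) := (\int[P]_w ((\1_(SB setT) w)%:E * h (repx a 0 n w)))%E.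
  pose L2 (h : borel T -> \bar R) := (\int[P]_w ((\1_(SB setT) w)%:E * \int[pi0]_y h y))%E.
  have m1 : measurable_fun setT (\1_(SB setT) : Om -> R).
    by apply: measurable_indic; exact: mSB.
  have i1 : is_int L1.
    apply: (@int_comp _ (borel T) R _ Om P (\1_(SB setT)) (fun w h => h (repx a 0 n w))) => //.
      by move=> w; exact: int_dirac.
    by move=> h [mh _]; exact: (measurableT_comp mh).
  have i2 : is_int L2.
    apply: (@int_comp _ (borel T) R _ Om P (\1_(SB setT)) (fun w h => \int[pi0]_y h y)%E) => //.
      by move=> w; exact: int_integral.
  have := @int_unique_sets _ (borel T) R L1 L2 i1 i2 _ _ nphi.
  rewrite /L1 /L2 /= cE; apply => B mB.
  rewrite integral_indic// setIT ge0_integralZr//; last exact/measurable_EFinP.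
  rewrite integral_indic ?setIT//; last exact: mSB.
  transitivity (P (SB B)); last exact: PSB.
  transitivity (\int[P]_w (\1_(SB B) w)%:E)%E; last first.
    by rewrite integral_indic ?setIT//; exact: mSB.
  apply: eq_integral => w _; rewrite -EFinM; congr EFin.
  have -> : SB B = SB setT `&` repx a 0 n @^-1` B.
    rewrite !SBE; apply/seteqP; split => w' /=.
      move=> [wJ h]; split; first split => // m /h; last by have := h n nk; rewrite /AB eqxx.
      by rewrite /AB; case: eqP.
    move=> [[wJ h] Bn]; split => // m /h; rewrite /AB; case: eqP => // -> _; exact: Bn.
  by rewrite indicI.
have mulI (B C D : set Om) w : (\1_B w : R) * (\1_C w * \1_D w) = \1_(B `&` (C `&` D)) w.
  by rewrite !indicI.
have f_E (u : Om -> R) w : \1_A w * (\1_(lab a 0 @^-1` [set J]) w * (\1_(inlab a 0 n) w * u w)) =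
    \1_(A `&` (lab a 0 @^-1` [set J] `&` inlab a 0 n)) w * u w.
  by rewrite -mulI !mulrA.
have [HC|nHC] := pselect (L J /\ forall m, m \notin J -> m <> n -> Bs m point).
  have AE : A `&` (lab a 0 @^-1` [set J] `&` inlab a 0 n) = SB setT.
    have [LJ BJ] := HC; rewrite SBE; apply/seteqP; split => w /=.
      move=> [[Lw h] [wJ nI]]; split => // m mk; rewrite /AB.
      by case: eqP => // mn; exact: h.
    move=> [wJ h]; split; last by split => //; rewrite /inlab /= wJ.
    split; first by rewrite /= wJ.
    move=> m mn; have [iJ|iJ] := boolP (m \in J).
      by have := h m; rewrite /AB; case: eqP => // _; apply; move: iJ; rewrite labk inE.
    by rewrite /repx wJ (negbTE iJ); exact: BJ.
  under eq_integral do rewrite -EFinM /f (f_E (fun w => phi (repx a 0 n w))) AE EFinM.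
  under [RHS]eq_integral do rewrite -EFinM /g (f_E (fun=> c)) AE EFinM.
  exact: key.
have AE : A `&` (lab a 0 @^-1` [set J] `&` inlab a 0 n) = set0.
  apply/seteqP; split => // w /= [[Lw h] [wJ nI]]; apply: nHC.
  split; first by rewrite -wJ.
  by move=> m iJ mn; have := h m mn; rewrite /repx wJ (negbTE iJ).
apply: eq_integral => w _.
by rewrite -!EFinM /f /g (f_E (fun w => phi (repx a 0 n w))) (f_E (fun=> c)) AE indic0 !mul0r.
Qed.

End fresh_replicas.

(** * Resampling and splitting *)

Section resampling.
Context d (Om : measurableType d) (R : realType) (T : ptopologicalType).
Context dU (U : measurableType dU).
Variables (P : probability Om R) (pi0 : probability (borel T) R).
Variables (filt : R -> set (set T)).
Variable pik : R.-pker (measurableTypeR R * borel T)%type ~> borel T.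
Variable a : gams Om R T U.
Hypotheses (filtF : level_filtration filt).
Hypotheses (a3 : assumption3 P filt a) (gf : gams_framework P pi0 filt pik a).
Variable q : nat.

Definition gKnown := Fq filt a q `|` gAll a q.
Definition gSplit := gKnown `|` sigma_of_discrete (par_sys a q).

Lemma gKnown_measurable : gKnown `<=` measurable.
Proof. by move=> A [/Fq_measurable//|[m [B [mB ->]]]]; exact: (measurable_repset gf). Qed.

Lemma gSplit_measurable : gSplit `<=` measurable.
Proof.
move=> A [/gKnown_measurable//|pA].
by have [_ h _ _] := a3_split a3 q; apply: h; right.
Qed.

Lemma gKnown_hist : <<s gKnown >> `<=` hist a q.
Proof.
rewrite -hist_sigma; apply: sub_sigma_algebra2 => A [/(Fq_hist filtF)//|[m [B [mB ->]]]].
by apply: wsys_hist; exact: sigma_wsys_rep.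
Qed.

Lemma gSplit_hist : <<s gSplit >> `<=` hist_split a q.
Proof.
apply: smallest_sub; first exact: smallest_sigma_algebra.
move=> A [kA|pA]; apply: sub_sigma_algebra; last by right.
by left; left; left; apply: gKnown_hist; exact: sub_sigma_algebra.
Qed.

Fixpoint gUres (s : seq nat) : set (set Om) :=
  if s is m :: s' then gUres s' `|` sigma_of (ures a q m) else gSplit.

Let mU m : measurable_fun setT (ures a q m).
Proof. by have [h _ _] := rep_new gf q; exact: h. Qed.

Lemma sigma_of_sigma d' (V : measurableType d') (v : Om -> V) A :
  <<s sigma_of v >> A -> exists2 D, measurable D & A = v @^-1` D.
Proof.
rewrite sigma_algebra_id; last first.
  by apply: sigma_algebra_preimage; exact: sigma_algebra_measurable.
by move=> [D mD <-]; exists D; rewrite ?setTI.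
Qed.

Lemma gUres_measurable s : gUres s `<=` measurable.
Proof.
elim: s => [|m s ih]; first exact: gSplit_measurable.
by move=> A [/ih//|[D mD <-]]; apply: mU.
Qed.

Lemma gSplit_gUres s : gSplit `<=` <<s gUres s >>.
Proof.
elim: s => [|m s ih]; first exact: sub_sigma_algebra.
by move=> A /ih; apply: sub_sigma_algebra2 => B sB; left.
Qed.

Let bigI (t : seq nat) (D : nat -> set U) := [set w : Om | forall m, m \in t -> D m (ures a q m w)].

Let bigI_cons m t D : bigI (m :: t) D = ures a q m @^-1` D m `&` bigI t D.
Proof.
apply/seteqP; split => w /=.
  by move=> h; split => [|i it]; apply: h; rewrite inE ?eqxx// it orbT.
by move=> [h1 h2] i; rewrite inE => /orP[/eqP->//|]; exact: h2.
Qed.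

Let measurable_bigI t D : (forall m, measurable (D m)) -> measurable (bigI t D).
Proof.
move=> mD; elim: t => [|m t ih].
  by rewrite (_ : bigI _ _ = setT)//; apply/seteqP; split.
rewrite bigI_cons; apply: measurableI => //.
by rewrite -[X in measurable X]setTI; exact: mU.
Qed.

Let indep_gUres s : forall t (A : set Om) (D : nat -> set U), uniq (s ++ t) ->
  <<s gUres s >> A -> (forall m, measurable (D m)) ->
  P (A `&` bigI t D) = (P A * (\prod_(m <- t) fine (P (ures a q m @^-1` D m)))%:E)%E.
Proof.
elim: s => [|m s ih] t A D /= su sA mD.
  have [_ mi _] := rep_new gf q.
  pose B (k : option nat) := if k is Some m then ures a q m @^-1` D m else A.
  pose J := [fset k in None :: map Some t]%fset.
  have := mi J B.
  rewrite (_ : \bigcap_(k in [set` J]) B k = A `&` bigI t D); last first.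
    apply/seteqP; split => w /=.
      move=> h; split; first by apply: (h None); rewrite /= !inE.
      move=> m mt; apply: (h (Some m)); rewrite /= !inE/=.
      by apply/mapP; exists m.
    move=> [Aw h] [m|]//=; rewrite !inE/= => /mapP[i it [->]]; exact: h.
  move=> ->; last first.
    move=> [m|] _ /=; last by apply: gSplit_hist.
    by exists (D m) => //; rewrite setTI.
  rewrite (perm_big (None :: map Some t)); last first.
    apply: uniq_perm; first exact: fset_uniq.
      rewrite /= map_inj_uniq ?su ?andbT; [|by move=> x y []].
      by apply/negP => /mapP[].
    by move=> k; rewrite !inE.
  by rewrite /= big_cons big_map EFinM fineK// fin_num_measure//; exact: gen_measurable gSplit_measurable _ sA.
have mt : m \notin t by move: su; rewrite mem_cat negb_or => /andP[/andP[]].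
have su' : uniq (s ++ m :: t).
  by rewrite (perm_uniq (_ : perm_eq _ (m :: s ++ t))) ?su// -cat1s perm_catCA.
have st : uniq (s ++ t) by move: su => /andP[].
have mB := measurable_bigI t mD.
have PB : P (bigI t D) = (\prod_(m <- t) fine (P (ures a q m @^-1` D m)))%:E.
  rewrite -[bigI t D]setTI (ih t setT D st _ mD); last exact: gen_setT.
  by rewrite [X in (X * _)%E](_ : _ = 1%E) ?mul1e//; exact: probability_setT.
rewrite -PB; move: A sA; apply: indep_join => //.
- exact: gUres_measurable.
- by move=> A [C mC <-]; apply: mU.
move=> A1 A2 sA1 /sigma_of_sigma[C mC ->].
pose D' k := if k == m then C else D k.
have mD' k : measurable (D' k) by rewrite /D'; case: ifP.
have D't : bigI t D' = bigI t D.
  apply/seteqP; split => w /= h i it; have := h i it; rewrite /D';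
    by case: eqP it mt => // -> ->.
have D'p : \prod_(i <- t) fine (P (ures a q i @^-1` D' i)) =
    \prod_(i <- t) fine (P (ures a q i @^-1` D i)).
  by apply: eq_big_seq => i it; rewrite /D'; case: eqP it mt => // -> ->.
have sm : uniq (s ++ [:: m]).
  by move: su'; rewrite -cat1s catA cat_uniq => /andP[].
have := ih [:: m] A1 D' sm sA1 mD'.
have := ih (m :: t) A1 D' su' sA1 mD'.
rewrite !bigI_cons D't big_cons big_seq1 D'p PB (_ : bigI [::] D' = setT); last first.
  by apply/seteqP; split.
rewrite setIT setIA /D' eqxx => -> ->.
by rewrite -muleA -EFinM.
Qed.

Lemma indep_ures m s A D : m \notin s -> uniq s -> <<s gUres s >> A -> measurable D ->
  P (A `&` ures a q m @^-1` D) = (P A * P (ures a q m @^-1` D))%E.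
Proof.
move=> ms us sA mD.
have u : uniq (s ++ [:: m]) by rewrite cats1 rcons_uniq ms.
have := indep_gUres u sA (fun=> mD).
rewrite bigI_cons big_seq1 (_ : bigI [::] _ = setT); last by apply/seteqP; split.
rewrite setIT => ->; rewrite fineK// fin_num_measure//.
by rewrite -[X in measurable X]setTI; exact: mU.
Qed.

Variables (Ev : set Om) (pp : nat -> nat).
Hypothesis sEv : <<s gSplit >> Ev.

Let gSplit_rep m : gmeas gSplit (repx a q m).
Proof.
apply: measurable_repx.
  by apply: inlab_gen => A /(gLab_Fq filtF a3 gf) FA; apply: sub_sigma_algebra; left; left.
by move=> B mB; apply: sub_sigma_algebra; left; right; exists m, B.
Qed.

Let gSplit_lev : gmeas gSplit (lev a q).
Proof.
apply: (@gmeas_sub _ _ (Fq filt a q)) => [A FA|]; last exact: (lev_Fq filtF a3 gf).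
by apply: sub_sigma_algebra; left; left.
Qed.

Lemma resample_laws (s : seq nat) (g : nat -> T -> R) (W : Om -> \bar R) :
  uniq s -> (forall m, M1 (g m)) ->
  (forall w m, Ev w -> m \in s ->
     [/\ m \in newlab a q w, par a q m w = pp m & pp m \in lab a q w]) ->
  nnmeas (W : g_sigma_algebraType gSplit -> \bar R) ->
  (\int[P]_w (W w * (\1_Ev w * \prod_(m <- s) g m (repx a q.+1 m w))%:E) =
   \int[P]_w (W w * (\1_Ev w * \prod_(m <- s) Kr pik (g m) (lev a q w) (repx a q (pp m) w))%:E))%E.
Proof.
move=> us Mg sEvP nW.
have [_ _ hf] := rep_new gf q; have [f fP] := choice hf.
pose v m w : measurableTypeR R * borel T := (lev a q w, repx a q (pp m) w).
pose xf m w : borel T := f m (v m w, ures a q m w).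
have mf m : measurable_fun setT (f m) by have [] := fP m.
have gv m : gmeas gSplit (v m).
  exact: (@measurable_fun_pair _ _ _ (g_sigma_algebraType gSplit)
    (measurableTypeR R) (borel T) _ _ gSplit_lev (@gSplit_rep (pp m))).
have gxf s' m : m \in s' -> gmeas (gUres s') (xf m).
  move=> ms; apply: (measurableT_comp (mf m)).
  apply: (@measurable_fun_pair _ _ _ (g_sigma_algebraType (gUres s'))
    (measurableTypeR R * borel T)%type U).
    exact: gmeas_sub (@gSplit_gUres s') (gv m).
  move=> _ D mD; rewrite setTI; elim: s' ms => // i s' ih.
  rewrite inE => /orP[/eqP mi|ms].
    by apply: sub_sigma_algebra; right; exists D => //; rewrite mi setTI.
  by apply: sub_sigma_algebra2 (ih ms) => B sB; left.
have mEv : measurable Ev by exact: gen_measurable gSplit_measurable _ sEv.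
have mW w : 0 <= (\1_Ev w : R) by [].
have K01 i w : 0 <= Kr pik (g i) (lev a q w) (repx a q (pp i) w).
  by have /andP[] := Kr01 pik (lev a q w) (repx a q (pp i) w) (Mg i).
have g01 i y : 0 <= g i y by have /andP[] := (Mg i).2 y.
have nWT V : nnmeas (V : g_sigma_algebraType gSplit -> \bar R) -> nnmeas (V : Om -> \bar R).
  by move=> [mV V0]; split => //; exact: gmeas_measurable gSplit_measurable mV.
have step s' : uniq s' -> (forall w m, Ev w -> m \in s' ->
     [/\ m \in newlab a q w, par a q m w = pp m & pp m \in lab a q w]) ->
  forall V : Om -> \bar R, nnmeas (V : g_sigma_algebraType gSplit -> \bar R) ->
  (\int[P]_w (V w * (\1_Ev w * \prod_(m <- s') g m (xf m w))%:E) =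
   \int[P]_w (V w * (\1_Ev w * \prod_(m <- s') Kr pik (g m) (lev a q w) (repx a q (pp m) w))%:E))%E.
  elim: s' => [_ _ V _|m s' ih /= /andP[ms us'] sP V nV].
    by apply: eq_integral => w _; rewrite !big_nil.
  have sP' w i : Ev w -> i \in s' ->
     [/\ i \in newlab a q w, par a q i w = pp i & pp i \in lab a q w].
    by move=> Ew is'; apply: sP => //; rewrite inE is' orbT.
  pose W1 w := (V w * (\1_Ev w * \prod_(i <- s') g i (xf i w))%:E)%E.
  have nprod : nnmeas ((fun w => (\1_Ev w * \prod_(i <- s') g i (xf i w))%:E) :
      g_sigma_algebraType (gUres s') -> \bar R).
    apply: nnmeas_EFin => [|w]; last by rewrite mulr_ge0// prodr_ge0.
    apply: measurable_funM.
      apply: measurable_indic; move: sEv; apply: smallest_sub; first exact: smallest_sigma_algebra.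
      exact: gSplit_gUres.
    apply: measurable_prod => i is'; apply: (measurableT_comp (Mg i).1); exact: gxf.
  have nW1 : nnmeas (W1 : g_sigma_algebraType (gUres s') -> \bar R).
    apply: nnmeasM => //; case: nV => mV V0; split => //.
    exact: gmeas_sub (@gSplit_gUres s') mV.
  pose k (x : (measurableTypeR R * borel T) * U) := (g m (f m x))%:E.
  have nk : nnmeas k.
    apply: (@nnmeas_EFin _ _ R (g m \o f m)) => [|x]; last exact: g01.
    by apply: (measurableT_comp (Mg m).1); exact: mf.
  have gvs : gmeas (gUres s') (v m) := gmeas_sub (@gSplit_gUres s') (gv m).
  have fr := @freeze _ Om R P (gUres s') (@gUres_measurable s') _ U (ures a q m) (mU m)
    (fun A D => @indep_ures m s' A D ms us') _ _ (v m) k gvs nk W1 nW1.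
  have nin := @freeze_gmeas _ Om R P (gUres s') _ U (ures a q m) (mU m) _ _ (v m) k gvs nk.
  transitivity (\int[P]_w (W1 w * k (v m w, ures a q m w)))%E.
    apply: eq_integral => w _; rewrite big_cons /W1 /k -muleA -EFinM; congr (_ * _%:E)%E.
    by rewrite /xf mulrCA -mulrA mulrC -!mulrA; congr (_ * _); rewrite mulrC.
  rewrite fr.
  transitivity (\int[P]_w (W1 w * (Kr pik (g m) (lev a q w) (repx a q (pp m) w))%:E))%E.
    have nW1T : nnmeas W1.
      by case: nW1 => mW1 ?; split => //; exact: gmeas_measurable (@gUres_measurable s') mW1.
    have ninT : nnmeas (fun w => \int[P]_w' k (v m w, ures a q m w'))%E.
      by case: nin => mn ?; split => //; exact: gmeas_measurable (@gUres_measurable s') mn.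
    have nKT : nnmeas (fun w => (Kr pik (g m) (lev a q w) (repx a q (pp m) w))%:E).
      apply: nnmeas_EFin => //; apply: measurable_Kr => //.
        exact: (measurable_levT filtF a3 gf).
      exact: (measurable_repxT gf).
    apply: ge0_ae_eq_integral => //.
    - exact: (nnmeasM nW1T ninT).1.
    - exact: (nnmeasM nW1T nKT).1.
    - by move=> w _; exact: (nnmeasM nW1T ninT).2.
    - by move=> w _; exact: (nnmeasM nW1T nKT).2.
    have [_ laws _] := fP m; apply: filterS laws => w lawm _.
    have [Ew|nEw] := pselect (Ev w); last first.
      by rewrite /W1 [\1_Ev w]indicE memNset// mul0r mule0 !mul0e.
    have [mn pm lm] := sP w m Ew (mem_head _ _).
    congr (_ * _)%E; rewrite KrE//.
    have vE : (lev a q w, rep a q (par a q m w) w) = v m w by rewrite /v /repx pm lm.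
    have {}lawm := lawm mn; rewrite vE in lawm.
    have mfu : measurable_fun setT (fun w' => f m (v m w, ures a q m w')).
      apply: (measurableT_comp (mf m)).
      exact: (@measurable_fun_pair _ _ _ Om (measurableTypeR R * borel T)%type U).
    pose L1 (h : borel T -> \bar R) := (\int[P]_w' (1%:E * h (f m (v m w, ures a q m w'))))%E.
    have i1 : is_int L1.
      apply: (@int_comp _ (borel T) R _ Om P (cst 1%R) (fun w' h => h (f m (v m w, ures a q m w')))) => //.
        by move=> w'; exact: int_dirac.
      by move=> h [mh _]; exact: (measurableT_comp mh).
    have := int_unique_sets i1 (int_integral (pik (v m w))) _ (M1_nnmeas (Mg m)).
    rewrite /L1 /=; under eq_integral do rewrite mul1e.
    apply => B mB; under eq_integral do rewrite mul1e.
    rewrite [RHS]integral_indic// setIT -lawm//.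
    transitivity (\int[P]_w' (\1_((fun w' => f m (v m w, ures a q m w')) @^-1` B) w')%:E)%E.
      by apply: eq_integral.
    rewrite integral_indic// ?setIT//.
    by rewrite -[X in measurable X]setTI; exact: mfu.
  transitivity (\int[P]_w ((V w * (Kr pik (g m) (lev a q w) (repx a q (pp m) w))%:E) *
      (\1_Ev w * \prod_(i <- s') g i (xf i w))%:E))%E.
    by apply: eq_integral => w _; rewrite /W1 muleAC.
  rewrite (ih us' sP'); last first.
    apply: nnmeasM => //; apply: nnmeas_EFin => //.
    exact: (@measurable_Kr _ _ pik _ (g_sigma_algebraType gSplit) _ _ _
      gSplit_lev (@gSplit_rep (pp m)) (Mg m)).
  apply: eq_integral => w _; rewrite big_cons -muleA -EFinM; congr (_ * _%:E)%E.
  by rewrite mulrCA.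
rewrite -(step s us sEvP W nW).
have mrx m : measurable_fun setT (fun w => g m (repx a q.+1 m w)).
  by apply: (measurableT_comp (Mg m).1); exact: (measurable_repxT gf).
have mxf m : measurable_fun setT (fun w => g m (xf m w)).
  apply: (measurableT_comp (Mg m).1).
  by apply: gmeas_measurable (@gxf [:: m] m (mem_head _ _)); exact: gUres_measurable.
have nprod (h : nat -> Om -> R) : (forall m, measurable_fun setT (h m)) ->
    (forall m w, 0 <= h m w) ->
    nnmeas (fun w => W w * (\1_Ev w * \prod_(m <- s) h m w)%:E)%E.
  move=> mh h0; apply: nnmeasM; first exact: nWT.
  apply: nnmeas_EFin => [|w]; last by rewrite mulr_ge0// prodr_ge0.
  by apply: measurable_funM; [exact: measurable_indic|exact: measurable_prod].
have n1 := nprod _ mrx (fun m w => g01 m _).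
have n2 := nprod _ mxf (fun m w => g01 m _).
apply: ge0_ae_eq_integral => //.
- exact: n1.1.
- exact: n2.1.
- by move=> w _; exact: n1.2.
- by move=> w _; exact: n2.2.
have ae : {ae P, forall w m, m \in newlab a q w ->
    rep a q.+1 m w = f m ((lev a q w, rep a q (par a q m w) w), ures a q m w)}.
  by apply: ae_foralln => m; have [_ _] := fP m.
apply: filterS ae => w aew _; congr (_ * _%:E)%E.
have [Ew|nEw] := pselect (Ev w); last by rewrite indicE memNset// !mul0r.
congr (_ * _); apply: eq_big_seq => m ms.
have [mn pm lm] := sEvP w m Ew ms.
have mI : m \in lab a q.+1 w by rewrite (lab_next gf) in_fsetU mn orbT.
by rewrite /xf /v /repx mI lm aew// pm.
Qed.

End resampling.

Section splitting.
Context d (Om : measurableType d) (R : realType) (T : ptopologicalType).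
Context dU (U : measurableType dU).
Variables (P : probability Om R) (pi0 : probability (borel T) R).
Variables (filt : R -> set (set T)).
Variable pik : R.-pker (measurableTypeR R * borel T)%type ~> borel T.
Variable a : gams Om R T U.
Hypotheses (filtF : level_filtration filt).
Hypotheses (a3 : assumption3 P filt a) (gf : gams_framework P pi0 filt pik a).
Variable q : nat.

Let gKm := gKnown_measurable gf (q := q).

Lemma indep_usplit A D : <<s gKnown filt a q >> A -> measurable D ->
  P (A `&` usplit a q @^-1` D) = (P A * P (usplit a q @^-1` D))%E.
Proof.
move=> sA mD; have [mu _ mi _] := a3_split a3 q.
pose B (b : bool) := if b then A else usplit a q @^-1` D.
have := mi [fset true; false]%fset B.
rewrite (_ : \bigcap_(k in _) B k = A `&` usplit a q @^-1` D); last first.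
  apply/seteqP; split => w /=.
    by move=> h; split; [apply: (h true)|apply: (h false)]; rewrite /= !inE.
  by move=> [h1 h2] [] _.
move=> ->; last first.
  move=> [] _ /=; first exact: (gKnown_hist filtF sA).
  by exists D => //; rewrite setTI.
rewrite (perm_big [:: true; false]); last first.
  by apply: uniq_perm => [||b]; [exact: fset_uniq| |rewrite !inE; case: b].
rewrite /= big_cons big_seq1 EFinM !fineK// fin_num_measure//; last first.
  exact: gen_measurable gKm _ sA.
by rewrite -[X in measurable X]setTI; exact: mu.
Qed.

Lemma split_freeze (h : sys nat * sys nat -> R) : (forall x, 0 <= h x) ->
  measurable_fun setT (fun w => h (brn_sys a q w, par_sys a q w)) ->
  exists kap : Om -> \bar R,
    nnmeas (kap : g_sigma_algebraType (Fq filt a q) -> \bar R) /\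
    eqm P (gKnown filt a q) (fun w => (h (brn_sys a q w, par_sys a q w))%:E) kap.
Proof.
move=> h0 mh; have [mu _ _ [d' [T' [V [f [FV mf fE]]]]]] := a3_split a3 q.
pose k (x : T' * U) := (h (f x))%:E.
have mhf : measurable_fun setT (h \o f).
  by move=> _ B mB; rewrite setTI; exact: (mf (h @^-1` B)).
have nk : nnmeas k by apply: (@nnmeas_EFin _ _ R (h \o f)) => // x; exact: h0.
have gV : gmeas (Fq filt a q) V.
  by move=> _ B mB; rewrite setTI; apply: sub_sigma_algebra; exact: FV.
have FK : Fq filt a q `<=` <<s gKnown filt a q >>.
  by move=> A FA; apply: sub_sigma_algebra; left.
exists (fun w => \int[P]_w' k (V w, usplit a q w'))%E; split.
  exact: (@freeze_gmeas _ Om R P (Fq filt a q) _ U (usplit a q) mu _ _ V k gV nk).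
have fr := @freeze _ Om R P (gKnown filt a q) gKm _ U (usplit a q) mu
  indep_usplit _ _ V k (gmeas_sub FK gV) nk.
apply: eqm_trans fr => W [mW W0].
have nW : nnmeas (W : Om -> \bar R) by split => //; exact: gmeas_measurable gKm mW.
have n1 : nnmeas (fun w => (h (brn_sys a q w, par_sys a q w))%:E).
  by apply: nnmeas_EFin.
have n2 : nnmeas (fun w => k (V w, usplit a q w)).
  split; last by move=> w; exact: nk.2.
  apply: (measurableT_comp nk.1); apply: measurable_fun_pair => //.
  apply: gmeas_measurable gV; exact: Fq_measurable.
apply: ge0_ae_eq_integral => //.
- exact: (nnmeasM nW n1).1.
- exact: (nnmeasM nW n2).1.
- by move=> w _; exact: (nnmeasM nW n1).2.
- by move=> w _; exact: (nnmeasM nW n2).2.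
- by apply: filterS fE => w fw _; rewrite /k -fw.
Qed.

Lemma survivors_lab w m : m \in survivors a q w -> m \in lab a q w.
Proof. by rewrite in_fsetD => /andP[]. Qed.

Lemma par_survivors w m : m \in lab a q.+1 w -> par a q m w \in survivors a q w.
Proof.
rewrite (lab_next gf) in_fsetU => /orP[mS|mN]; last exact: (par_new gf).
by rewrite (par_old gf).
Qed.

Lemma newlab_notin_lab w m : m \in newlab a q w -> m \notin lab a q w.
Proof.
rewrite in_fset/= mem_iota => /andP[mx _]; apply/negP => ml.
by move: mx; rewrite ltnNge => /negP; apply; apply: leq_bigmax_seq.
Qed.

Lemma survivors_par w m : m \in lab a q.+1 w ->
  (m \in survivors a q w) = (par a q m w == m).
Proof.
move=> ml; apply/idP/eqP => [mS|mp]; first exact: (par_old gf).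
by rewrite -mp; exact: par_survivors.
Qed.

Lemma newlab_par w m : m \in lab a q.+1 w ->
  (m \in newlab a q w) = (par a q m w != m).
Proof.
move=> ml; rewrite -survivors_par//; apply/idP/idP => [mN|mS].
  by apply: contra (newlab_notin_lab mN); exact: survivors_lab.
by move: ml; rewrite (lab_next gf) in_fsetU (negbTE mS).
Qed.

Lemma repx_survivor w m : m \in lab a q.+1 w -> par a q m w = m ->
  repx a q.+1 m w = repx a q m w.
Proof.
move=> ml mp; have mS : m \in survivors a q w by rewrite survivors_par// mp.
by rewrite /repx ml (survivors_lab mS); exact: (rep_old gf).
Qed.

(* sys nat is countable but is not a countType *)
Definition parcode (w : Om) : {fset nat} * seq nat :=
  (lab a q.+1 w, [seq par a q m w | m <- lab a q.+1 w]).

Let dec (s : sys nat) : {fset nat} * seq nat :=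
  (projT1 s, [seq (if insub m is Some j then projT2 s j else 0%N) | m <- projT1 s]).

Let parcodeE w : parcode w = dec (par_sys a q w).
Proof.
rewrite /parcode /dec /par_sys /restr /=; congr (_, _).
by apply/eq_in_map => m ml; rewrite (insubT (fun x => x \in lab a q.+1 w) ml).
Qed.

Lemma parcode_lab w w' : parcode w = parcode w' -> lab a q.+1 w = lab a q.+1 w'.
Proof. by move=> [->]. Qed.

Lemma parcode_par w w' m : parcode w = parcode w' -> m \in lab a q.+1 w ->
  par a q m w = par a q m w'.
Proof. by move=> [-> /eq_in_map h] ml; apply: h. Qed.

Lemma parcode_sys w w' : parcode w = parcode w' -> par_sys a q w = par_sys a q w'.
Proof.
move=> e; have ep m := @parcode_par w w' m e; have el := parcode_lab e.
rewrite /par_sys; move: ep; rewrite el => ep; congr existT.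
by apply/funext => j; apply: ep; exact: valP.
Qed.

Lemma parcode_discrete y : sigma_of_discrete (par_sys a q) (parcode @^-1` [set y]).
Proof.
exists (dec @^-1` [set y]) => //; rewrite setTI.
by apply/seteqP; split => w /=; rewrite parcodeE.
Qed.

Lemma measurable_parcode y : measurable (parcode @^-1` [set y]).
Proof.
have [_ h _ _] := a3_split a3 q; apply: h; right; exact: parcode_discrete.
Qed.

End splitting.

(** * Conditional laws of the new replicas *)

Section rep_rectangles.
Context d (Om : measurableType d) (R : realType) (P : probability Om R).

Lemma trace_atom (E1 E2 : set (set Om)) (Ev : set Om) :
  (forall A, E2 A -> A `&` Ev = set0 \/ Ev `<=` A) ->
  forall A, <<s E1 `|` E2 >> A -> exists2 A1, <<s E1 >> A1 & A `&` Ev = A1 `&` Ev.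
Proof.
move=> h; apply: smallest_sub.
  split=> [|A [A1 sA1 AA1]|A_ hA] /=.
  - by exists set0; [exact: sigma_algebra0|].
  - exists (~` A1); first exact: sigma_algebraC.
    apply/seteqP; split => w /=.
      move=> [[_ nA] Ew]; split => // A1w; apply: nA.
      by have [//] : (A `&` Ev) w by rewrite AA1.
    move=> [nA1 Ew]; split => //; split => // Aw; apply: nA1.
    by have [//] : (A1 `&` Ev) w by rewrite -AA1.
  - have /choice[B BP] : forall i, exists B, <<s E1 >> B /\ A_ i `&` Ev = B `&` Ev.
      by move=> i; have [B] := hA i; exists B.
    exists (\bigcup_i B i); first by apply: sigma_algebra_bigcup => i; exact: (BP i).1.
    by rewrite !setI_bigcupl; apply: eq_bigcupr => i _; exact: (BP i).2.
move=> A [sA|/h[->|EA]].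
- by exists A => //; exact: sub_sigma_algebra.
- by exists set0; [exact: sigma_algebra0|rewrite set0I].
- by exists setT; [exact: gen_setT|rewrite setTI setIidr].
Qed.

Context (T : ptopologicalType) dU (U : measurableType dU).
Variable a : gams Om R T U.

Lemma eqm_rectangles q n (E : set (set Om)) (f g : Om -> R) :
  E `|` gRep a q n `<=` measurable -> gLab a q `<=` <<s E >> ->
  nnR f -> nnR g -> (\int[P]_w (f w)%:E < +oo)%E ->
  (forall A0 (Bs : nat -> set (borel T)), <<s E >> A0 -> (forall m, measurable (Bs m)) ->
    let A := A0 `&` [set w | forall m, m <> n -> Bs m (repx a q m w)] in
    \int[P]_w ((\1_A w)%:E * (f w)%:E) = \int[P]_w ((\1_A w)%:E * (g w)%:E))%E ->
  eqm P (E `|` gRep a q n) (EFin \o f) (EFin \o g).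
Proof.
move=> Gm LE nf ng ffin e.
have EG A : <<s E >> A -> <<s E `|` gRep a q n >> A.
  by apply: sub_sigma_algebra2 => B EB; left.
have LG : gLab a q `<=` <<s E `|` gRep a q n >> by move=> A /LE; exact: EG.
apply: (@eqm_pi _ _ _ P _ [set A | exists (A0 : set Om) (Bs : nat -> set (borel T)),
  [/\ <<s E >> A0, (forall m, measurable (Bs m)) &
   A = A0 `&` [set w | forall m, m <> n -> Bs m (repx a q m w)]]]) => //.
- apply/seteqP; split; apply: smallest_sub; try exact: smallest_sigma_algebra.
    move=> _ [A0 [Bs [sA0 mBs ->]]]; apply: gen_setI; first exact: EG.
    apply: (@measurable_bigcap_repx _ _ _ _ _ _ a q [set m | m <> n]) => // m mn.
    apply: measurable_repx; first exact: inlab_gen.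
    by move=> B mB; apply: sub_sigma_algebra; right; exists m, B.
  move=> A [EA|[m [B [mn mB ->]]]]; apply: sub_sigma_algebra.
    exists A, (fun=> setT); split; [exact: sub_sigma_algebra|by []|].
    by apply/seteqP; split => w /= => [|[]].
  exists (inlab a q m), (fun i => if i == m then B else setT); split.
  - exact: inlab_gen.
  - by move=> i; case: ifP.
  - apply/seteqP; split => w /=.
      move=> [mI Bw]; split => // i _; case: eqP => // ->.
      by rewrite /repx mI.
    by move=> [mI /(_ m mn)]; rewrite eqxx /repx mI.
- move=> _ _ [L [Bs [sL mBs ->]]] [L' [Bs' [sL' mBs' ->]]].
  exists (L `&` L'), (fun m => Bs m `&` Bs' m); split.
  + exact: gen_setI.
  + by move=> m; exact: measurableI.
  apply/seteqP; split => w /=.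
    by move=> [[h1 h2] [h3 h4]]; split => // m mn; split; [exact: h2|exact: h4].
  by move=> [[h1 h3] h]; split; split => // m /h[].
- exists setT, (fun=> setT); split => //; first exact: gen_setT.
  by apply/seteqP; split.
- by move=> _ [A0 [Bs [sA0 mBs ->]]]; exact: e.
Qed.

End rep_rectangles.

Section fresh_succ.
Context d (Om : measurableType d) (R : realType) (T : ptopologicalType).
Context dU (U : measurableType dU).
Variables (P : probability Om R) (pi0 : probability (borel T) R).
Variables (filt : R -> set (set T)).
Variable pik : R.-pker (measurableTypeR R * borel T)%type ~> borel T.
Variable a : gams Om R T U.
Hypotheses (filtF : level_filtration filt).
Hypotheses (a3 : assumption3 P filt a) (gf : gams_framework P pi0 filt pik a).
Variable q : nat.

Let gS := Fq filt a q `|` sigma_of_discrete (par_sys a q).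

Let gS_measurable : gS `<=` measurable.
Proof. exact: (gPast_measurable a3 (q := q.+1)). Qed.

Let par_set m (j : nat) : sigma_of_discrete (par_sys a q)
  [set w | m \in lab a q.+1 w /\ par a q m w = j].
Proof.
exists [set s : sys nat | exists i : projT1 s, val i = m /\ projT2 s i = j] => //.
rewrite setTI; apply/seteqP; split => w /=.
  by move=> [i [<- /= e]]; split => //; exact: valP.
by move=> [ml e]; exists [` ml]%fset.
Qed.

Let lab_gS : gLab a q.+1 `<=` <<s gS >>.
Proof.
move=> _ [J ->]; apply: sub_sigma_algebra; right.
exists [set s : sys nat | projT1 s = J] => //.
by rewrite setTI.
Qed.

Lemma brn_versions : exists Y : nat -> Om -> R, forall n,
  is_cexp P (Fq filt a q) (brn0 a q n) (Y n) /\
  {ae P, forall w, n \in lab a q w -> 0 < Y n w}.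
Proof.
have /choice[Y YP] : forall n, exists Y : Om -> R,
    is_cexp P (Fq filt a q) (brn0 a q n) Y /\
    {ae P, forall w, n \in lab a q w -> 0 < Y w}.
  by move=> n; have [Y] := a3_brn_gt0 a3 q n; exists Y.
by exists Y.
Qed.

Lemma cexp_gmeas (X Y : Om -> R) : is_cexp P (Fq filt a q) X Y -> gmeas (Fq filt a q) Y.
Proof. by move=> [mY _] _ B mB; rewrite setTI; apply: sub_sigma_algebra; exact: mY. Qed.

(* powR _ (-1) is the inverse on positive reals and, unlike it, is nonnegative
   everywhere *)
Lemma child_wgt_gmeas (Y : Om -> R) j : gmeas (Fq filt a q) Y ->
  gmeas (Fq filt a q) (fun w => wgtx a q j w * powR (Y w) (-1)).
Proof.
move=> mY; apply: measurable_funM; first exact: (wgtx_Fq filtF a3 gf).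
exact: (measurableT_comp (measurable_powR (-1))).
Qed.

Lemma wgt_next_ae (Y : nat -> Om -> R) :
  (forall n, is_cexp P (Fq filt a q) (brn0 a q n) (Y n) /\
    {ae P, forall w, n \in lab a q w -> 0 < Y n w}) ->
  {ae P, forall w m, m \in lab a q.+1 w -> wgt a q.+1 m w =
    wgtx a q (par a q m w) w * powR (Y (par a q m w) w) (-1)}.
Proof.
move=> YP.
have ae1 : {ae P, forall w j, j \in lab a q w -> 0 < Y j w}.
  by apply: ae_foralln => j; exact: (YP j).2.
have ae2 : {ae P, forall w j, forall m, m \in lab a q.+1 w -> par a q m w = j ->
    wgt a q.+1 m w = wgt a q j w / Y j w}.
  by apply: ae_foralln => j; exact: (wgt_next gf (YP j).1).
apply: filterS2 ae1 ae2 => w Y0 wE m ml.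
have pl := survivors_lab (par_survivors gf ml).
rewrite (wE (par a q m w) m ml erefl) /wgtx pl powR_inv1//.
by apply: ltW; exact: Y0.
Qed.

(* The weights are divided by a version of E(B | Fq q), so they are functions of
   the past only up to a null set. *)
Lemma gWgt_ae A : gWgt a q.+1 A -> measurable A /\
  exists2 B, <<s gS >> B & ae_eqset P A B.
Proof.
move=> [m [D [mD ->]]]; split; first exact: (measurable_wgtset gf).
have [Y YP] := brn_versions.
pose r j w := wgtx a q j w * powR (Y j w) (-1).
have gr j : gmeas gS (r j).
  apply: (@gmeas_sub _ _ (Fq filt a q)) => [B FB|].
    by apply: sub_sigma_algebra; left.
  by apply: child_wgt_gmeas; exact: (cexp_gmeas (YP j).1).
exists (\bigcup_(j : nat) ([set w | m \in lab a q.+1 w /\ par a q m w = j] `&` r j @^-1` D)).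
  apply: countable_bigcup_gen => j; apply: gen_setI.
    by apply: sub_sigma_algebra; right; exact: par_set.
  by have := gr j measurableT _ mD; rewrite setTI.
apply: filterS (wgt_next_ae YP) => w wE; split.
  by move=> [ml Dw]; exists (par a q m w) => //; split => //=; rewrite /r -wE.
by move=> [j _ [[/= ml <-] Dw]]; split => //; rewrite wE.
Qed.

Definition parx n w : borel T :=
  if n \in lab a q.+1 w then repx a q (par a q n w) w else point.

Lemma measurable_parx n : measurable_fun setT (parx n).
Proof.
move=> _ B mB; rewrite setTI.
have mset (j : nat) : measurable [set w | n \in lab a q.+1 w /\ par a q n w = j].
  by apply: gS_measurable; right; exact: par_set.
rewrite (_ : parx n @^-1` B = \bigcup_(j : nat)
   ([set w | n \in lab a q.+1 w /\ par a q n w = j] `&` repx a q j @^-1` B) `|`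
   ([set _ | B point] `\` inlab a q.+1 n)).
  apply: measurableU.
    apply: bigcupT_measurable => j; apply: measurableI => //.
    by rewrite -[X in measurable X]setTI; exact: (measurable_repxT gf).
  apply: measurableD; last exact: (measurable_inlab gf).
  have [h|h] := pselect (B point).
    by rewrite (_ : [set _ | _] = setT)//; apply/seteqP; split.
  by rewrite (_ : [set _ | _] = set0)//; apply/seteqP; split.
apply/seteqP; split => w /=; rewrite /parx /inlab /setD /=; case: ifPn => nI.
- by move=> Bw; left; exists (par a q n w).
- by move=> Bw; right; split => //; exact/negP.
- by move=> [[j _ [[/= _ ->]]]|[_ []]].
- by move=> [[j _ [[/= h]]]|[]//]; rewrite h in nI.
Qed.

Let gx (G : set (set Om)) j : Fq filt a q `<=` <<s G >> ->
  (forall B : set (borel T), measurable B -> <<s G >> (repset a q j B)) ->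
  gmeas G (repx a q j).
Proof.
move=> FG GB; apply: measurable_repx => //.
by apply: inlab_gen => A /(gLab_Fq filtF a3 gf)/FG.
Qed.

Let gl (G : set (set Om)) : Fq filt a q `<=` <<s G >> -> gmeas G (lev a q).
Proof. by move=> FG; apply: (gmeas_sub FG); exact: (lev_Fq filtF a3 gf). Qed.

Lemma prod_indic (I : Type) (s : seq I) (A : I -> set T) (x : I -> T) :
  \prod_(i <- s) (\1_(A i) (x i) : R) = (all (fun i => x i \in A i) s)%:R.
Proof.
elim: s => [|i s ih]; first by rewrite big_nil.
by rewrite big_cons ih /= indicE -natrM mulnb.
Qed.

Lemma allM1_map (I : Type) (s : seq I) (g : I -> T -> R) :
  (forall i, M1 (g i)) -> allM1 [seq g i | i <- s].
Proof. by move=> Mg; elim: s => [//|i s ih]; apply/allM1_cons. Qed.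

Section parcode_atom.
Hypothesis ci : cond_indep P filt pik a q.
Variables (n : nat) (phi : T -> R) (w0 : Om).
Hypotheses (Mphi : M1 phi) (nw0 : n \in lab a q.+1 w0).
Let Ev := parcode a q @^-1` [set parcode a q w0].
Let J := lab a q.+1 w0.
Let pp m := par a q m w0.
Variables (A1 : set Om) (Bs : nat -> set (borel T)).
Hypotheses (FA1 : <<s Fq filt a q >> A1) (mBs : forall m, measurable (Bs m)).
Let js := [seq m <- J | m != n].
Let gg m : T -> R := \1_(Bs m).

Let Mgg m : M1 (gg m). Proof. exact: M1_indic. Qed.

Let EvP w : Ev w -> lab a q.+1 w = J /\ forall m, m \in J -> par a q m w = pp m.
Proof.
move=> Ew; have e : parcode a q w = parcode a q w0 := Ew.
split=> [|m mJ]; first exact: parcode_lab e.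
by apply: (parcode_par e); rewrite (parcode_lab e).
Qed.

Let jsJ m : m \in js -> m \in J /\ m != n.
Proof. by rewrite mem_filter => /andP[]. Qed.

Let Ev_new w m : Ev w -> m \in J -> pp m != m ->
  [/\ m \in newlab a q w, par a q m w = pp m & pp m \in lab a q w].
Proof.
move=> /EvP[lJ lp] mJ pm; have ml : m \in lab a q.+1 w by rewrite lJ.
split; [by rewrite (newlab_par gf)// lp|exact: lp|].
by rewrite -lp//; apply: survivors_lab; exact: (par_survivors gf).
Qed.

Let Ev_old w m : Ev w -> m \in J -> pp m = m ->
  repx a q.+1 m w = repx a q m w /\ m \in lab a q w.
Proof.
move=> /EvP[lJ lp] mJ pm; have ml : m \in lab a q.+1 w by rewrite lJ.
split; first by apply: (repx_survivor gf) => //; rewrite lp.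
by apply: survivors_lab; rewrite (survivors_par gf)// lp// pm.
Qed.

Let sEv : <<s gSplit filt a q >> Ev.
Proof. by apply: sub_sigma_algebra; right; exact: parcode_discrete. Qed.

Let mEv : measurable Ev.
Proof. exact: (measurable_parcode a3). Qed.

Let jS := [seq m <- js | pp m == m].
Let jN := [seq m <- js | pp m != m].
Let RS w : R := \prod_(m <- jS) gg m (repx a q m w).

Let gg0 m y : 0 <= gg m y. Proof. by have /andP[] := (Mgg m).2 y. Qed.

Let RS0 w : 0 <= RS w. Proof. by rewrite prodr_ge0. Qed.

Let uniq_js : uniq js. Proof. by rewrite filter_uniq// fset_uniq. Qed.

Let split_js w : Ev w -> \prod_(m <- js) gg m (repx a q.+1 m w) =
  RS w * \prod_(m <- jN) gg m (repx a q.+1 m w).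
Proof.
move=> Ew; rewrite (bigID (fun m => pp m == m))/=.
rewrite -[X in X * _ = _]big_filter -[X in _ * X = _]big_filter; congr (_ * _).
apply: eq_big_seq => m; rewrite mem_filter => /andP[/eqP pm /jsJ[mJ _]].
by have [->] := Ev_old Ew mJ pm.
Qed.

Let FK : Fq filt a q `<=` <<s gKnown filt a q >>.
Proof. by move=> A FA; apply: sub_sigma_algebra; left. Qed.

Let KS A : <<s gKnown filt a q >> A -> <<s gSplit filt a q >> A.
Proof. by apply: sub_sigma_algebra2 => B KB; left. Qed.

Let gxK j : gmeas (gKnown filt a q) (repx a q j).
Proof. by apply: gx => // B mB; apply: sub_sigma_algebra; right; exists j, B. Qed.

Let gK_RS u : (forall w, 0 <= u w) -> gmeas (gKnown filt a q) (u : Om -> R) ->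
  nnmeas ((fun w => (\1_A1 w * RS w * u w)%:E) : g_sigma_algebraType (gKnown filt a q) -> \bar R).
Proof.
move=> u0 gu; apply: nnmeas_EFin => [|w]; last by rewrite !mulr_ge0.
apply: measurable_funM => //; apply: measurable_funM.
  apply: measurable_indic; move: FA1; apply: smallest_sub; first exact: smallest_sigma_algebra.
  exact: FK.
by apply: measurable_prod => m _; apply: (measurableT_comp (Mgg m).1); exact: gxK.
Qed.

Let gKS d' (V : measurableType d') (u : Om -> V) :
  gmeas (gKnown filt a q) u -> gmeas (gSplit filt a q) u.
Proof. by apply: gmeas_sub => A KA; apply: KS; exact: sub_sigma_algebra. Qed.

Let nKS (u : Om -> \bar R) :
  nnmeas (u : g_sigma_algebraType (gKnown filt a q) -> \bar R) ->
  nnmeas (u : g_sigma_algebraType (gSplit filt a q) -> \bar R).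
Proof. by move=> [mu u0]; split => //; exact: gKS. Qed.

Let gK_Kr psi j : M1 psi -> gmeas (gKnown filt a q) (fun w => Kr pik psi (lev a q w) (repx a q j w)).
Proof.
move=> Mpsi.
exact: (@measurable_Kr _ _ pik _ (g_sigma_algebraType (gKnown filt a q)) _ _ _ (gl FK) (gxK j) Mpsi).
Qed.

Let Kr0 psi j w : M1 psi -> 0 <= Kr pik psi (lev a q w) (repx a q j w).
Proof. by move=> Mpsi; have /andP[] := Kr01 pik (lev a q w) (repx a q j w) Mpsi. Qed.

Let resample s (ff : nat -> T -> R) u : uniq s -> (forall m, M1 (ff m)) ->
  (forall m, m \in s -> m \in J /\ pp m != m) ->
  (forall w, 0 <= u w) -> gmeas (gKnown filt a q) (u : Om -> R) ->
  (\int[P]_w ((\1_A1 w * RS w * u w)%:E *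
     (\1_Ev w * \prod_(m <- s) ff m (repx a q.+1 m w))%:E) =
   \int[P]_w ((\1_A1 w * RS w * u w)%:E *
     (\1_Ev w * \prod_(m <- s) Kr pik (ff m) (lev a q w) (repx a q (pp m) w))%:E))%E.
Proof.
move=> us Mff sP u0 gu.
apply: (resample_laws filtF a3 gf sEv us Mff) => [w m Ew ms|].
  by have [mJ pm] := sP m ms; exact: Ev_new.
by apply: nKS; exact: gK_RS.
Qed.

Let jNP m : m \in jN -> m \in J /\ pp m != m.
Proof. by rewrite mem_filter => /andP[pm /jsJ[mJ _]]. Qed.

Let old_case : pp n = n ->
  (\int[P]_w ((\1_A1 w * RS w * phi (repx a q n w))%:E *
     (\1_Ev w * \prod_(m <- jN) gg m (repx a q.+1 m w))%:E) =
   \int[P]_w ((\1_A1 w * RS w * Kr pik phi (lev a q w) (repx a q n w))%:E *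
     (\1_Ev w * \prod_(m <- jN) gg m (repx a q.+1 m w))%:E))%E.
Proof.
move=> pn.
have uN : uniq jN by rewrite filter_uniq.
rewrite !resample//; last 4 first.
- by move=> w; exact: Kr0.
- exact: gK_Kr.
- by move=> w; have /andP[] := Mphi.2 (repx a q n w).
- by apply: (measurableT_comp Mphi.1); exact: gxK.
pose psis := [seq gg m | m <- [seq m <- jN | pp m == n]].
pose RK w : R := \prod_(m <- [seq m <- jN | pp m != n])
  Kr pik (gg m) (lev a q w) (repx a q (pp m) w).
have RK0 w : 0 <= RK w by rewrite prodr_ge0// => m _; exact: Kr0.
have prodE w : \prod_(m <- jN) Kr pik (gg m) (lev a q w) (repx a q (pp m) w) =
    RK w * Kprod pik psis (lev a q w) (repx a q n w).
  rewrite (bigID (fun m => pp m == n))/= mulrC.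
  rewrite -[X in X * _ = _]big_filter -[X in _ * X = _]big_filter; congr (_ * _).
  rewrite /Kprod /psis big_map; apply: eq_big_seq => m.
  by rewrite mem_filter => /andP[/eqP->].
have [kap [nkap ekap]] : exists kap : Om -> \bar R,
    nnmeas (kap : g_sigma_algebraType (Fq filt a q) -> \bar R) /\
    eqm P (gKnown filt a q) (fun w => (\1_Ev w)%:E) kap.
  have [C _ CE] := parcode_discrete a q (parcode a q w0); rewrite setTI in CE.
  have hE w : \1_C (par_sys a q w) = \1_Ev w :> R by rewrite /Ev -CE.
  have [] := @split_freeze _ _ _ _ _ _ P pi0 filt pik a filtF a3 gf q (fun x => \1_C x.2).
  - by [].
  - rewrite (_ : (fun w => _) = \1_Ev); first exact: measurable_indic.
    by apply/funext => w /=; rewrite hE.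
  move=> kap [nk ek]; exists kap; split => //.
  rewrite (_ : (fun w => _) = (fun w => (\1_C (par_sys a q w))%:E))//.
  by apply/funext => w; rewrite hE.
have Mps : allM1 psis by exact: allM1_map.
have gKp : gmeas (gKnown filt a q) (fun w => Kprod pik psis (lev a q w) (repx a q n w)).
  exact: (@measurable_Kprod _ _ pik _ (g_sigma_algebraType (gKnown filt a q)) _ _ _ (gl FK) (gxK n) Mps).
have Kp0 w : 0 <= Kprod pik psis (lev a q w) (repx a q n w).
  by have /andP[] := Kprod01 pik (lev a q w) (repx a q n w) Mps.
have gRK : gmeas (gKnown filt a q) RK.
  by apply: measurable_prod => m _; exact: gK_Kr.
have gN : gmeas (gKnown filt a q) (\1_(inlab a q n) : Om -> R).
  apply: measurable_indic; apply: inlab_gen => A LA; apply: FK.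
  exact: (gLab_Fq filtF a3 gf).
pose G2 := Fq filt a q `|` gRep a q n.
have FG2 : Fq filt a q `<=` <<s G2 >> by move=> A FA; apply: sub_sigma_algebra; left.
have gx2 j : j != n -> gmeas G2 (repx a q j).
  move=> /eqP jn; apply: gx => // B mB; apply: sub_sigma_algebra; right.
  by exists j, B.
pose W w := ((\1_A1 w * RS w * RK w)%:E * kap w)%E.
have nW : nnmeas (W : g_sigma_algebraType G2 -> \bar R).
  apply: nnmeasM; last by case: nkap => mk k0; split => //; exact: gmeas_sub FG2 mk.
  apply: nnmeas_EFin => [|w]; last by rewrite !mulr_ge0.
  apply: measurable_funM; first apply: measurable_funM.
  - apply: measurable_indic; move: FA1; apply: smallest_sub; first exact: smallest_sigma_algebra.
    exact: FG2.
  - rewrite /RS; apply: measurable_prod => m; rewrite mem_filter => /andP[_ /jsJ[_ mn]].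
    by apply: (measurableT_comp (Mgg m).1); exact: gx2.
  - apply: measurable_prod => m; rewrite mem_filter => /andP[pmn _].
    exact: (@measurable_Kr _ _ pik _ (g_sigma_algebraType G2) _ _ _ (gl FG2) (gx2 _ pmn) (Mgg m)).
have red u : (forall w, 0 <= u w) -> gmeas (gKnown filt a q) (u : Om -> R) ->
  (\int[P]_w ((\1_A1 w * RS w * u w)%:E *
     (\1_Ev w * \prod_(m <- jN) Kr pik (gg m) (lev a q w) (repx a q (pp m) w))%:E) =
   \int[P]_w (W w * (\1_(inlab a q n) w * u w *
      Kprod pik psis (lev a q w) (repx a q n w))%:E))%E.
  move=> u0 gu.
  pose v w := RK w * (\1_(inlab a q n) w * u w * Kprod pik psis (lev a q w) (repx a q n w)).
  have gv : gmeas (gKnown filt a q) v.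
    by apply: measurable_funM => //; apply: measurable_funM => //; exact: measurable_funM.
  have v0 w : 0 <= v w by rewrite !mulr_ge0.
  transitivity (\int[P]_w ((\1_A1 w * RS w * v w)%:E * (\1_Ev w)%:E))%E.
    apply: eq_integral => w _; rewrite -!EFinM; congr EFin.
    have [Ew|nEw] := pselect (Ev w); last first.
      by rewrite [\1_Ev w]indicE memNset// !(mul0r, mulr0).
    rewrite /v; have -> : \1_(inlab a q n) w = 1 :> R.
      by rewrite indicE mem_set// /inlab /=; have [] := Ev_old Ew nw0 pn.
    by rewrite prodE; move: (RS w) (u w) (RK w) (Kprod _ _ _ _) (\1_A1 w) (\1_Ev w) => *; ring.
  rewrite (ekap _ (gK_RS v0 gv)); apply: eq_integral => w _.
  rewrite /W /v muleAC -EFinM; congr (_%:E * _)%E.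
  by rewrite -!mulrA.
rewrite red; last 2 first.
- by move=> w; have /andP[] := Mphi.2 (repx a q n w).
- by apply: (measurableT_comp Mphi.1); exact: gxK.
rewrite red; last 2 first.
- by move=> w; exact: Kr0.
- exact: gK_Kr.
exact: (ci Mphi Mps nW).
Qed.

Let new_case : pp n != n ->
  (\int[P]_w ((\1_A1 w * RS w)%:E *
     (\1_Ev w * \prod_(m <- jN) gg m (repx a q.+1 m w) * phi (repx a q.+1 n w))%:E) =
   \int[P]_w ((\1_A1 w * RS w * Kr pik phi (lev a q w) (repx a q (pp n) w))%:E *
     (\1_Ev w * \prod_(m <- jN) gg m (repx a q.+1 m w))%:E))%E.
Proof.
move=> pn; pose ff m := if m == n then phi else gg m.
have Mff m : M1 (ff m) by rewrite /ff; case: ifP.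
have uN : uniq jN by rewrite filter_uniq.
have nN : n \notin jN by rewrite !mem_filter eqxx andbF.
have ffE (F : (T -> R) -> nat -> R) : \prod_(m <- jN) F (ff m) m = \prod_(m <- jN) F (gg m) m.
  by apply: eq_big_seq => m mN; rewrite /ff; case: eqP mN nN => // -> ->.
rewrite resample//; last 2 first.
- by move=> w; exact: Kr0.
- exact: gK_Kr.
transitivity (\int[P]_w ((\1_A1 w * RS w * 1)%:E *
     (\1_Ev w * \prod_(m <- n :: jN) ff m (repx a q.+1 m w))%:E))%E.
  apply: eq_integral => w _; rewrite mulr1 big_cons {1}/ff eqxx.
  rewrite (ffE (fun f m => f (repx a q.+1 m w))).
  by congr (_ * _%:E)%E; rewrite -mulrA; congr (_ * _); rewrite mulrC.
have uS : uniq (n :: jN) by rewrite cons_uniq nN.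
have SP m : m \in n :: jN -> m \in J /\ pp m != m by rewrite inE => /orP[/eqP-> //|/jNP].
have g1 : gmeas (gKnown filt a q) ((fun=> 1) : Om -> R) by exact: measurable_cst.
rewrite (resample uS Mff SP (fun=> ler01) g1).
apply: eq_integral => w _; rewrite mulr1 big_cons {1}/ff eqxx.
rewrite (ffE (fun f m => Kr pik f (lev a q w) (repx a q (pp m) w))).
by rewrite -!EFinM; congr EFin; rewrite -!mulrA; do 2 congr (_ * _); rewrite mulrCA.
Qed.

(* On Ev the labels and the genealogy are fixed. The new replicas have law
   pi_Z of their parents; if n is an old label, its children turn into the
   factors Kr (gg m) of the level-Z law at X^(n,q), i.e. into the psis of
   cond_indep. *)
Lemma parcode_atom :
  (\int[P]_w (\1_A1 w * (\1_Ev w * \prod_(m <- js) gg m (repx a q.+1 m w) *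
      phi (repx a q.+1 n w)))%:E =
   \int[P]_w (\1_A1 w * (\1_Ev w * \prod_(m <- js) gg m (repx a q.+1 m w) *
      Kr pik phi (lev a q w) (repx a q (pp n) w)))%:E)%E.
Proof.
have red u v : (forall w, Ev w -> u w = v w) ->
  (\int[P]_w (\1_A1 w * (\1_Ev w * \prod_(m <- js) gg m (repx a q.+1 m w) * u w))%:E =
   \int[P]_w ((\1_A1 w * RS w * v w)%:E *
     (\1_Ev w * \prod_(m <- jN) gg m (repx a q.+1 m w))%:E))%E.
  move=> uv; apply: eq_integral => w _; rewrite -EFinM; congr EFin.
  have [Ew|nEw] := pselect (Ev w); last first.
    by rewrite [\1_Ev w]indicE memNset// !(mul0r, mulr0).
  rewrite split_js// uv//.
  by move: (RS w) (\prod_(_ <- _) _) (v w) (\1_A1 w) (\1_Ev w) => *; ring.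
rewrite (red (fun w => Kr pik phi (lev a q w) (repx a q (pp n) w)) _ (fun w _ => erefl)).
have [pn|pn] := eqVneq (pp n) n.
  rewrite (red _ (fun w => phi (repx a q n w))); last first.
    by move=> w Ew; have [->] := Ev_old Ew nw0 pn.
  by rewrite pn; exact: old_case.
rewrite -new_case// (red _ _ (fun w _ => erefl)).
apply: eq_integral => w _; rewrite -!EFinM; congr EFin.
by move: (RS w) (\prod_(_ <- _) _) (phi _) (\1_A1 w) (\1_Ev w) => *; ring.
Qed.

End parcode_atom.

Lemma fresh_succ : cond_indep P filt pik a q -> fresh P pi0 filt pik a q.+1.
Proof.
move=> ci n phi Mphi.
pose f w : R := \1_(inlab a q.+1 n) w * phi (repx a q.+1 n w).
pose g w : R := \1_(inlab a q.+1 n) w * Kr pik phi (lev a q w) (parx n w).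
rewrite (_ : (fun w => ((\1_(inlab a q.+1 n) w)%:E * _)%E) = EFin \o g); last first.
  apply/funext => w /=; rewrite EFinM KrE// indicE.
  have [nI|_] := boolP (w \in inlab a q.+1 n); last by rewrite !mul0e.
  move: nI; rewrite inE /inlab /= => nI.
  by rewrite /parx nI /repx (survivors_lab (par_survivors gf nI)).
have mI : measurable (inlab a q.+1 n) by exact: (measurable_inlab gf).
have f01 w : 0 <= f w <= 1.
  have /andP[p0 p1] := Mphi.2 (repx a q.+1 n w).
  by rewrite mulr_ge0//= mulr_ile1// indicE; case: (_ \in _).
have nf : nnR f.
  split=> [|w]; last by have /andP[] := f01 w.
  apply: measurable_funM; first exact: measurable_indic.
  by apply: (measurableT_comp Mphi.1); exact: (measurable_repxT gf).
have ng : nnR g.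
  split=> [|w]; last first.
    by have /andP[p0 p1] := Kr01 pik (lev a q w) (parx n w) Mphi; rewrite mulr_ge0.
  apply: measurable_funM; first exact: measurable_indic.
  apply: measurable_Kr => //; last exact: measurable_parx.
  exact: (measurable_levT filtF a3 gf).
pose G := gS `|` gRep a q.+1 n.
have Gm : G `<=` measurable by move=> A [/gS_measurable//|]; exact: (gRep_measurable gf).
have FS : Fq filt a q `<=` <<s gS >> by move=> A FA; apply: sub_sigma_algebra; left.
have SG A : <<s gS >> A -> <<s G >> A by apply: sub_sigma_algebra2 => B; left.
have triv A : <<s G >> A -> measurable A /\ exists2 B, <<s G >> B & ae_eqset P A B.
  move=> GA; split; first exact: (gen_measurable Gm).
  by exists A => //; exact: aeW.
apply: (eqm_compl Gm nf ng).
  move=> A [[PA|[LA|WA]]|RA].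
  - by apply: triv; apply: SG; exact: sub_sigma_algebra.
  - by apply: triv; apply: SG; exact: lab_gS.
  - by have [mA [B sB AB]] := gWgt_ae WA; split => //; exists B => //; exact: SG.
  - by apply: triv; apply: sub_sigma_algebra; right.
apply: (eqm_partition Gm (nnR_nnmeas nf) (nnR_nnmeas ng) (fun y => @measurable_parcode _ _ _ _ _ _ P filt a a3 q y)) => y.
set Ev := _ @^-1` _.
have mEv : measurable Ev by exact: (measurable_parcode a3).
have nE u : nnR u -> nnR (fun w => \1_Ev w * u w).
  by move=> [mu u0]; split=> [|w]; [apply: measurable_funM => //; exact: measurable_indic|rewrite mulr_ge0].
apply: (@eqm_rectangles _ _ _ P _ _ _ a q.+1 n gS (fun w => \1_Ev w * f w) (fun w => \1_Ev w * g w)) => //.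
- exact: nE.
- exact: nE.
- apply: integral_le1_lty; first exact: nE.
  by move=> w; have /andP[p0 p1] := f01 w; rewrite mulr_ile1// indicE; case: (_ \in _).
move=> A0 Bs sA0 mBs A.
have [[w0 [Ew0 nw0]]|no] := pselect (exists w0, Ev w0 /\ n \in lab a q.+1 w0); last first.
  apply: eq_integral => w _; congr (_ * _)%E.
  have [Ew|nEw] := pselect (Ev w); last by rewrite [\1_Ev w]indicE memNset// !mul0r.
  have nI : ~ inlab a q.+1 n w by move=> nI; apply: no; exists w.
  by rewrite /f /g [\1_(inlab _ _ _) w]indicE memNset// !mul0r.
have yE : y = parcode a q w0 by rewrite Ew0.
rewrite yE in Ev mEv nE Ew0 A *.
have [A1 FA1 AE] : exists2 A1, <<s Fq filt a q >> A1 & A0 `&` Ev = A1 `&` Ev.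
  apply: trace_atom sA0 => _ [D _ <-]; rewrite setTI.
  have [Dw|nDw] := pselect (D (par_sys a q w0)).
    by right => w Ew /=; rewrite (parcode_sys Ew).
  left; apply/seteqP; split => w // [/= Dw Ew]; apply: nDw.
  by rewrite -(parcode_sys Ew).
pose J := lab a q.+1 w0; pose js := [seq m <- J | m != n].
have EJ w : Ev w -> lab a q.+1 w = J.
  by move=> Ew; have e : parcode a q w = parcode a q w0 := Ew; exact: parcode_lab e.
have In w : Ev w -> \1_(inlab a q.+1 n) w = 1 :> R.
  by move=> Ew; rewrite indicE mem_set// /inlab /= EJ.
have [BP|nBP] := pselect (forall m, m <> n -> m \notin J -> Bs m point); last first.
  have z w : \1_A w * \1_Ev w = 0 :> R.
    have [Ew|nEw] := pselect (Ev w); last by rewrite [\1_Ev w]indicE memNset// mulr0.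
    rewrite indicE memNset ?mul0r// => -[_ h]; apply: nBP => m mn mJ.
    by have := h m mn; rewrite /repx EJ// (negbTE mJ).
  by apply: eq_integral => w _; rewrite -!EFinM !mulrA z !mul0r.
have AEv w : \1_A w * \1_Ev w =
    \1_A1 w * (\1_Ev w * \prod_(m <- js) \1_(Bs m) (repx a q.+1 m w)) :> R.
  have [Ew|nEw] := pselect (Ev w); last by rewrite [\1_Ev w]indicE memNset// !(mul0r, mulr0).
  rewrite prod_indic mulrA.
  have -> : \1_A1 w * \1_Ev w = \1_A0 w * \1_Ev w :> R.
    have := congr1 (fun S : set Om => (\1_S w : R)) AE.
    by rewrite !indicI.
  rewrite indicI -!mulrA (mulrC _ (\1_Ev w)); do 2 congr (_ * _).
  rewrite indicE; congr ((nat_of_bool _)%:R); apply/idP/allP.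
    rewrite inE /= => h m; rewrite mem_filter => /andP[/eqP mn _].
    by rewrite inE; exact: h.
  move=> h; rewrite inE /= => m mn; have [mJ|mJ] := boolP (m \in J).
    by have := h m; rewrite mem_filter mJ andbT inE; apply; exact/eqP.
  by rewrite /repx EJ// (negbTE mJ); exact: BP.
transitivity (\int[P]_w (\1_A1 w * (\1_Ev w * \prod_(m <- js) \1_(Bs m) (repx a q.+1 m w) *
      phi (repx a q.+1 n w)))%:E)%E.
  apply: eq_integral => w _; rewrite -EFinM; congr EFin.
  rewrite !mulrA AEv -!mulrA; congr (_ * _).
  have [Ew|nEw] := pselect (Ev w); last by rewrite [\1_Ev w]indicE memNset// !(mul0r, mulr0).
  by rewrite In// mul1r.
rewrite (parcode_atom ci Mphi nw0 FA1 mBs).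
apply: eq_integral => w _; rewrite -EFinM; congr EFin.
rewrite [RHS]mulrA AEv -!mulrA; congr (_ * _).
have [Ew|nEw] := pselect (Ev w); last by rewrite [\1_Ev w]indicE memNset// !(mul0r, mulr0).
have nI : n \in lab a q.+1 w by rewrite EJ.
have e : parcode a q w = parcode a q w0 := Ew.
by rewrite /g In// mul1r /parx nI (parcode_par e nI).
Qed.

End fresh_succ.

Section almost_sure.
Context d (Om : measurableType d) (R : realType) (P : probability Om R).

Lemma lt_integral_null (D : set Om) (u v : Om -> \bar R) :
  measurable D -> nnmeas u -> nnmeas v -> (forall w, D w -> (u w < v w)%E) ->
  (\int[P]_(w in D) u w = \int[P]_(w in D) v w)%E ->
  (\int[P]_(w in D) v w < +oo)%E -> P D = 0%E.
Proof.
move=> mD [mu u0] [mv v0] uv e fin.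
have mu' : measurable_fun D u by exact: measurable_funTS.
have mv' : measurable_fun D v by exact: measurable_funTS.
pose h w := (v w - u w)%E.
have mh : measurable_fun D h by exact: emeasurable_funB.
have h0 w : D w -> (0 < h w)%E by move=> Dw; rewrite sube_gt0 uv.
have fu w : D w -> u w \is a fin_num.
  by move=> Dw; rewrite ge0_fin_numE// (lt_le_trans (uv _ Dw))// leey.
have hE : (\int[P]_(w in D) h w = 0)%E.
  have : (\int[P]_(w in D) v w = \int[P]_(w in D) u w + \int[P]_(w in D) h w)%E.
    rewrite -ge0_integralD//; last by move=> w /h0/ltW.
    by apply: eq_integral => w; rewrite inE => Dw; rewrite /h addeC subeK// fu.
  have key (x y : \bar R) : x \is a fin_num -> x = (x + y)%E -> y = 0%E.
    by case: x y => [x||] [y||]//= _ [xy]; congr EFin; lra.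
  rewrite e; apply: key; rewrite ge0_fin_numE//.
  by apply: integral_ge0 => w _; exact: v0.
have : (\int[P]_(w in D) `|h w| = 0)%E.
  rewrite -[RHS]hE; apply: eq_integral => w; rewrite inE => Dw.
  by rewrite gee0_abs// ltW// h0.
move/(ae_eq_integral_abs P mD mh) => hae.
apply/(negligibleP P mD); apply: negligibleS hae => w Dw /=.
by move=> /(_ Dw) hw; have := h0 _ Dw; rewrite hw ltxx.
Qed.

Lemma cexp_unique (G : set (set Om)) (f : Om -> R) (g : Om -> \bar R) :
  G `<=` measurable -> gmeas G f -> (forall w, 0 <= f w) ->
  nnmeas (g : g_sigma_algebraType G -> \bar R) ->
  (forall A, <<s G >> A ->
    \int[P]_(w in A) (f w)%:E = \int[P]_(w in A) g w)%E ->
  {ae P, forall w, g w = (f w)%:E}.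
Proof.
move=> Gm gf f0 ng e.
have nf : nnmeas ((fun w => (f w)%:E) : g_sigma_algebraType G -> \bar R).
  exact: nnmeas_EFin.
have up (u : Om -> \bar R) : nnmeas (u : g_sigma_algebraType G -> \bar R) -> nnmeas u.
  by move=> [mu u0]; split => //; exact: gmeas_measurable mu.
pose B (N : nat) : set Om := f @^-1` `]-oo, N%:R].
have sB N : <<s G >> (B N).
  by have := gf measurableT _ (measurable_itv `]-oo, N%:R]); rewrite setTI.
pose D1 N := B N `&` [set w | ((f w)%:E < g w)%E].
pose D2 N := B N `&` [set w | (g w < (f w)%:E)%E].
have sD1 N : <<s G >> (D1 N).
  apply: gen_setI => //; rewrite -[X in <<s _ >> X]setTI.
  exact: (@measurable_lte _ (g_sigma_algebraType G) R setT measurableT _ _ nf.1 ng.1).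
have sD2 N : <<s G >> (D2 N).
  apply: gen_setI => //; rewrite -[X in <<s _ >> X]setTI.
  exact: (@measurable_lte _ (g_sigma_algebraType G) R setT measurableT _ _ ng.1 nf.1).
have fin N D : <<s G >> D -> D `<=` B N -> (\int[P]_(w in D) (f w)%:E < +oo)%E.
  move=> sD DB; have mD : measurable D by exact: gen_measurable sD.
  apply: (@le_lt_trans _ _ (\int[P]_(w in D) cst N%:R%:E w)%E).
    apply: ge0_le_integral => //.
    - by move=> w _; exact: nf.2.
    - by apply: measurable_funTS; exact: (up _ nf).1.
  by rewrite integral_cst// lte_mul_pinfty// ltey_eq fin_num_measure.
have z1 N : P (D1 N) = 0%E.
  have mD : measurable (D1 N) by exact: gen_measurable (sD1 N).
  apply: (lt_integral_null mD (up _ nf) (up _ ng)) => [w []//||].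
    exact: e.
  by rewrite -e//; apply: (fin N) => // w [].
have z2 N : P (D2 N) = 0%E.
  have mD : measurable (D2 N) by exact: gen_measurable (sD2 N).
  apply: (lt_integral_null mD (up _ ng) (up _ nf)) => [w []//||].
    by rewrite -e.
  by apply: (fin N) => // w [].
have : P.-negligible (\bigcup_N (D1 N `|` D2 N)).
  apply: negligible_bigcup => N; apply: negligibleU.
    by apply/(negligibleP P (gen_measurable Gm (sD1 N))); exact: z1.
  by apply/(negligibleP P (gen_measurable Gm (sD2 N))); exact: z2.
apply: negligibleS => w /= gf'; exists (Num.truncn (f w)).+1 => //.
have Bw : B (Num.truncn (f w)).+1 w by rewrite /B /= in_itv/= ltW// truncnS_gt.
case: (ltgtP (g w) (f w)%:E) => // h; by [right|left].
Qed.

End almost_sure.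

Lemma fset_series (R : realType) (J : {fset nat}) (f : nat -> \bar R) :
  (forall n, 0 <= f n)%E ->
  (\sum_(n <oo) (if n \in J then f n else 0) = \sum_(n <- J) f n)%E.
Proof.
move=> f0; pose K := (\max_(n <- J) n).+1.
have JK n : n \in J -> (n < K)%N by move=> nJ; rewrite ltnS; exact: leq_bigmax_seq.
rewrite (nneseries_split 0 K); last by move=> n _; case: ifP.
rewrite [X in (_ + X)%E]eseries0 ?adde0; last first.
  by move=> n; rewrite add0n => Kn _; case: ifPn => // /JK; rewrite ltnNge Kn.
rewrite add0n -big_mkcond/= -big_filter; apply: perm_big.
apply: uniq_perm; rewrite ?filter_uniq ?iota_uniq ?fset_uniq// => n.
rewrite mem_filter mem_index_iota /=; apply/andP/idP => [[]//|nJ].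
by split => //; exact: JK.
Qed.

(** * The martingale property *)

Section martingale.
Context d (Om : measurableType d) (R : realType) (T : ptopologicalType).
Context dU (U : measurableType dU).
Variables (P : probability Om R) (pi0 : probability (borel T) R).
Variables (filt : R -> set (set T)).
Variable pik : R.-pker (measurableTypeR R * borel T)%type ~> borel T.
Variable a : gams Om R T U.
Hypotheses (polT : polish R T) (filtF : level_filtration filt).
Hypotheses (A1 : assumption1 pi0 pik) (A2 : assumption2 filt pi0 pik).
Hypotheses (a3 : assumption3 P filt a) (gf : gams_framework P pi0 filt pik a).

Lemma sum_children q w (r : nat -> R) :
  \sum_(m <- lab a q.+1 w) r (par a q m w) =
  \sum_(n <- lab a q w) (brn a q n w)%:R * r n.
Proof.
pose S := survivors a q w; pose N := newlab a q w.
have SE n : (n \in S) = (n \in lab a q w) && (brn a q n w != 0%N).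
  by rewrite in_fsetD in_fset /= !inE; case: (n \in lab a q w); rewrite /= ?andbT ?andbF.
have perm : perm_eq (lab a q.+1 w) (S ++ N).
  apply: uniq_perm; first exact: fset_uniq.
    rewrite cat_uniq !fset_uniq andbT /= ; apply/hasPn => m mN; apply/negP => mS.
    by have /negP := newlab_notin_lab mN; apply; exact: survivors_lab mS.
  by move=> m; rewrite (lab_next gf) in_fsetU mem_cat.
transitivity (\sum_(m <- S ++ N) r (par a q m w)); first exact: perm_big.
rewrite big_cat/=.
have -> : \sum_(m <- S) r (par a q m w) = \sum_(n <- S) r n.
  by apply: eq_big_seq => m mS; rewrite (par_old gf).
have -> : \sum_(m <- N) r (par a q m w) = \sum_(n <- S) (brn a q n w - 1)%:R * r n.
  transitivity (\sum_(m <- N) \sum_(n <- S | par a q m w == n) r n).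
    apply: eq_big_seq => m mN; have pS : par a q m w \in S by exact: (par_new gf).
    rewrite -big_filter (_ : [seq n <- S | par a q m w == n] = [:: par a q m w]) ?big_seq1//.
    rewrite (eq_filter (a2 := pred1 (par a q m w))); last by move=> n; rewrite /= eq_sym.
    by rewrite filter_pred1_uniq// fset_uniq.
  rewrite (exchange_big_dep predT)//=; apply: eq_big_seq => n nS.
  rewrite -(par_card gf nS) -big_filter big_const_seq count_predT iter_addr addr0.
  rewrite -[LHS]mulr_natl; congr (_%:R * _); apply: perm_size.
  apply: uniq_perm; [by rewrite filter_uniq// fset_uniq|exact: fset_uniq|].
  by move=> m; rewrite mem_filter in_fset /= !inE andbC.
have permS : perm_eq S [seq n <- lab a q w | brn a q n w != 0%N].
  apply: uniq_perm; [exact: fset_uniq|by rewrite filter_uniq// fset_uniq|].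
  by move=> n; rewrite mem_filter SE andbC.
transitivity (\sum_(n <- [seq n <- lab a q w | brn a q n w != 0%N])
  (r n + (brn a q n w - 1)%:R * r n)).
  by rewrite -big_split/=; exact: perm_big.
rewrite big_filter [RHS](bigID (fun n => brn a q n w != 0%N))/=.
rewrite [X in _ + X]big1 ?addr0; last by move=> n /negPn/eqP->; rewrite mul0r.
apply: eq_bigr => n; rewrite -lt0n => B0.
by rewrite natrB// -[X in X + _]mul1r -mulrDl subrKC.
Qed.

Lemma fresh_all q : fresh P pi0 filt pik a q.
Proof.
elim: q => [|q ih]; first exact: fresh0.
by apply: (fresh_succ filtF a3 gf); exact: (fresh_cond_indep polT filtF A1 A2 a3 gf ih).
Qed.

Lemma cond_indep_all q : cond_indep P filt pik a q.
Proof. exact: (fresh_cond_indep polT filtF A1 A2 a3 gf (@fresh_all q)). Qed.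

Lemma Fq_sigma q : sigma_algebra setT (Fq filt a q).
Proof.
have sF (z : R) : <<s Flev filt a q z%:E >> = Flev filt a q z%:E.
  by apply: sigma_algebra_id; exact: Flev_sigma.
split=> [|A [mA FA]|A_ FA].
- by split => // z; rewrite set0I -sF; exact: sigma_algebra0.
- rewrite setTD; split=> [|z]; first exact: measurableC.
  rewrite (_ : _ `&` _ = [set w | lev a q w <= z] `\` (A `&` [set w | lev a q w <= z])).
    by rewrite -sF; apply: gen_setD; apply: sub_sigma_algebra => //; exact: (lev_set a3).
  apply/seteqP; split=> w /=; first by move=> [nA h]; split => // -[].
  by move=> [h nA]; split => // Aw; exact: nA.
- split=> [|z]; first by apply: bigcupT_measurable => i; exact: (FA i).1.
  rewrite setI_bigcupl -sF; apply: sigma_algebra_bigcup => i.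
  by apply: sub_sigma_algebra; exact: (FA i).2.
Qed.

Lemma Fq_id q : <<s Fq filt a q >> = Fq filt a q.
Proof. by apply: sigma_algebra_id; exact: Fq_sigma. Qed.

Lemma wgtx_ge0 q n w : 0 <= wgtx a q n w.
Proof. by rewrite /wgtx; case: ifPn => // /(wgt_ge0 gf). Qed.

Lemma indic_inlab q n w : \1_(inlab a q n) w = (n \in lab a q w)%:R :> R.
Proof. by rewrite indicE; congr ((nat_of_bool _)%:R); apply/idP/idP; rewrite inE. Qed.

Lemma measurable_wgtxT q n : measurable_fun setT (wgtx a q n).
Proof.
apply: (gmeas_measurable (G := Fq filt a q)); first exact: Fq_measurable.
exact: (wgtx_Fq filtF a3 gf).
Qed.

Definition summand q (phi : T -> R) n (w : Om) : \bar R :=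
  (wgtx a q n w * phi (repx a q n w))%:E.

Lemma summand_nnmeas q phi n : M1 phi -> nnmeas (summand q phi n).
Proof.
move=> Mphi; apply: (@nnmeas_EFin _ Om R) => [|w]; last first.
  by have /andP[p0 _] := Mphi.2 (repx a q n w); rewrite mulr_ge0// wgtx_ge0.
apply: measurable_funM; first exact: measurable_wgtxT.
by apply: (measurableT_comp Mphi.1); exact: (measurable_repxT gf).
Qed.

Lemma estimatorE q phi w : M1 phi ->
  ((estimator a q phi w)%:E = \sum_(n <oo) summand q phi n w)%E.
Proof.
move=> Mphi; transitivity (\sum_(n <- lab a q w) summand q phi n w)%E.
  rewrite /estimator -sumEFin; apply: eq_big_seq => n nI.
  by rewrite /summand /wgtx /repx nI.
rewrite -fset_series => [|n]; last exact: (summand_nnmeas q n Mphi).2.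
apply: eq_eseriesr => n _; case: ifPn => // nI.
by rewrite /summand /wgtx (negbTE nI) mul0r.
Qed.

Lemma estimator_nnR q phi : M1 phi -> nnR (estimator a q phi : Om -> R).
Proof.
move=> Mphi; split=> [|w].
  apply/measurable_EFinP; rewrite (_ : EFin \o _ = fun w => \sum_(n <oo) summand q phi n w)%E.
    apply: ge0_emeasurable_sum => n => [w _ _|_]; first exact: (summand_nnmeas q n Mphi).2.
    exact: (summand_nnmeas q n Mphi).1.
  by apply/funext => w; exact: estimatorE.
rewrite -lee_fin estimatorE//; apply: nneseries_ge0 => n _ _.
exact: (summand_nnmeas q n Mphi).2.
Qed.

Lemma integral_estimator q phi A : M1 phi -> measurable A ->
  (\int[P]_w ((\1_A w)%:E * (estimator a q phi w)%:E) =
   \sum_(n <oo) \int[P]_w ((\1_A w)%:E * summand q phi n w))%E.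
Proof.
move=> Mphi mA; have nS n := nnmeasM (nnmeas_indic R mA) (summand_nnmeas q n Mphi).
rewrite -integral_nneseries => [|//|n|n w _]; [|exact: (nS n).1|exact: (nS n).2].
apply: eq_integral => w _; rewrite estimatorE// nneseriesZl// => n _.
exact: (summand_nnmeas q n Mphi).2.
Qed.


Let brnh n (s : sys nat) : R :=
  if insub n is Some j then (projT2 s j)%:R else 0.

Let brnhE q n w : brnh n (brn_sys a q w) = brn0 a q n w.
Proof.
rewrite /brnh /brn0 /=; have [nI|nI] := boolP (n \in lab a q w).
  by rewrite (insubT (fun x => x \in lab a q w) nI).
by rewrite insubF//; exact/negbTE.
Qed.

Lemma measurable_brn0 q n : measurable_fun setT (brn0 a q n : Om -> R).
Proof.
move=> _ B mB; have [_ h _ _] := a3_split a3 q; apply: h; left.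
exists (brnh n @^-1` B) => //.
by rewrite !setTI; apply/seteqP; split => w /=; rewrite brnhE.
Qed.

Lemma brn0_ge0 q n w : 0 <= brn0 a q n w :> R.
Proof. by rewrite /brn0; case: ifP. Qed.

Lemma offspring_mean q n (Y : Om -> R) :
  is_cexp P (Fq filt a q) (brn0 a q n) Y -> {ae P, forall w, n \in lab a q w -> 0 < Y w} ->
  exists kap : Om -> \bar R, [/\ nnmeas (kap : g_sigma_algebraType (Fq filt a q) -> \bar R),
    eqm P (gKnown filt a q) (fun w => (brn0 a q n w)%:E) kap &
    {ae P, forall w, n \in lab a q w -> kap w = (Y w)%:E}].
Proof.
move=> cY Y0.
have [kap [nk ek]] : exists kap : Om -> \bar R,
    nnmeas (kap : g_sigma_algebraType (Fq filt a q) -> \bar R) /\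
    eqm P (gKnown filt a q) (fun w => (brn0 a q n w)%:E) kap.
  have [] := @split_freeze _ _ _ _ _ _ P pi0 filt pik a filtF a3 gf q (fun x => brnh n x.1).
  - by move=> x; rewrite /brnh; case: insub.
  - rewrite (_ : (fun w => _) = brn0 a q n); first exact: measurable_brn0.
    by apply/funext => w; rewrite brnhE.
  move=> kap [nk ek]; exists kap; split => //.
  rewrite (_ : (fun w => _) = (fun w => (brnh n (brn_sys a q w))%:E))//.
  by apply/funext => w; rewrite brnhE.
exists kap; split => //; pose L := inlab a q n.
have gY := cexp_gmeas cY.
have Fm := @Fq_measurable _ Om R T dU U filt a q.
have FK : Fq filt a q `<=` <<s gKnown filt a q >>.
  by move=> A FA; apply: sub_sigma_algebra; left.
have sFK : <<s Fq filt a q >> `<=` <<s gKnown filt a q >>.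
  by apply: smallest_sub => //; exact: smallest_sigma_algebra.
pose f w : R := \1_L w * Num.max (Y w) 0.
pose g w := ((\1_L w)%:E * kap w)%E.
have gf' : gmeas (Fq filt a q) f.
  apply: measurable_funM; first by apply: measurable_indic; exact: (inlab_Fq filtF a3 gf).
  exact: measurable_maxr.
have f0 w : 0 <= f w by rewrite mulr_ge0// le_max lexx orbT.
have ng : nnmeas (g : g_sigma_algebraType (Fq filt a q) -> \bar R).
  by apply: nnmeasM => //; apply: gindic_nnmeas; exact: (inlab_Fq filtF a3 gf).
have gE : {ae P, forall w, g w = (f w)%:E}.
  apply: (cexp_unique Fm gf' f0 ng) => A sA.
  have sAL : <<s Fq filt a q >> (A `&` L) by apply: gen_setI => //; exact: (inlab_Fq filtF a3 gf).
  have mAL : measurable (A `&` L) by exact: gen_measurable sAL.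
  transitivity (\int[P]_w ((\1_(A `&` L) w)%:E * (Y w)%:E))%E.
    rewrite (integral_indicE P A); apply: ae_eq_integral => //.
    - apply: emeasurable_funM; first exact: (nnmeas_indic R (gen_measurable Fm sA)).1.
      by apply/measurable_EFinP; exact: gmeas_measurable gf'.
    - apply: emeasurable_funM; first exact: (nnmeas_indic R mAL).1.
      by apply/measurable_EFinP; exact: gmeas_measurable gY.
    apply: filterS Y0 => w Yw _; rewrite indicI /f -!EFinM /= mulrA; congr EFin.
    rewrite [\1_L w]indicE; have [|_] := boolP (w \in L); last by rewrite !(mulr0, mul0r).
    by rewrite inE => /Yw/ltW h; rewrite max_l.
  have <- := integral_indicE P (A `&` L) (fun w => (Y w)%:E).
  rewrite -(cY.2 (A `&` L)); last by rewrite -Fq_id.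
  rewrite (integral_indicE P (A `&` L)) (integral_indicE P A).
  rewrite (eqm_indic ek (sFK _ sAL)).
  by apply: eq_integral => w _; rewrite indicI EFinM /g muleA.
apply: filterS2 Y0 gE => w Yw gw nI; have := gw.
rewrite /g /f indicE mem_set// mul1e mul1r => ->.
by rewrite max_l// ltW// Yw.
Qed.

Lemma summand_offspring q n (Y : Om -> R) A phi : M1 phi ->
  is_cexp P (Fq filt a q) (brn0 a q n) Y -> {ae P, forall w, n \in lab a q w -> 0 < Y w} ->
  <<s Fq filt a q >> A ->
  (\int[P]_w ((\1_A w)%:E * (brn0 a q n w *
     (wgtx a q n w * powR (Y w) (-1) * Kr pik phi (lev a q w) (repx a q n w)))%:E) =
   \int[P]_w ((\1_A w)%:E * summand q phi n w))%E.
Proof.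
move=> Mphi cY Y0 sA; have gY := cexp_gmeas cY.
have [kap [nk ek kE]] := offspring_mean cY Y0.
have Fm := @Fq_measurable _ Om R T dU U filt a q.
have FK : Fq filt a q `<=` <<s gKnown filt a q >>.
  by move=> B FB; apply: sub_sigma_algebra; left.
have sFK : <<s Fq filt a q >> `<=` <<s gKnown filt a q >>.
  by apply: smallest_sub => //; exact: smallest_sigma_algebra.
have gc : gmeas (Fq filt a q) (fun w => wgtx a q n w * powR (Y w) (-1)).
  exact: (child_wgt_gmeas filtF a3 gf).
pose c w := wgtx a q n w * powR (Y w) (-1).
pose H w := Kr pik phi (lev a q w) (repx a q n w).
have H0 w : 0 <= H w by have /andP[] := Kr01 pik (lev a q w) (repx a q n w) Mphi.
have c0 w : 0 <= c w by rewrite mulr_ge0 ?wgtx_ge0 ?powR_ge0.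
have gH : gmeas (gKnown filt a q) H.
  apply: (@measurable_Kr _ _ pik _ (g_sigma_algebraType (gKnown filt a q))) => //.
    by apply: (gmeas_sub FK); exact: (lev_Fq filtF a3 gf).
  apply: measurable_repx; first by apply: sFK; exact: (inlab_Fq filtF a3 gf).
  by move=> B mB; apply: sub_sigma_algebra; right; exists n, B.
have mA := gen_measurable Fm sA.
transitivity (\int[P]_w ((\1_A w * c w * H w)%:E * (brn0 a q n w)%:E))%E.
  apply: eq_integral => w _; rewrite -!EFinM /c /H; congr EFin.
  by move: (\1_A w) (brn0 _ _ _ _) (powR _ _) (wgtx _ _ _ _) (Kr _ _ _ _) => *; ring.
have nAcH : nnmeas ((fun w => (\1_A w * c w * H w)%:E) :
    g_sigma_algebraType (gKnown filt a q) -> \bar R).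
  apply: nnmeas_EFin => [|w]; last by rewrite mulr_ge0// mulr_ge0.
  apply: measurable_funM => //; apply: measurable_funM; last by apply: (gmeas_sub FK).
  apply: measurable_indic; exact: sFK.
rewrite (ek _ nAcH).
pose V w := ((\1_A w * wgtx a q n w)%:E : \bar R).
have nV : nnmeas (V : g_sigma_algebraType (Fq filt a q `|` gRep a q n) -> \bar R).
  have FG : Fq filt a q `<=` <<s Fq filt a q `|` gRep a q n >>.
    by move=> B FB; apply: sub_sigma_algebra; left.
  apply: nnmeas_EFin => [|w]; last by rewrite mulr_ge0// wgtx_ge0.
  apply: measurable_funM; last by apply: gmeas_sub FG _; exact: (wgtx_Fq filtF a3 gf).
  apply: measurable_indic; move: sA; apply: smallest_sub => //.
  exact: smallest_sigma_algebra.
have ci := @cond_indep_all q n phi [::] Mphi (fun i h => ltac:(by [])) _ nV.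
have mH : measurable_fun setT H.
  by apply: (gmeas_measurable (G := gKnown filt a q)) => //; exact: (gKnown_measurable gf).
transitivity (\int[P]_w (V w * (\1_(inlab a q n) w * H w)%:E))%E.
  have nH : nnmeas (fun w => (V w * (\1_(inlab a q n) w * H w)%:E)%E).
    apply: nnmeasM.
      by case: nV => mV V0; split => //; apply: (gmeas_measurable _ mV) => B [/Fm//|];
        exact: (gRep_measurable gf).
    apply: nnmeas_EFin => [|w]; last by rewrite mulr_ge0.
    by apply: measurable_funM => //; apply: measurable_indic; exact: (measurable_inlab gf).
  have nk' : nnmeas (fun w => ((\1_A w * c w * H w)%:E * kap w)%E).
    apply: nnmeasM; last by case: nk => mk k0; split => //; exact: gmeas_measurable mk.
    by case: nAcH => m m0; split => //; apply: (gmeas_measurable _ m); exact: (gKnown_measurable gf).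
  apply: ge0_ae_eq_integral => //.
  - exact: nk'.1.
  - exact: nH.1.
  - by move=> w _; exact: nk'.2.
  - by move=> w _; exact: nH.2.
  apply: filterS2 Y0 kE => w Yw kw _; rewrite /V indic_inlab.
  have [nI|nI] := boolP (n \in lab a q w).
    rewrite kw// -!EFinM /c mul1r powR_inv1 ?(ltW (Yw nI))//; congr EFin.
    by have Y1 := Yw nI; field; rewrite gt_eqF.
  by rewrite /c /wgtx (negbTE nI) !(mulr0, mul0r, mule0, mul0e).
transitivity (\int[P]_w (V w * (\1_(inlab a q n) w * H w *
    Kprod pik [::] (lev a q w) (repx a q n w))%:E))%E.
  by apply: eq_integral => w _; rewrite /Kprod big_nil mulr1.
rewrite -ci; apply: eq_integral => w _.
rewrite /V /summand /Kprod big_nil mulr1 -!EFinM; congr EFin.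
rewrite -mulrA indic_inlab; have [nI|nI] := boolP (n \in lab a q w).
  by rewrite mul1r.
by rewrite /wgtx (negbTE nI) !(mul0r, mulr0).
Qed.

Lemma estimator_martingale q phi A : M1 phi -> <<s Fq filt a q >> A ->
  (\int[P]_w ((\1_A w)%:E * (estimator a q.+1 phi w)%:E) =
   \int[P]_w ((\1_A w)%:E * (estimator a q phi w)%:E))%E.
Proof.
move=> Mphi sA; have Fm := @Fq_measurable _ Om R T dU U filt a q.
have mA := gen_measurable Fm sA; have n1A := nnmeas_indic R mA.
have [Y YP] := brn_versions a3 q.
pose c n w := wgtx a q n w * powR (Y n w) (-1).
pose H n w := Kr pik phi (lev a q w) (repx a q n w).
pose K m w := Kr pik phi (lev a q w) (parx a q m w).
have mlev : measurable_fun setT (lev a q) by exact: (measurable_levT filtF a3 gf).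
have nnH n : nnR (H n).
  split=> [|w]; last by have /andP[] := Kr01 pik (lev a q w) (repx a q n w) Mphi.
  by apply: measurable_Kr => //; exact: (measurable_repxT gf).
have nnK m : nnR (K m).
  split=> [|w]; last by have /andP[] := Kr01 pik (lev a q w) (parx a q m w) Mphi.
  by apply: measurable_Kr => //; exact: (measurable_parx a3 gf).
have nnc n : nnR (c n).
  split=> [|w]; last by rewrite mulr_ge0 ?wgtx_ge0 ?powR_ge0.
  apply: (gmeas_measurable (G := Fq filt a q)) => //.
  by apply: (child_wgt_gmeas filtF a3 gf); exact: (cexp_gmeas (YP n).1).
have nnM (u v : Om -> R) : nnR u -> nnR v -> nnR (fun w => u w * v w).
  by move=> [mu u0] [mv v0]; split=> [|w]; [exact: measurable_funM|rewrite mulr_ge0].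
have nnw p m : nnR (wgtx a p m) by split; [exact: measurable_wgtxT|exact: wgtx_ge0].
have nnb n : nnR (brn0 a q n : Om -> R) by split; [exact: measurable_brn0|exact: brn0_ge0].
pose lhs m w := (wgtx a q.+1 m w * K m w)%:E.
pose rhs n w := (brn0 a q n w * (c n w * H n w))%:E.
have nl m : nnmeas (lhs m) by apply: nnR_nnmeas; exact: nnM.
have nr n : nnmeas (rhs n) by apply: nnR_nnmeas; apply: (nnM) => //; exact: nnM.
have sum_int (u : nat -> Om -> \bar R) : (forall n, nnmeas (u n)) ->
    (\sum_(n <oo) \int[P]_w ((\1_A w)%:E * u n w) =
     \int[P]_w ((\1_A w)%:E * \sum_(n <oo) u n w))%E.
  move=> nu; rewrite -integral_nneseries => [|//|n|n w _].
  - by apply: eq_integral => w _; rewrite nneseriesZl// => n _; exact: (nu n).2.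
  - exact: (nnmeasM n1A (nu n)).1.
  - exact: (nnmeasM n1A (nu n)).2.
have sum_nn (u : nat -> Om -> \bar R) : (forall n, nnmeas (u n)) ->
    nnmeas (fun w => \sum_(n <oo) u n w)%E.
  move=> nu; split=> [|w]; last by apply: nneseries_ge0 => n _ _; exact: (nu n).2.
  by apply: ge0_emeasurable_sum => n => [w _ _|_]; [exact: (nu n).2|exact: (nu n).1].
rewrite !integral_estimator//.
transitivity (\sum_(m <oo) \int[P]_w ((\1_A w)%:E * lhs m w))%E.
  apply: eq_eseriesr => m _.
  pose V w := ((\1_A w * wgtx a q.+1 m w)%:E : \bar R).
  have nV : nnmeas (V : g_sigma_algebraType (gEnv filt a q.+1 `|` gRep a q.+1 m) -> \bar R).
    apply: nnmeas_EFin => [|w]; last by rewrite mulr_ge0// wgtx_ge0.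
    apply: measurable_funM.
      apply: measurable_indic; move: sA; apply: smallest_sub.
        exact: smallest_sigma_algebra.
      by move=> B FB; apply: sub_sigma_algebra; left; left; left.
    apply: measurable_wgtx => [|D mD].
      by apply: inlab_gen => B LB; apply: sub_sigma_algebra; left; right; left.
    by apply: sub_sigma_algebra; left; right; right; exists m, D.
  transitivity (\int[P]_w (V w * (\1_(inlab a q.+1 m) w * phi (repx a q.+1 m w))%:E))%E.
    apply: eq_integral => w _; rewrite /V /summand -!EFinM indic_inlab; congr EFin.
    have [mI|mI] := boolP (m \in lab a q.+1 w); first by rewrite mul1r mulrA.
    by rewrite /wgtx (negbTE mI) !(mul0r, mulr0).
  rewrite (@fresh_all q.+1 m phi Mphi V nV); apply: eq_integral => w _.
  rewrite /V /lhs indic_inlab; have [mI|mI] := boolP (m \in lab a q.+1 w).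
    rewrite mul1e !EFinM /K KrE// /parx mI /repx (survivors_lab (par_survivors gf mI)).
    by rewrite muleA.
  by rewrite /wgtx (negbTE mI) !(mul0r, mulr0, mul0e, mule0).
rewrite sum_int//; transitivity (\int[P]_w ((\1_A w)%:E * \sum_(n <oo) rhs n w))%E.
  have nL := nnmeasM n1A (sum_nn _ nl); have nR' := nnmeasM n1A (sum_nn _ nr).
  apply: ge0_ae_eq_integral => //; [exact: nL.1|exact: nR'.1| | |].
  - by move=> w _; exact: nL.2.
  - by move=> w _; exact: nR'.2.
  apply: filterS (wgt_next_ae gf YP) => w wE _; congr (_ * _)%E.
  transitivity (\sum_(m <- lab a q.+1 w) lhs m w)%E.
    rewrite -fset_series => [|m]; last exact: (nl m).2.
    apply: eq_eseriesr => m _; case: ifPn => // mI.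
    by rewrite /lhs /wgtx (negbTE mI) mul0r.
  transitivity (\sum_(n <- lab a q w) rhs n w)%E; last first.
    rewrite -fset_series => [|n]; last exact: (nr n).2.
    apply: eq_eseriesr => n _; case: ifPn => // nI.
    by rewrite /rhs /brn0 (negbTE nI) mul0r.
  rewrite !sumEFin; congr EFin.
  transitivity (\sum_(m <- lab a q.+1 w) (c (par a q m w) w * H (par a q m w) w)).
    apply: eq_big_seq => m mI; rewrite {1}/wgtx mI wE//; congr (_ * _).
    by rewrite /K /H /parx mI.
  rewrite (sum_children q w (fun n => c n w * H n w)).
  by apply: eq_big_seq => n nI; rewrite /brn0 nI.
rewrite -sum_int//; apply: eq_eseriesr => n _.
by have [cY Y0] := YP n; exact: summand_offspring.
Qed.

(** * Stopping *)

Lemma sum_wgt0 w : \sum_(n <- lab a 0 w) wgt a 0 n w = 1.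
Proof.
have [k k0 labE] := lab_init gf w.
transitivity (\sum_(n <- lab a 0 w) (#|` lab a 0 w|%:R : R)^-1).
  by apply: eq_big_seq => n; exact: (wgt_init gf).
rewrite big_const_seq count_predT iter_addr addr0 -[LHS]mulr_natl divff//.
rewrite pnatr_eq0 -lt0n cardfs_gt0; apply/fset0Pn; exists 1%N.
by rewrite labE in_fset /= mem_iota/= add1n ltnS.
Qed.

Lemma estimator0 phi : M1 phi ->
  (\int[P]_w (estimator a 0 phi w)%:E = \int[pi0]_x (phi x)%:E)%E.
Proof.
move=> Mphi; have Mc := M1_cst1 R T.
pose c := fine (\int[pi0]_x (phi x)%:E)%E.
have nphi := M1_nnmeas Mphi.
have c0 : 0 <= c by apply: fine_ge0; apply: integral_ge0 => y _; exact: nphi.2.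
have cE : (\int[pi0]_y (phi y)%:E = c%:E)%E.
  rewrite fineK// ge0_fin_numE; last by apply: integral_ge0 => y _; exact: nphi.2.
  apply: le_lt_trans (ltry 1); apply: integral_M1_le1 => //.
  exact: probability_setT.
have intT psi : M1 psi -> (\int[P]_w (estimator a 0 psi w)%:E =
    \sum_(n <oo) \int[P]_w summand 0 psi n w)%E.
  move=> Mpsi; transitivity (\int[P]_w ((\1_[set: Om] w)%:E * (estimator a 0 psi w)%:E))%E.
    by apply: eq_integral => w _; rewrite indicT mul1e.
  rewrite integral_estimator//; apply: eq_eseriesr => n _.
  by apply: eq_integral => w _; rewrite indicT mul1e.
transitivity (c%:E * \int[P]_w (estimator a 0 (cst 1) w)%:E)%E; last first.
  rewrite cE (_ : (\int[P]_w _)%E = 1%E) ?mule1//.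
  transitivity (\int[P]_w (cst 1 w))%E; last first.
    by rewrite integral_cst// mul1e; exact: probability_setT.
  apply: eq_integral => w _; congr EFin; rewrite /estimator -[RHS](sum_wgt0 w).
  by apply: eq_bigr => n _; rewrite mulr1.
rewrite !intT// -nneseriesZl; last first.
  by move=> n _; apply: integral_ge0 => w _; exact: (summand_nnmeas 0 n Mc).2.
apply: eq_eseriesr => n _.
have nV : nnmeas ((fun w => (wgtx a 0 n w)%:E) :
    g_sigma_algebraType (gEnv filt a 0 `|` gRep a 0 n) -> \bar R).
  apply: nnmeas_EFin => [|w]; last exact: wgtx_ge0.
  apply: measurable_wgtx => [|D mD].
    by apply: inlab_gen => B LB; apply: sub_sigma_algebra; left; right; left.
  by apply: sub_sigma_algebra; left; right; right; exists n, D.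
transitivity (\int[P]_w ((wgtx a 0 n w)%:E * (\1_(inlab a 0 n) w * phi (repx a 0 n w))%:E))%E.
  apply: eq_integral => w _; rewrite /summand -!EFinM indic_inlab; congr EFin.
  have [nI|nI] := boolP (n \in lab a 0 w); first by rewrite mul1r.
  by rewrite /wgtx (negbTE nI) !(mul0r, mulr0).
rewrite (@fresh0 _ _ _ _ _ _ P pi0 filt pik a gf n phi Mphi _ nV).
rewrite -ge0_integralZl//.
- apply: eq_integral => w _; rewrite cE /summand -!EFinM indic_inlab; congr EFin.
  have [nI|nI] := boolP (n \in lab a 0 w); first by rewrite mul1r mulr1 mulrC.
  by rewrite /wgtx (negbTE nI) !(mul0r, mulr0).
- exact: (summand_nnmeas 0 n Mc).1.
- by move=> w _; exact: (summand_nnmeas 0 n Mc).2.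
Qed.

Definition running q := [set w | forall j, (j <= q)%N -> go a j w].
Definition stopped q := [set w | Qiter a w = Some q].

Lemma QiterP w q : Qiter a w = Some q <->
  ~~ go a q w /\ forall j, (j < q)%N -> go a j w.
Proof.
rewrite /Qiter; case: pselect => [h|h]; last first.
  by split=> // -[gq _]; exfalso; apply: h; exists q.
case: ex_minnP => m gm mmin; split=> [[<-]|[gq lq]].
  by split => // j jm; apply: contraTT jm => /mmin; rewrite -leqNgt.
congr Some; apply/eqP; rewrite eqn_leq mmin//= leqNgt; apply/negP => mq.
by move: gm; rewrite lq.
Qed.

Lemma running_succ q : running q.+1 = running q `&` [set w | go a q.+1 w].
Proof.
apply/seteqP; split=> w /=.
  by move=> h; split=> [j jq|]; apply: h => //; exact: leqW.
by move=> [h g] j; rewrite leq_eqVlt => /orP[/eqP->//|]; exact: h.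
Qed.

Let go_Fq q : Fq filt a q [set w | go a q w].
Proof.
rewrite (_ : mkset _ = go a q @^-1` [set true]); first exact: (a3_go a3).
by apply/seteqP; split => w.
Qed.

Lemma running_Fq q : <<s Fq filt a q >> (running q).
Proof.
elim: q => [|q ih].
  rewrite (_ : running 0 = [set w | go a 0 w]); first exact: sub_sigma_algebra.
  apply/seteqP; split=> w /=; first exact.
  by move=> g j; rewrite leqn0 => /eqP->.
rewrite running_succ; apply: gen_setI; last exact: sub_sigma_algebra.
by move: ih; apply: sub_sigma_algebra2; exact: (Fq_succ filtF a3 gf).
Qed.

Lemma stopped0 : stopped 0 = setT `\` running 0.
Proof.
apply/seteqP; split=> w /=.
  by move=> /QiterP[g _]; split => // h; move: g; rewrite h.
move=> [_ h]; apply/QiterP; split => //; apply/negP => g; apply: h => j.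
by rewrite leqn0 => /eqP->.
Qed.

Lemma stopped_succ q : stopped q.+1 = running q `\` running q.+1.
Proof.
apply/seteqP; split=> w /=.
  by move=> /QiterP[g h]; split=> // h'; move: g; rewrite h'.
move=> [h h']; apply/QiterP; split => //; apply/negP => g; apply: h'.
by rewrite running_succ.
Qed.

Lemma measurable_running q : measurable (running q).
Proof. exact: (gen_measurable (@Fq_measurable _ Om R T dU U filt a q) (@running_Fq q)). Qed.

Let mstop q : measurable (stopped q).
Proof.
by case: q => [|q]; rewrite ?stopped0 ?stopped_succ; apply: measurableD => //; exact: measurable_running.
Qed.

Definition mass (phi : T -> R) q (A : set Om) : \bar R :=
  (\int[P]_w ((\1_A w)%:E * (estimator a q phi w)%:E))%E.

Lemma mass_split phi q A B : M1 phi -> measurable A -> measurable B -> B `<=` A ->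
  mass phi q A = (mass phi q (A `\` B) + mass phi q B)%E.
Proof.
move=> Mphi mA mB BA; have ne := nnR_nnmeas (estimator_nnR q Mphi).
have n1 := nnmeasM (nnmeas_indic R (measurableD mA mB)) ne.
have n2 := nnmeasM (nnmeas_indic R mB) ne.
rewrite /mass -ge0_integralD//; last 4 first.
- by move=> w _; exact: n1.2.
- exact: n1.1.
- by move=> w _; exact: n2.2.
- exact: n2.1.
apply: eq_integral => w _; rewrite -ge0_muleDl ?lee_fin// -EFinD; congr (_%:E * _)%E.
rewrite !indicE in_setD; have [wB|wB] := boolP (w \in B).
  by rewrite (_ : w \in A) ?add0r//; apply/mem_set/BA; rewrite inE in wB.
by rewrite andbT addr0.
Qed.

Lemma mass_conservation phi N : M1 phi ->
  (\sum_(0 <= k < N.+1) mass phi k (stopped k) + mass phi N (running N) =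
   \int[pi0]_x (phi x)%:E)%E.
Proof.
move=> Mphi; have mr := measurable_running; rewrite -estimator0//; elim: N => [|N ih].
  rewrite big_nat1 stopped0 -mass_split//.
  by apply: eq_integral => w _; rewrite indicT mul1e.
rewrite big_nat_recr//= -addeA stopped_succ -mass_split//; last first.
  by rewrite running_succ => w [].
rewrite -ih; congr (_ + _)%E.
exact: (estimator_martingale Mphi (@running_Fq N)).
Qed.

Lemma final_estimatorE phi w : M1 phi -> ((final_estimator a phi w)%:E =
  \sum_(k <oo) ((\1_(stopped k) w)%:E * (estimator a k phi w)%:E))%E.
Proof.
move=> Mphi; have ne k := (nnR_nnmeas (estimator_nnR k Mphi)).2 w.
rewrite /final_estimator; case E : (Qiter a w) => [q|]; last first.
  by rewrite eseries0// => k _ _; rewrite indicE memNset ?mul0e// /stopped /= E.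
rewrite (eq_eseriesr (g := fun k => (if k \in [fset q]%fset then
    (estimator a k phi w)%:E else 0)%E)).
  by rewrite fset_series// big_seq_fset1.
move=> k _; rewrite inE indicE; have [->|kq] := eqVneq k q.
  by rewrite mem_set ?mul1e.
by rewrite memNset ?mul0e// /stopped /= E => -[qk]; rewrite qk eqxx in kq.
Qed.

Lemma integral_final phi : M1 phi ->
  (forall e : R, 0 < e -> exists N, (mass phi N (running N) <= e%:E)%E) ->
  (\int[P]_w (final_estimator a phi w)%:E = \int[pi0]_x (phi x)%:E)%E.
Proof.
move=> Mphi small.
have nm k := nnmeasM (nnmeas_indic R (mstop k)) (nnR_nnmeas (estimator_nnR k Mphi)).
have m0 k : (0 <= mass phi k (stopped k))%E by apply: integral_ge0 => w _; exact: (nm k).2.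
have m1 k : (0 <= mass phi k (running k))%E.
  apply: integral_ge0 => w _; apply: mule_ge0; first by rewrite lee_fin.
  exact: (nnR_nnmeas (estimator_nnR k Mphi)).2.
transitivity (\sum_(k <oo) mass phi k (stopped k))%E.
  rewrite -integral_nneseries => [|//|k|k w _]; [|exact: (nm k).1|exact: (nm k).2].
  by apply: eq_integral => w _; exact: final_estimatorE.
apply/eqP; rewrite eq_le; apply/andP; split.
  apply: lime_le; first by apply: is_cvg_nneseries => k _ _; exact: m0.
  near=> N; rewrite -(mass_conservation N Mphi).
  rewrite big_nat_recr//= -addeA leeDl//; exact: adde_ge0.
apply/lee_addgt0Pr => e e0; have [N hN] := small e e0.
rewrite -(mass_conservation N Mphi); apply: leeD => //.
exact: nneseries_lim_ge.
Unshelve. all: by end_near. Qed.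

Lemma final_estimator_nnR phi : M1 phi -> nnR (final_estimator a phi : Om -> R).
Proof.
move=> Mphi.
have nm k := nnmeasM (nnmeas_indic R (mstop k)) (nnR_nnmeas (estimator_nnR k Mphi)).
split=> [|w].
  apply/measurable_EFinP; rewrite (_ : EFin \o _ = fun w => \sum_(k <oo)
      ((\1_(stopped k) w)%:E * (estimator a k phi w)%:E))%E.
    apply: ge0_emeasurable_sum => n => [w _ _|_]; first exact: (nm n).2.
    exact: (nm n).1.
  by apply/funext => w; exact: final_estimatorE.
rewrite -lee_fin final_estimatorE//; apply: nneseries_ge0 => n _ _.
exact: (nm n).2.
Qed.


Lemma running_null_bounded phi N : M1 phi ->
  {ae P, forall w, exists2 q, Qiter a w = Some q & (q <= N)%N} ->
  mass phi N (running N) = 0%E.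
Proof.
move=> Mphi QN; rewrite -[RHS](@integral0 _ Om R P setT).
have nm := nnmeasM (nnmeas_indic R (measurable_running N)) (nnR_nnmeas (estimator_nnR N Mphi)).
apply: ge0_ae_eq_integral => //; [exact: nm.1|by move=> w _; exact: nm.2|].
apply: filterS QN => w [q /QiterP[gq _] qN] _.
by rewrite indicE memNset ?mul0e// => /(_ q qN); exact/negP.
Qed.

Lemma running_cvg0 : P [set w | exists q, Qiter a w = Some q] = 1%E ->
  P (running N) @[N --> \oo] --> 0%E.
Proof.
move=> PQ; have mI : measurable (\bigcap_N running N).
  by apply: bigcapT_measurable => i; exact: measurable_running.
have <- : P (\bigcap_N running N) = 0%E.
  apply/eqP; rewrite -measure_le0; apply: (@le_trans _ _ (P (~` \bigcup_q stopped q))).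
    apply: le_measure; rewrite ?inE//.
      by apply: measurableC; exact: bigcupT_measurable.
    move=> w h [q _ /QiterP[gq _]].
    by move: gq; rewrite (h q Logic.I q).
  rewrite probability_setC; last exact: bigcupT_measurable.
  rewrite (_ : \bigcup_q stopped q = [set w | exists q, Qiter a w = Some q]).
    by rewrite (PQ : P _ = 1%E) subee.
  by apply/seteqP; split=> w [q]; exists q.
apply: nonincreasing_cvg_mu => //.
- by rewrite ltey_eq fin_num_measure//; exact: measurable_running.
- exact: measurable_running.
move=> m n mn; apply/subsetPset => w h j jm; apply: h; exact: leq_trans mn.
Qed.

Lemma mass_le_prob phi N : M1 phi ->
  {ae P, forall w, \sum_(n <- lab a N w) wgt a N n w = 1} ->
  (mass phi N (running N) <= P (running N))%E.
Proof.
move=> Mphi W1; have nE := nnR_nnmeas (estimator_nnR N Mphi).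
have n1 := nnmeas_indic R (measurable_running N); have nm := nnmeasM n1 nE.
have -> : (P (running N) = \int[P]_w (\1_(running N) w)%:E)%E.
  by rewrite integral_indic ?setIT//; exact: measurable_running.
apply: (ae_ge0_le_integral measurableT _ nm.1 _ n1.1).
- by move=> w _; exact: nm.2.
- by move=> w _; exact: n1.2.
apply: filterS W1 => w sw _; rewrite -[leRHS]mule1 lee_wpmul2l// ?lee_fin//.
rewrite -sw /estimator big_seq [leRHS]big_seq; apply: ler_sum => n nI.
by have /andP[p0 p1] := Mphi.2 (rep a N n w); rewrite ler_piMr// (wgt_ge0 gf).
Qed.

End martingale.

Lemma integral_affine d (X : measurableType d) (R : realType)
    (mu : {measure set X -> \bar R}) (f g : X -> R) (c k : R) :
  mu.-integrable setT (EFin \o f) -> mu.-integrable setT (EFin \o g) ->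
  (\int[mu]_x (c * f x - k * g x)%:E =
   c%:E * \int[mu]_x (f x)%:E - k%:E * \int[mu]_x (g x)%:E)%E.
Proof.
move=> If Ig; rewrite -!integralZl// -integralB//; last 2 first.
- exact: integrableZl.
- exact: integrableZl.
Qed.

Theorem theorem4p1 (R : realType) (d : measure_display) (Om : measurableType d)
    (P : probability Om R) (T : ptopologicalType)
    (pi0 : probability (borel T) R) (filt : R -> set (set T))
    (pik : R.-pker (measurableTypeR R * borel T)%type ~> borel T)
    (dU : measure_display) (U : measurableType dU) (a : gams Om R T U) :
  polish R T ->
  level_filtration filt ->
  assumption1 pi0 pik ->
  assumption2 filt pi0 pik ->
  assumption3 P filt a ->
  gams_framework P pi0 filt pik a ->
  P [set w | exists q, Qiter a w = Some q] = 1%E ->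
  (exists N : nat, {ae P, forall w, exists2 q, Qiter a w = Some q & (q <= N)%N})
  \/ (forall q, {ae P, forall w, \sum_(n <- lab a q w) wgt a q n w = 1}) ->
  forall phi : borel T -> R, measurable_fun setT phi -> bounded_fun phi ->
    ('E_P[final_estimator a phi] = \int[pi0]_x (phi x)%:E)%E.
Proof.
move=> polT filtF A1 A2 a3 gf PQ bounded_or_conserved phi mphi bphi.
have M1_final psi : M1 psi ->
    (\int[P]_w (final_estimator a psi w)%:E = \int[pi0]_x (psi x)%:E)%E.
  move=> Mpsi; apply: (integral_final polT filtF A1 A2 a3 gf Mpsi) => e e0.
  have [[N QN]|W1] := bounded_or_conserved.
    by exists N; rewrite (running_null_bounded filtF a3 gf Mpsi QN) lee_fin ltW.
  have /fine_cvgP[_ /cvgrPdist_le/(_ e e0)[N _ hN]] := running_cvg0 filtF a3 gf PQ.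
  exists N; apply: (le_trans (mass_le_prob filtF a3 gf Mpsi (W1 N))).
  have := hN N (leqnn N); rewrite /= sub0r normrN ger0_norm ?fine_ge0//.
  by rewrite -lee_fin fineK// fin_num_measure//; exact: (measurable_running filtF a3 gf).
have [M M0 phiM] : exists2 M : R, 0 < M & forall x, `|phi x| <= M.
  case: bphi => B [_ hB]; exists (Num.max (B + 1) 1); first by rewrite lt_max ltr01 orbT.
  by move=> x; apply: hB => //; rewrite lt_max ltrDl ltr01.
pose psi x := (phi x + M) / (2 * M).
have Mpsi : M1 (psi : T -> R).
  split=> [|x].
    by apply: measurable_funM => //; exact: measurable_funD.
  have := phiM x; rewrite ler_norml => /andP[l1 l2].
  rewrite divr_ge0/=; [|lra|lra].
  by rewrite ler_pdivrMr; lra.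
have phiE x : phi x = 2 * M * psi x - M * 1.
  by rewrite /psi mulr1; field; rewrite gt_eqF.
have fin (psi' : T -> R) : M1 psi' -> (\int[pi0]_x (psi' x)%:E < +oo)%E.
  move=> Mp; apply: le_lt_trans (ltry 1); apply: integral_M1_le1 => //.
  exact: probability_setT.
have intT (psi' : T -> R) : M1 psi' -> pi0.-integrable [set: borel T] (EFin \o psi').
  move=> Mp; have [m p0] := M1_nnmeas Mp; apply/integrableP; split => //.
  under eq_integral do rewrite gee0_abs ?p0//.
  exact: fin.
have intF (psi' : T -> R) : M1 psi' -> P.-integrable setT (EFin \o final_estimator a psi').
  move=> Mp; have [m p0] := nnR_nnmeas (final_estimator_nnR filtF a3 gf Mp).
  apply/integrableP; split => //; under eq_integral do rewrite gee0_abs ?p0//.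
  by rewrite M1_final//; exact: fin.
have finalE w : final_estimator a phi w =
    2 * M * final_estimator a psi w - M * final_estimator a (cst 1) w.
  rewrite /final_estimator; case: (Qiter a w) => [q|]; last by rewrite !mulr0 subr0.
  rewrite /estimator !mulr_sumr -sumrB; apply: eq_bigr => n _.
  by rewrite phiE /=; ring.
rewrite unlock; under eq_integral do rewrite finalE.
under [RHS]eq_integral do rewrite phiE.
rewrite integral_affine; [|exact: intF|exact/intF/M1_cst1].
rewrite [RHS](@integral_affine _ (borel T) R pi0 psi (cst 1)); [|exact: intT|exact/intT/M1_cst1].
by rewrite !M1_final//; exact: M1_cst1.
Qed.
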